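(* Let $\ell\ge1$ and consider $\dot I=\varepsilon h(I,\theta;\varepsilon)$, $\dot\theta=\omega(I)+\varepsilon g(I,\theta;\varepsilon)$, $(I,\theta)\in\mathbb R^\ell\times\mathbb S^1$, with $h,\omega,g$ real-analytic in $(I,\theta,\varepsilon)$ and $\omega$ scalar. Let $I_0\in\mathbb R^\ell$ and $U$ a neighborhood of $I_0$. If $\omega(I)\ne0$ and $\hat h_0(I)\ne0$ for some $I\in U$, then the system does not have $\ell$ real-analytic first integrals in a neighborhood of $\{I_0\}\times\mathbb S^1$ near $\varepsilon=0$ that are functionally independent for $|\varepsilon|\neq0$ and depend analytically on $\varepsilon$.
   Context: $\mathbb S^1=\mathbb R/2\pi\mathbb Z$; $\hat h_0(I)=\frac{1}{2\pi}\int_0^{2\pi}h(I,\theta;0)\,d\theta$ is the zeroth Fourier coefficient of $h(I,\theta;0)$. Functions are functionally independent if their differentials are linearly independent almost everywhere. *)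

(* Defs.v *)
From HB Require Import structures.
From mathcomp Require Import all_boot all_order all_algebra.
From mathcomp Require Import all_classical all_reals all_analysis.
Set Implicit Arguments. Unset Strict Implicit. Unset Printing Implicit Defensive.
Import Order.TTheory GRing.Theory Num.Theory.
Import numFieldNormedType.Exports.
Local Open Scope classical_set_scope.
Local Open Scope ring_scope.

Section Defs.
Variable R : realType.

Definition monom (n : nat) (x0 x : 'rV[R]_n) (a : {ffun 'I_n -> nat}) : R :=
  \prod_(i < n) (x ord0 i - x0 ord0 i) ^+ a i.

(* multi-indices of total degree k, enumerated as {ffun 'I_n -> 'I_k.+1} *)
Definition mi_of (n k : nat) (a : {ffun 'I_n -> 'I_k.+1}) : {ffun 'I_n -> nat} :=
  [ffun i => nat_of_ord (a i)].

Definition hom_part (n : nat) (c : {ffun 'I_n -> nat} -> R) (x0 x : 'rV[R]_n)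
  (k : nat) : R :=
  \sum_(a : {ffun 'I_n -> 'I_k.+1} | (\sum_(i < n) (a i : nat))%N == k)
     c (mi_of a) * monom x0 x (mi_of a).

Definition abs_hom_part (n : nat) (c : {ffun 'I_n -> nat} -> R) (x0 x : 'rV[R]_n)
  (k : nat) : R :=
  \sum_(a : {ffun 'I_n -> 'I_k.+1} | (\sum_(i < n) (a i : nat))%N == k)
     `|c (mi_of a) * monom x0 x (mi_of a)|.

Definition analytic_at (n : nat) (f : 'rV[R]_n -> R) (x0 : 'rV[R]_n) : Prop :=
  exists r : R, 0 < r /\
  exists c : {ffun 'I_n -> nat} -> R,
    forall x : 'rV[R]_n, (forall i, `|x ord0 i - x0 ord0 i| < r) ->
      cvg (series (abs_hom_part c x0 x) @ \oo) /\
      series (hom_part c x0 x) @ \oo --> f x.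

Definition analytic_on (n : nat) (D : set 'rV[R]_n) (f : 'rV[R]_n -> R) : Prop :=
  forall x, D x -> analytic_at f x.

Definition pack3 (l : nat) (I : 'rV[R]_l) (t e : R) : 'rV[R]_(l + 2) :=
  row_mx I (\row_(j < 2) (if j == ord0 then t else e)).
Definition fstI (l : nat) (z : 'rV[R]_(l + 2)) : 'rV[R]_l := lsubmx z.
Definition thetaof (l : nat) (z : 'rV[R]_(l + 2)) : R := rsubmx z ord0 ord0.
Definition epsof (l : nat) (z : 'rV[R]_(l + 2)) : R := rsubmx z ord0 (@Ordinal 2 1 isT).

Definition analytic3 (l : nat) (D : 'rV[R]_l -> R -> R -> Prop)
  (F : 'rV[R]_l -> R -> R -> R) : Prop :=
  analytic_on [set z | D (fstI z) (thetaof z) (epsof z)]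
              (fun z => F (fstI z) (thetaof z) (epsof z)).

Definition box_vol (m : nat) (a b : 'rV[R]_m) : R := \prod_(i < m) (b ord0 i - a ord0 i).

Definition leb_null (m : nat) (N : set 'rV[R]_m) : Prop :=
  forall delta : R, 0 < delta ->
  exists a b : nat -> 'rV[R]_m,
    (forall k i, a k ord0 i <= b k ord0 i) /\
    (forall x, N x -> exists k, forall i, a k ord0 i <= x ord0 i <= b k ord0 i) /\
    (forall K, \sum_(k < K) box_vol (a k) (b k) <= delta).

Definition evec (l : nat) (i : 'I_l) : 'rV[R]_l := \row_(j < l) (if j == i then 1 else 0).

Definition dI (l : nat) (F : 'rV[R]_l -> R -> R -> R) (i : 'I_l) (I : 'rV[R]_l) (t e : R) : R :=
  derive (fun J => F J t e) I (evec i).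

Definition dtheta (l : nat) (F : 'rV[R]_l -> R -> R -> R) (I : 'rV[R]_l) (t e : R) : R :=
  derive1 (fun s => F I s e) t.

Definition dIth (l : nat) (F : 'I_l -> 'rV[R]_l -> R -> R -> R) (I : 'rV[R]_l) (t e : R)
  : 'M[R]_(l, l + 1) :=
  \matrix_(j < l, k < l + 1)
    match fintype.split k with
    | inl i => dI (F j) i I t e
    | inr _ => dtheta (F j) I t e
    end.

Definition hhat0 (l : nat) (h : 'rV[R]_l -> R -> R -> 'I_l -> R) (I : 'rV[R]_l) : 'rV[R]_l :=
  \row_(i < l) ((2 * pi)^-1 *
      Rintegral (@lebesgue_measure R) `[0, 2 * pi]%classic (fun t => h I t 0 i)).

Definition first_integral (l : nat) (h : 'rV[R]_l -> R -> R -> 'I_l -> R)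
  (omega : 'rV[R]_l -> R) (g : 'rV[R]_l -> R -> R -> R)
  (D : 'rV[R]_l -> R -> R -> Prop) (F : 'rV[R]_l -> R -> R -> R) : Prop :=
  forall I t e, D I t e ->
    \sum_(i < l) dI F i I t e * (e * h I t e i) + dtheta F I t e * (omega I + e * g I t e) = 0.

End Defs.

(* Main.v *)
(** Restrict to a point [p] with [omega p != 0] and nonzero averaged field.  Along
    [dI/dtheta = eps * h / (omega + eps * g)] the Picard iterates [x_N(theta, eps)]
    with [x_N(theta1) = p] satisfy, for the shift [Delta] by one period,
    [Delta^j x_N = O(eps^j)]: a power series preserves this property, and integrating over
    one period gains a factor [eps].  A first integral [F] is constant up to
    [O(eps^(N+1))] along [n |-> x_N(theta1 + 2 n pi)], [0 <= n <= N].  Interpolating these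
    points by a polynomial in [n], whose coefficient of degree [j] is [O(eps^j)], and
    extracting the linear coefficient of [F] along it gives
    [dF(p, theta1, eps) . eta = O(eps^N)] with
    [eta = eps * 2 pi * hhat0(p) / omega(p) + O(eps^2)], the same [eta] for all first
    integrals.  With [l] of them, Cramer's rule makes the Jacobian determinant in [I] flat at
    [eps = 0], hence zero by analyticity.  But [p] and [theta1] can be chosen, off a null
    set, such that this determinant does not vanish for some [eps > 0]. *)

Require Import Defs.
From HB Require Import structures.
From mathcomp Require Import all_boot all_order all_algebra.
From mathcomp Require Import all_classical all_reals all_analysis.
From mathcomp Require Import measurable_realfun.
From mathcomp Require Import ring lra zify.
Import Order.TTheory GRing.Theory Num.Theory.
Import numFieldNormedType.Exports.
Set Implicit Arguments. Unset Strict Implicit. Unset Printing Implicit Defensive.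
Local Open Scope classical_set_scope.
Local Open Scope ring_scope.

(** * Real analysis *)

Section RealTools.
Variable R : realType.
Implicit Types (f u : R -> R) (x t C q : R).

(** The obstacle is the passage from a discrete conservation law to a differential one. A first
    integral is constant on the orbit of [p] under the period map, but the increment over one period
    differs from the right direction by O(eps^2), so differentiating along it gives only a low-order
    relation. The polynomial interpolating the orbit acts as a formal flow through the period map:
    its velocity at n = 0 is [eta], it depends on the orbit alone, and it corrects the direction to
    any order. A polynomial in n that is constant at n = 0, ..., N up to O(eps^(N+1)) has a linear
    coefficient of that size provided its coefficients beyond degree N are equally small, which is
    what the bounds on iterated differences guarantee. Each order N takes finitely many Picard
    steps, so approximate solutions with explicit errors suffice. Independence enters through linear
    algebra: where omega + eps g is nonzero, the equation of a first integral expresses its theta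
    derivative by its I derivatives, so a Jacobian of rank l in (I, theta) has an invertible block
    in I. *)

Lemma cvgn_dist (u : nat -> R) (l : R) :
  (forall e, 0 < e -> exists N, forall n, (N <= n)%N -> `|l - u n| <= e) -> u @ \oo --> l.
Proof.
move=> H; apply/cvgrPdist_le => e e0.
have [N HN] := H e e0.
by exists N.
Qed.

Lemma cvgn_distE (u : nat -> R) (l e : R) : u @ \oo --> l -> 0 < e ->
  exists N, forall n, (N <= n)%N -> `|l - u n| <= e.
Proof.
move=> /cvgrPdist_le H e0; have [N _ HN] := H e e0.
by exists N.
Qed.

Lemma cvgn_bound (u : nat -> R) (l a B : R) (N : nat) : u @ \oo --> l ->
  (forall n, (N <= n)%N -> `|u n - a| <= B) -> `|l - a| <= B.
Proof.
move=> ul H; apply/ler_addgt0Pr => e e0.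
have [M HM] := cvgn_distE ul e0.
have := HM (maxn N M) (leq_maxr _ _).
have := H (maxn N M) (leq_maxl _ _).
set v := u _.
have -> : l - a = (l - v) + (v - a) by ring.
move=> h1 h2; apply: (le_trans (ler_normD _ _)); lra.
Qed.

Lemma series_diff_geo (u : nat -> R) C q : 0 <= C -> 0 <= q <= 2^-1 ->
  (forall k, `|u k| <= C * q ^+ k) ->
  forall N n, (N <= n)%N -> `|series u n - series u N| <= 2 * C * q ^+ N.
Proof.
move=> C0 /andP[q0 q1] Hu N n /subnK <-; move: (n - N)%N => d {n}.
have qN k : 0 <= q ^+ k by apply: exprn_ge0.
(* The term subtracted on the right strengthens the bound so that the induction on [d] closes: with
   q <= 1/2 the decrease of 2 C q^k in one step is at least C q^k. *)
suff : `|series u (d + N)%N - series u N| <= 2 * C * q ^+ N - 2 * C * q ^+ (d + N).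
  move=> h; apply: (le_trans h); rewrite lerBlDr lerDl.
  by rewrite !mulr_ge0.
elim: d => [|d IH]; first by rewrite add0n !subrr normr0.
have -> : series u (d.+1 + N)%N - series u N =
   (series u (d + N)%N - series u N) + u (d + N)%N.
  by rewrite addSn seriesSr; ring.
apply: (le_trans (ler_normD _ _)).
apply: (le_trans (lerD IH (Hu _))).
rewrite addSn exprS.
have := qN (d + N)%N; move: (q ^+ (d + N)) => X X0.
have : 0 <= C * X by rewrite mulr_ge0.
rewrite -subr_ge0 => h.
have -> : 2 * C * q ^+ N - 2 * C * X + C * X = 2 * C * q ^+ N - C * X by ring.
rewrite lerB //.
have -> : 2 * C * (q * X) = 2 * q * (C * X) by ring.
rewrite -[leRHS]mul1r; apply: ler_wpM2r; first by rewrite mulr_ge0.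
lra.
Qed.

Lemma series_tail_geo (u : nat -> R) C q l : 0 <= C -> 0 <= q <= 2^-1 ->
  (forall k, `|u k| <= C * q ^+ k) -> series u @ \oo --> l ->
  forall N, `|l - series u N| <= 2 * C * q ^+ N.
Proof.
move=> C0 q01 Hu ul N; apply: (@cvgn_bound _ _ _ _ N ul) => n.
exact: series_diff_geo.
Qed.

Lemma geo_to0 C e : 0 < e -> exists N, forall n, (N <= n)%N -> C * 2^-1 ^+ n <= e.
Proof.
move=> e0.
have h : `|2^-1 : R| < 1 by rewrite ger0_norm; lra.
have [N HN] := cvgn_distE (@cvg_geometric R C _ h) e0.
exists N => n /HN; rewrite sub0r normrN => h2; apply: le_trans h2.
by rewrite /geometric /= ler_norm.
Qed.

Lemma cvgn_geo (u : nat -> R) l C : 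
  (forall n, `|l - u n| <= C * 2^-1 ^+ n) -> u @ \oo --> l.
Proof.
move=> H; apply: cvgn_dist => e e0.
have [N HN] := geo_to0 C e0.
by exists N => n /HN; apply: le_trans.
Qed.

Lemma series_geo_cvg (u : nat -> R) C q : 0 <= C -> 0 <= q <= 2^-1 ->
  (forall k, `|u k| <= C * q ^+ k) -> exists l : R, series u @ \oo --> l.
Proof.
move=> C0 q01 Hu; exists (limn (series u)); apply: normed_cvg.
apply: (@series_le_cvg _ (fun n => `|u n|) (geometric C q)) => [n|n|n|].
- exact: normr_ge0.
- by rewrite /geometric /= mulr_ge0 // exprn_ge0 //; case/andP: q01.
- exact: Hu.
- by apply: is_cvg_geometric_series; rewrite ger0_norm; case/andP: q01 => //; lra.
Qed.

(** Compactness of [[A, B]], by the supremum of the reachable endpoints. In this form, for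
    properties of intervals that can be concatenated, it serves analytic continuation, parameter
    integrals and uniformity in t. *)
Lemma cousin (P : R -> R -> Prop) (A B : R) :
  (forall a b c, a <= b <= c -> P a b -> P b c -> P a c) ->
  (forall x, A <= x <= B -> exists r, 0 < r /\
     forall a b, `|a - x| < r -> `|b - x| < r -> a <= b -> A <= a -> b <= B -> P a b) ->
  A <= B -> P A B.
Proof.
move=> Ptr Ploc AB.
pose S := [set x | A <= x <= B /\ P A x].
have SA : S A.
  split; first by rewrite lexx AB.
  have [|r [r0 H]] := Ploc A; first by rewrite lexx AB.
  by apply: H; rewrite ?subrr ?normr0 ?lexx.
have hsS : has_sup S.
  split; first by exists A.
  by exists B => x [/andP[_ ]].
pose s := sup S.
have sA : A <= s by apply: sup_upper_bound.
have sB : s <= B by apply: ge_sup; [exists A | move=> x [/andP[_ ]]].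
have [|r [r0 H]] := Ploc s; first by rewrite sA sB.
have [y [/andP[yA yB] Py] ys] := sup_adherent r0 hsS.
have ys' : y <= s by apply: sup_upper_bound => //; split => //; rewrite yA.
pose z := Num.min B (s + r / 2).
have sz : s <= z by rewrite /z le_min sB /=; lra.
have zB : z <= B by rewrite /z ge_min lexx.
have zr : z <= s + r / 2 by rewrite /z ge_min lexx orbT.
have Sz : S z.
  split; first by rewrite zB (le_trans sA sz).
  apply: (Ptr A y z) => //; first by rewrite yA (le_trans ys' sz).
  apply: H => //.
  - rewrite ler0_norm; rewrite -/s in ys; lra.
  - rewrite ger0_norm; lra.
  - exact: le_trans ys' sz.
have zs : z <= s by apply: sup_upper_bound.
suff : z = B by move=> <-; case: Sz.
move: zs; rewrite /z /Num.min; case: ifP => // _; lra.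
Qed.

(** The remainder form lets derivatives be read off from Taylor estimates, as in [hasd_sq]. *)
Definition hasd f x d := forall e : R, 0 < e -> exists r : R, 0 < r /\
  forall s, `|s| < r -> `|f (x + s) - f x - d * s| <= e * `|s|.

Lemma hasd_is_derive f x d : hasd f x d -> is_derive x 1 f d.
Proof.
move=> H.
have cv : (fun h : R => h^-1 *: ((f \o shift x) (h *: 1) - f x)) @ 0^' --> d.
  apply/cvgrPdist_le => e e0.
  have [r [r0 Hr]] := H e e0.
  near=> h.
  have h0 : h != 0 by near: h; apply: nbhs_dnbhs_neq.
  have hr : `|h| < r.
    near: h; apply: dnbhs0_lt => //.
  have := Hr h hr.
  rewrite /= /GRing.scale /= mulr1 [h + x]addrC => h1.
  have -> : d - h^-1 * (f (x + h) - f x) = - (h^-1 * (f (x + h) - f x - d * h)).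
    by field.
  rewrite normrN normrM normfV mulrC ler_pdivrMr ?normr_gt0 //.
split; first by apply: cvgP; exact: cv.
by rewrite /derive; apply: cvg_lim.
Unshelve. all: by end_near.
Qed.

Lemma is_derive_hasd f x d : is_derive x 1 f d -> hasd f x d.
Proof.
case=> df vf e e0.
have : (fun h : R => h^-1 *: ((f \o shift x) (h *: 1) - f x)) @ 0^' --> d.
  by rewrite -vf; exact: df.
move=> /cvgrPdist_le /(_ e e0) /nbhs_ballP [r /= r0 Hr].
exists r; split => // s sr.
have [->|s0] := eqVneq s 0; first by rewrite addr0 subrr mulr0 subrr normr0 mulr0.
have := Hr s; rewrite /ball /= sub0r normrN => /(_ sr s0).
rewrite /= /GRing.scale /= mulr1 [s + x]addrC => h1.
have -> : f (x + s) - f x - d * s = - (d - s^-1 * (f (x + s) - f x)) * s.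
  by field.
by rewrite normrM normrN; apply: ler_wpM2r.
Qed.

Lemma hasd_cont f x d : hasd f x d -> {for x, continuous f}.
Proof.
move=> /hasd_is_derive [df _]; apply: differentiable_continuous.
exact/derivable1_diffP.
Qed.

Lemma hasd_cst c x : hasd (fun _ => c) x 0.
Proof. by move=> e e0; exists 1; split=> // s _; rewrite subrr mul0r subr0 normr0 mulr_ge0 // ltW. Qed.

Lemma hasd_D f g x d d' : hasd f x d -> hasd g x d' ->
  hasd (fun y => f y + g y) x (d + d').
Proof.
move=> Hf Hg e e0.
have e2 : 0 < e / 2 by lra.
have [r [r0 Hr]] := Hf _ e2; have [r' [r0' Hr']] := Hg _ e2.
exists (Num.min r r'); split; first by rewrite lt_min r0.
move=> s; rewrite lt_min => /andP[/Hr h1 /Hr' h2].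
have -> : f (x + s) + g (x + s) - (f x + g x) - (d + d') * s =
  (f (x + s) - f x - d * s) + (g (x + s) - g x - d' * s) by ring.
apply: (le_trans (ler_normD _ _)); lra.
Qed.

Lemma hasd_Z f x d c : hasd f x d -> hasd (fun y => c * f y) x (c * d).
Proof.
move=> Hf e e0.
have c1 : 0 < `|c| + 1 by rewrite ltr_pwDr.
have e2 : 0 < e / (`|c| + 1) by rewrite divr_gt0.
have [r [r0 Hr]] := Hf _ e2; exists r; split => // s /Hr h.
have -> : c * f (x + s) - c * f x - c * d * s = c * (f (x + s) - f x - d * s) by ring.
rewrite normrM; apply: (@le_trans _ _ (`|c| * (e / (`|c| + 1) * `|s|))).
  exact: ler_wpM2l.
rewrite mulrA; apply: ler_wpM2r => //.
rewrite mulrCA ger_pMr // ler_pdivrMr // mul1r; lra.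
Qed.

Lemma hasd_B f g x d d' : hasd f x d -> hasd g x d' ->
  hasd (fun y => f y - g y) x (d - d').
Proof.
move=> Hf /(hasd_Z (-1)) Hg.
have := hasd_D Hf Hg; rewrite mulN1r => H e /H [r [r0 h]].
by exists r; split => // s /h; rewrite !mulN1r.
Qed.

Lemma hasd_shift f x a d : hasd f (x + a) d -> hasd (fun y => f (y + a)) x d.
Proof.
move=> H e /H [r [r0 h]]; exists r; split => // s /h.
by have -> : x + a + s = x + s + a by ring.
Qed.

Lemma hasd_sum (I : finType) (P : pred I) (F : I -> R -> R) (D : I -> R) x :
  (forall i, hasd (F i) x (D i)) ->
  hasd (fun y => \sum_(i | P i) F i y) x (\sum_(i | P i) D i).
Proof.
move=> H; elim: (index_enum I) => [|i s IH].
  have := hasd_cst 0 x => h e /h [r [r0 h']]; exists r; split => // y /h'.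
  by rewrite !big_nil.
have [Pi|Pi] := boolP (P i).
  have := hasd_D (H i) IH => h e /h [r [r0 h']]; exists r; split => // y /h'.
  by rewrite !big_cons Pi.
have := IH => h e /h [r [r0 h']]; exists r; split => // y /h'.
by rewrite !big_cons (negbTE Pi).
Qed.

Lemma hasd_bound f df a b K : a <= b ->
  (forall x, a <= x <= b -> hasd f x (df x)) ->
  (forall x, a <= x <= b -> `|df x| <= K) -> `|f b - f a| <= K * (b - a).
Proof.
move=> ab Hd Hb.
have [||c] := @MVT_segment R f df a b ab.
- move=> x; rewrite in_itv /= => /andP[/ltW h1 /ltW h2].
  by apply: hasd_is_derive; apply: Hd; rewrite h1 h2.
- apply: derivable_within_continuous => x; rewrite in_itv /= => h.
  by have [] := hasd_is_derive (Hd x h).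
- rewrite in_itv /= => h ->; rewrite normrM (ger0_norm (x := b - a)) ?subr_ge0 //.
  by apply: ler_wpM2r; rewrite ?subr_ge0 // Hb.
Qed.

Lemma hasd_const f a b : a <= b -> (forall x, a <= x <= b -> hasd f x 0) -> f a = f b.
Proof.
move=> ab H; have := @hasd_bound f (fun _ => 0) a b 0 ab H.
rewrite mul0r normr0 => /(_ (fun _ _ => lexx _)).
by rewrite normr_le0 subr_eq0 => /eqP.
Qed.

Lemma Rintegral_hasd f F a b : a < b -> continuous f ->
  (forall x, hasd F x (f x)) ->
  Rintegral (@lebesgue_measure R) `[a, b]%classic f = F b - F a.
Proof.
move=> ab cf HF.
rewrite /Rintegral (@continuous_FTC2 _ _ F) //.
- exact: continuous_subspaceT.
- split.
  + by move=> x _; have [] := hasd_is_derive (HF x).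
  + by apply: cvg_at_right_filter; apply: hasd_cont (HF a).
  + by apply: cvg_at_left_filter; apply: hasd_cont (HF b).
- by move=> x _; rewrite derive1E; have [_ ->] := hasd_is_derive (HF x).
Qed.

Lemma antiderivative_local f (n : nat) : continuous f -> exists F, F 0 = 0 /\
  forall x, - n.+1%:R < x < n.+1%:R -> hasd F x (f x).
Proof.
move=> cf.
pose F x := (\int[@lebesgue_measure R]_(t in `[(- n.+1%:R), x]) (f t))%R.
exists (fun x => F x - F 0); split; first by rewrite subrr.
move=> x /andP[h1 h2].
have [|dF vF] := @continuous_FTC1_closed R f (- n.+1%:R) x n.+1%:R h2 _ h1 (cf x).
- apply: continuous_compact_integrable; first exact: segment_compact.
  exact: continuous_subspaceT.
- have h : hasd F x (f x) by apply: is_derive_hasd; apply: (DeriveDef dF); rewrite -(derive1E F x) vF.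
  by have := hasd_B h (hasd_cst (F 0) x); rewrite subr0.
Qed.

(** Local primitives are glued: all vanish at 0, so they agree on common domains, and at [x] the one
    indexed by an integer bound of |x| is used. *)
Lemma antiderivative f : continuous f -> exists F, F 0 = 0 /\ forall x, hasd F x (f x).
Proof.
move=> cf.
have [F HF] := choice (fun n => antiderivative_local n cf).
have F0 n : F n 0 = 0 by have [] := HF n.
have FE n m x : - n.+1%:R < x < n.+1%:R -> (n <= m)%N -> F m x = F n x.
  move=> /andP[x1 x2] nm.
  have nm' : n.+1%:R <= m.+1%:R :> R by rewrite ler_nat.
  suff : F n x - F m x = F n 0 - F m 0 by rewrite !F0; lra.
  have hd y : - n.+1%:R < y < n.+1%:R -> hasd (fun y => F n y - F m y) y 0.
    move=> /andP[y1 y2]; rewrite -(subrr (f y)); apply: hasd_B.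
      by apply: (HF n).2; rewrite y1 y2.
    by apply: (HF m).2; rewrite (le_lt_trans _ y1) ?lerN2 // (lt_le_trans y2).
  have n0 : 0 < n.+1%:R :> R by rewrite ltr0n.
  have [x0|x0] := leP 0 x.
    symmetry; apply: (@hasd_const (fun y => F n y - F m y) 0 x x0) => y /andP[y1 y2].
    by apply: hd; lra.
  apply: (@hasd_const (fun y => F n y - F m y) x 0 (ltW x0)) => y /andP[y1 y2].
  by apply: hd; lra.
pose N (x : R) := Num.bound `|x|.
have Nb x : - (N x).+1%:R < x < (N x).+1%:R.
  have : `|x| < (N x)%:R by apply: archi_boundP; apply: normr_ge0.
  by rewrite -natr1 ltr_norml; lra.
exists (fun x => F (N x) x); split; first by rewrite F0.
move=> x e e0.
have xb : - (N x).+2%:R < x < (N x).+2%:R.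
  by have := Nb x; rewrite -[(N x).+2%:R]natr1; lra.
have [r [r0 Hr]] := (HF (N x).+1).2 x xb e e0.
exists (Num.min r 1); split; first by rewrite lt_min r0 /=.
move=> s; rewrite lt_min => /andP[/Hr h1 s1].
have key y : `|y - x| < 1 -> F (N y) y = F (N x).+1 y.
  move=> yx.
  have yb : - (N x).+2%:R < y < (N x).+2%:R.
    move: yx (Nb x); rewrite -[(N x).+2%:R]natr1 ltr_norml; lra.
  have [h|h] := leqP (N y) (N x).+1.
    by rewrite (FE (N y)).
  by apply: FE => //; apply: ltnW.
by rewrite !key // ?subrr ?normr0 // [x + s]addrC addrK.
Qed.

End RealTools.

(** * Power series and finite differences *)

Section Series.
Variable R : realType.

Definition csum (n : nat) (c : {ffun 'I_n -> nat} -> R) (k : nat) : R :=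
  \sum_(a : {ffun 'I_n -> 'I_k.+1} | (\sum_(i < n) (a i : nat))%N == k) `|c (mi_of a)|.

Lemma monom_cst n (x0 : 'rV[R]_n) (s : R) k (a : {ffun 'I_n -> 'I_k.+1}) :
  (\sum_(i < n) (a i : nat))%N == k ->
  monom x0 (\row_i (x0 ord0 i + s)) (mi_of a) = s ^+ k.
Proof.
move=> /eqP ak; rewrite -[in RHS]ak /monom expr_sum; apply: eq_bigr => i _.
by rewrite mxE ffunE addrC addKr.
Qed.

(** Cauchy estimates from one point: where every coordinate exceeds that of [x0] by r/2, all
    monomials of degree k equal (r/2)^k, so absolute convergence there bounds the coefficient
    sums. *)
Lemma analytic_bound n (f : 'rV[R]_n -> R) (x0 : 'rV[R]_n) : analytic_at f x0 ->
  exists (r C : R) c, [/\ 0 < r, 0 <= C, (forall k, csum c k * r ^+ k <= C) &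
    forall x : 'rV[R]_n, (forall i, `|x ord0 i - x0 ord0 i| < r) ->
      series (hom_part c x0 x) @ \oo --> f x].
Proof.
move=> [r [r0 [c H]]].
have r2 : 0 < r / 2 by lra.
have [|+ _] := H (\row_i (x0 ord0 i + r / 2)).
  by move=> i; rewrite mxE addrC addKr ger0_norm; lra.
move=> /cvg_series_bounded [M [_ /(_ (`|M| + 1))]].
have Mlt : M < `|M| + 1 by rewrite (le_lt_trans (ler_norm _)) // ltrDl.
move=> /(_ Mlt) HM.
exists (r / 2), (`|M| + 1), c; split => //.
- move=> k; have /= := HM k I.
  apply: le_trans; rewrite ger0_norm ?sumr_ge0 //.
  rewrite /csum mulr_suml le_eqVlt; apply/orP; left; apply/eqP.
  apply: eq_bigr => a Ha; rewrite normrM monom_cst // (ger0_norm (x := (r / 2) ^+ k)) //.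
  by rewrite exprn_ge0 // ltW.
- move=> x Hx; have [|//] := H x.
  move=> i; apply: (lt_trans (Hx i)); lra.
Qed.

(** Unfolded: the j-th forward difference of [u] at n is at most s w^j in absolute value whenever n
    + j <= m. Recursion on the difference makes each closure property an induction on [m]. *)
Fixpoint Bd (m : nat) (s w : R) (u : nat -> R) : Prop :=
  (forall n, (n <= m)%N -> `|u n| <= s) /\
  if m is m'.+1 then Bd m' (s * w) w (fun n => u n.+1 - u n) else True.

Lemma Bd0 m s w u n : Bd m s w u -> (n <= m)%N -> `|u n| <= s.
Proof. by case: m => [|m] [H _]; apply: H. Qed.

Lemma Bd_s0 m s w u : Bd m s w u -> 0 <= s.
Proof. by move=> /Bd0 /(_ (leq0n _)); apply: le_trans. Qed.

Lemma Bd_le m s s' w u : 0 <= w -> s <= s' -> Bd m s w u -> Bd m s' w u.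
Proof.
move=> w0; elim: m s s' u => [|m IH] s s' u ss' [H1 H2]; split=> //;
  try by move=> n /H1 h; apply: le_trans ss'.
by apply: IH H2; apply: ler_wpM2r.
Qed.

Lemma Bd_scale m s w w' u : 0 <= w <= w' -> Bd m s w u -> Bd m s w' u.
Proof.
move=> /andP[w0 ww']; elim: m s u => [|m IH] s u B; case: (B) => [H1 H2]; split=> //.
apply: IH; apply: Bd_le H2 => //; apply: ler_wpM2l => //.
exact: Bd_s0 B.
Qed.

Lemma Bd_ext m s w u v : (forall n, (n <= m)%N -> u n = v n) -> Bd m s w u -> Bd m s w v.
Proof.
elim: m s u v => [|m IH] s u v uv [H1 H2]; split=> //;
  try by move=> n nm; rewrite -uv //; apply: H1.
by apply: IH H2 => n nm; rewrite !uv // ltnW.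
Qed.

Lemma Bd_D m s s' w u v : Bd m s w u -> Bd m s' w v ->
  Bd m (s + s') w (fun n => u n + v n).
Proof.
elim: m s s' u v => [|m IH] s s' u v [H1 H2] [H1' H2']; split=> //;
  try by move=> n nm; apply: (le_trans (ler_normD _ _)); apply: lerD; [apply: H1|apply: H1'].
rewrite mulrDl; apply: Bd_ext (IH _ _ _ _ H2 H2') => n _; ring.
Qed.

Lemma Bd_cst m s w c : 0 <= w -> `|c| <= s -> Bd m s w (fun _ => c).
Proof.
move=> w0; elim: m s c => [|m IH] s c cs; split=> //.
apply: (@Bd_ext _ _ _ (fun _ => 0)) => [n _|]; first by rewrite subrr.
by apply: IH; rewrite normr0 mulr_ge0 // (le_trans _ cs).
Qed.

Lemma Bd_Z m s w c u : Bd m s w u -> Bd m (`|c| * s) w (fun n => c * u n).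
Proof.
elim: m s u => [|m IH] s u [H1 H2]; split=> //;
  try by move=> n /H1 h; rewrite normrM; apply: ler_wpM2l.
rewrite -mulrA; apply: Bd_ext (IH _ _ H2) => n _; ring.
Qed.

Lemma Bd_S m s w u : 0 <= w -> Bd m.+1 s w u -> Bd m s w u /\ Bd m s w (fun n => u n.+1).
Proof.
move=> w0; elim: m s u => [|m IH] s u [H1 H2].
  by split; split=> // n nm; apply: H1; lia.
have [h1 h2] := IH _ _ H2.
split; split=> //; first by move=> n nm; apply: H1; lia.
by move=> n nm; apply: H1; lia.
Qed.

(** Discrete Leibniz rule: the difference of u v at n is Delta u(n) v(n+1) + u(n) Delta v(n). The
    two terms cost a factor 2 at each order. *)
Lemma Bd_M m s t w u v : 0 <= w -> Bd m s w u -> Bd m t w v ->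
  Bd m (2 ^+ m * (s * t)) w (fun n => u n * v n).
Proof.
move=> w0; elim: m s t u v => [|m IH] s t u v Bu Bv.
  split=> // n n0; rewrite expr0 mul1r normrM; apply: ler_pM => //.
    by apply: Bd0 Bu _.
  by apply: Bd0 Bv _.
have [s0 t0] := (Bd_s0 Bu, Bd_s0 Bv).
split.
  move=> n nm; rewrite normrM.
  apply: (@le_trans _ _ (s * t)).
    by apply: ler_pM => //; [apply: Bd0 Bu _|apply: Bd0 Bv _].
  rewrite -[leLHS]mul1r; apply: ler_wpM2r; first exact: mulr_ge0.
  by rewrite exprn_ege1 // ler1n.
have [Bu1 _] := Bd_S w0 Bu; have [_ Bv1] := Bd_S w0 Bv.
case: Bu => _ Bu; case: Bv => _ Bv.
have := Bd_D (IH _ _ _ _ Bu Bv1) (IH _ _ _ _ Bu1 Bv).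
have -> : 2 ^+ m * (s * w * t) + 2 ^+ m * (s * (t * w)) = 2 ^+ m.+1 * (s * t) * w.
  by rewrite exprS; ring.
by apply: Bd_ext => n _; ring.
Qed.

Lemma Bd_lim m s w (S : nat -> nat -> R) u : (forall k, Bd m s w (S k)) ->
  (forall n, (n <= m)%N -> (fun k => S k n) @ \oo --> u n) -> Bd m s w u.
Proof.
elim: m s S u => [|m IH] s S u HS Hl; split=> //.
- move=> n nm; have := @cvgn_bound _ _ _ 0 s 0 (Hl n nm); rewrite subr0; apply=> k _.
  by rewrite subr0; apply: Bd0 (HS k) _.
- move=> n nm; have := @cvgn_bound _ _ _ 0 s 0 (Hl n nm); rewrite subr0; apply=> k _.
  by rewrite subr0; apply: Bd0 (HS k) _.
- apply: (IH _ (fun k n => S k n.+1 - S k n)) => [k|n nm]; first by have [] := HS k.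
  by apply: cvgB; apply: Hl; lia.
Qed.

Lemma Bd_sum m w (I : Type) (r : seq I) (P : pred I) (s : I -> R) (u : I -> nat -> R) :
  0 <= w -> (forall i, P i -> Bd m (s i) w (u i)) ->
  Bd m (\sum_(i <- r | P i) s i) w (fun n => \sum_(i <- r | P i) u i n).
Proof.
move=> w0 H; elim: r => [|i r IH].
  rewrite big_nil; apply: (@Bd_ext _ _ _ (fun _ => 0)) => [n _|]; first by rewrite big_nil.
  by apply: Bd_cst; rewrite ?normr0.
rewrite big_cons; case: ifP => Pi.
  by apply: Bd_ext (Bd_D (H i Pi) IH) => n _; rewrite big_cons Pi.
by apply: Bd_ext IH => n _; rewrite big_cons Pi.
Qed.

(* The factor 2 ^- m on each variable absorbs the constants of the product rule. *)
Lemma Bd_monom n m w r (x0 : 'rV[R]_n) (v : nat -> 'rV[R]_n) (a : {ffun 'I_n -> nat}) :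
  0 <= w -> (forall i, Bd m (r / 2 ^+ m) w (fun k => v k ord0 i - x0 ord0 i)) ->
  Bd m (r ^+ (\sum_(i < n) a i)) w (fun k => monom x0 (v k) a).
Proof.
move=> w0 H; rewrite /monom expr_sum.
have two0 : 2 ^+ m != 0 :> R by rewrite expf_neq0 // pnatr_eq0.
elim: (index_enum _) => [|i s IH].
  rewrite big_nil; apply: (@Bd_ext _ _ _ (fun _ => 1)) => [k _|]; first by rewrite big_nil.
  by apply: Bd_cst; rewrite ?normr1.
rewrite big_cons.
suff : forall j, Bd m (r ^+ j * \prod_(j <- s) r ^+ a j) w
   (fun k => (v k ord0 i - x0 ord0 i) ^+ j * \prod_(j <- s) (v k ord0 j - x0 ord0 j) ^+ a j).
  by move=> /(_ (a i)); apply: Bd_ext => k _; rewrite big_cons.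
elim=> [|j IHj].
  by rewrite expr0 mul1r; apply: Bd_ext IH => k _; rewrite expr0 mul1r.
have := Bd_M w0 (H i) IHj.
have -> : 2 ^+ m * (r / 2 ^+ m * (r ^+ j * \prod_(j0 <- s) r ^+ a j0)) =
  r ^+ j.+1 * \prod_(j0 <- s) r ^+ a j0 by rewrite exprS; field.
by apply: Bd_ext => k _; rewrite exprS mulrA.
Qed.

(** The homogeneous part of degree k satisfies [Bd] with a constant of size 2^-k, and [Bd] survives
    sums and pointwise limits. The constants depend neither on [m] nor on [w]; only the admissible
    size r / 2^m of the displacements shrinks with the order. *)
Lemma Bd_analytic n (f : 'rV[R]_n -> R) (x0 : 'rV[R]_n) : analytic_at f x0 ->
  exists r C : R, [/\ 0 < r, 0 <= C & forall m w (v : nat -> 'rV[R]_n), 0 <= w ->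
    (forall i, Bd m (r / 2 ^+ m) w (fun k => v k ord0 i - x0 ord0 i)) ->
    Bd m C w (fun k => f (v k))].
Proof.
move=> /analytic_bound [r [C [c [r0 C0 Hc Hf]]]].
exists (r / 2), (2 * C); split; [lra|by rewrite mulr_ge0|].
move=> m w v w0 Hv.
apply: (@Bd_lim _ _ _ (fun K k => series (hom_part c x0 (v k)) K)) => [K|k km].
  have : Bd m (\sum_(0 <= k < K) csum c k * (r / 2) ^+ k) w
      (fun k => series (hom_part c x0 (v k)) K).
    rewrite /series /=; apply: Bd_sum => // k _; rewrite /hom_part /csum mulr_suml.
    apply: Bd_sum => // a /eqP ak; apply: Bd_Z.
    have -> : (r / 2) ^+ k = (r / 2) ^+ (\sum_(i < n) mi_of a i).
      by rewrite -[in LHS]ak; congr (_ ^+ _); apply: eq_bigr => i _; rewrite ffunE.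
    exact: Bd_monom.
  apply: Bd_le => //.
  apply: (@le_trans _ _ (\sum_(0 <= k < K) C * 2^-1 ^+ k)).
    apply: ler_sum => k _; rewrite exprMn mulrA; exact: ler_wpM2r.
  have := @series_diff_geo R (fun k => C * 2^-1 ^+ k) C 2^-1 C0 _ _ 0 K (leq0n _).
  rewrite /series /= [\sum_(0 <= k < 0) _]big_geq // subr0 expr0 mulr1 => h.
  apply: (le_trans (ler_norm _)); apply: h; first lra.
  by move=> k; rewrite ger0_norm // mulr_ge0 // exprn_ge0.
apply: Hf => i; apply: (le_lt_trans (Bd0 (Hv i) km)).
apply: (@le_lt_trans _ _ (r / 2)); last lra.
rewrite ler_pdivrMr ?exprn_gt0 // ler_peMr ?divr_ge0 ?(ltW r0) //.
by rewrite exprn_ege1 // ler1n.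
Qed.

End Series.

(** * Double series and one-variable analytic functions *)

Section DoubleSeries.
Variable R : realType.

Definition diag (e : nat -> nat -> R) (s t : R) (k : nat) : R :=
  \sum_(j < k.+1) e j (k - j)%N * s ^+ j * t ^+ (k - j).

Lemma triangular_sum (g : nat -> nat -> R) N :
  \sum_(0 <= k < N) \sum_(j < k.+1) g j (k - j)%N =
  \sum_(0 <= j < N) \sum_(0 <= b < N - j) g j b.
Proof.
elim: N => [|N IH]; first by rewrite !big_geq.
have -> : \sum_(0 <= j < N.+1) \sum_(0 <= b < N.+1 - j) g j b =
   \sum_(0 <= j < N) (\sum_(0 <= b < N - j) g j b + g j (N - j)%N) + g N 0%N.
  rewrite big_nat_recr //= subSnn big_nat1; congr (_ + _).
  by apply: eq_big_nat => j /andP[_ jN]; rewrite subSn ?(ltnW jN) // big_nat_recr.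
rewrite big_nat_recr //= IH big_ord_recr /= subnn big_split /= -addrA.
by congr (_ + (_ + _)); rewrite big_mkord.
Qed.

Lemma natr_le_pow2 n : n.+1%:R <= 2 ^+ n :> R.
Proof.
rewrite -natrX ler_nat; elim: n => // n IH; rewrite expnS; lia.
Qed.

Lemma eighth_pow n : 8^-1 ^+ n = 2^-1 ^+ n * (2^-1 ^+ n * 2^-1 ^+ n) :> R.
Proof.
by rewrite -!exprMn; congr (_ ^+ _); field.
Qed.

Lemma half_pow_le n : n.+1%:R * 2^-1 ^+ n <= 1 :> R.
Proof.
rewrite exprVn ler_pdivrMr ?exprn_gt0 // mul1r; exact: natr_le_pow2.
Qed.

Lemma geo_term (x C r t : R) k : 0 < r -> `|t| <= r / 8 -> `|x| * r ^+ k <= C ->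
  `|x * t ^+ k| <= C * 8^-1 ^+ k.
Proof.
move=> r0 tr xC; rewrite normrM normrX.
apply: (@le_trans _ _ (`|x| * (r / 8) ^+ k)).
  by apply: ler_wpM2l => //; apply: lerXn2r; rewrite ?nnegrE ?divr_ge0 // ltW.
rewrite exprMn mulrA; exact: ler_wpM2r.
Qed.

(** The diagonal sum is the row sum with row j cut at length N - j. On the radius r/8 each discarded
    tail, multiplied by s^j, is at most 2 C 8^-N, and N 8^-N <= 2^-N pays for the number of rows. *)
Lemma rows_diag (e : nat -> nat -> R) (E : nat -> R) (C r s t : R) :
  0 < r -> 0 <= C -> (forall j b, `|e j b| * r ^+ (j + b) <= C) ->
  `|s| <= r / 8 -> `|t| <= r / 8 ->
  (forall j, series (fun b => e j b * t ^+ b) @ \oo --> E j) ->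
  forall N, `|series (fun j => E j * s ^+ j) N - series (diag e s t) N|
     <= 2 * C * 2^-1 ^+ N.
Proof.
move=> r0 C0 He sr tr HE N.
have r8 : 0 <= r / 8 by rewrite divr_ge0 // ltW.
have q8 : 0 <= (8^-1 : R) <= 2^-1 by lra.
have tailE j M : `|E j - series (fun b => e j b * t ^+ b) M| * r ^+ j <= 2 * C * 8^-1 ^+ M.
  rewrite -ler_pdivlMr ?exprn_gt0 //.
  have Cr : 0 <= C / r ^+ j by rewrite divr_ge0 // exprn_ge0 // ltW.
  have := @series_tail_geo R _ (C / r ^+ j) 8^-1 (E j) Cr q8 _ (HE j) M.
  have -> : 2 * (C / r ^+ j) * 8^-1 ^+ M = 2 * C * 8^-1 ^+ M / r ^+ j by ring.
  apply=> b; apply: (geo_term r0) => //.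
  by rewrite ler_pdivlMr ?exprn_gt0 // -mulrA -exprD addnC.
have -> : series (diag e s t) N =
    \sum_(0 <= j < N) s ^+ j * series (fun b => e j b * t ^+ b) (N - j)%N.
  rewrite /series /= /diag.
  rewrite (triangular_sum (fun j b => e j b * s ^+ j * t ^+ b)).
  apply: eq_bigr => j _; rewrite mulr_sumr; apply: eq_bigr => b _; ring.
rewrite /series /= -sumrB.
apply: (le_trans (ler_norm_sum _ _ _)).
apply: (@le_trans _ _ (\sum_(0 <= j < N) 2 * C * 8^-1 ^+ N)).
  rewrite big_nat [leRHS]big_nat; apply: ler_sum => j /andP[_ jN].
  rewrite [X in `|X|](_ : _ = (E j - series (fun b => e j b * t ^+ b) (N - j)%N) * s ^+ j);
    last by rewrite /series /=; ring.
  apply: (le_trans (geo_term r0 sr (tailE j (N - j)%N))).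
  by rewrite -mulrA -exprD subnK // ltnW.
rewrite sumr_const_nat subn0 -[leLHS]mulr_natr -[leLHS]mulrA; apply: ler_wpM2l; first by rewrite mulr_ge0.
rewrite eighth_pow -mulrA ler_piMr ?exprn_ge0 ?invr_ge0 //.
rewrite mulrAC -mulrA; apply: mulr_ile1; rewrite ?exprn_ge0 ?invr_ge0 ?mulr_ge0 //.
  by rewrite exprn_ile1 // ?invr_ge0 // invf_le1 // ler1n.
apply: le_trans (half_pow_le N); apply: ler_wpM2r.
  by rewrite exprn_ge0 // invr_ge0.
by rewrite ler_nat.
Qed.

Lemma rows_cvg (e : nat -> nat -> R) (C r t : R) :
  0 < r -> 0 <= C -> (forall j b, `|e j b| * r ^+ (j + b) <= C) -> `|t| <= r / 8 ->
  exists E : nat -> R, (forall j, series (fun b => e j b * t ^+ b) @ \oo --> E j) /\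
    (forall j, `|E j| * r ^+ j <= 2 * C).
Proof.
move=> r0 C0 He tr.
have r8 : 0 <= r / 8 by rewrite divr_ge0 // ltW.
have q8 : 0 <= (8^-1 : R) <= 2^-1 by lra.
have Cr j : 0 <= C / r ^+ j by rewrite divr_ge0 // exprn_ge0 // ltW.
have B j b : `|e j b * t ^+ b| <= C / r ^+ j * 8^-1 ^+ b.
  apply: (geo_term r0) => //.
  by rewrite ler_pdivlMr ?exprn_gt0 // -mulrA -exprD addnC.
have [E HE] := choice (fun j => @series_geo_cvg R _ _ _ (Cr j) q8 (B j)).
exists E; split=> // j.
have := @series_tail_geo R _ _ _ _ (Cr j) q8 (B j) (HE j) 0.
rewrite /series /= big_geq // subr0 expr0 mulr1 -ler_pdivlMr ?exprn_gt0 //.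
by rewrite mulrA.
Qed.

(** Analyticity at [t0] with the Cauchy bound kept as data, so that products and parameter integrals
    are controlled by geometric estimates. *)
Definition PS (u : R -> R) (t0 : R) := exists (r C : R) (a : nat -> R),
  [/\ 0 < r, 0 <= C, (forall k, `|a k| * r ^+ k <= C) &
   forall t, `|t| < r -> series (fun k => a k * t ^+ k) @ \oo --> u (t0 + t)].

Lemma coef_shrink (x C r r' : R) k : 0 <= r' <= r -> `|x| * r ^+ k <= C -> `|x| * r' ^+ k <= C.
Proof.
move=> /andP[r0 rr]; apply: le_trans; apply: ler_wpM2l => //.
by apply: lerXn2r => //; rewrite nnegrE // (le_trans r0).
Qed.

(** With [t] fixed, the row sums of the double series are the coefficients in [s]. *)
Lemma PS_double (u : R -> R) t0 (e : nat -> nat -> R) (C r t : R) :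
  0 < r -> 0 <= C -> (forall j b, `|e j b| * r ^+ (j + b) <= C) -> `|t| <= r / 8 ->
  (forall s, `|s| <= r / 8 -> series (diag e s t) @ \oo --> u (t0 + s)) -> PS u t0.
Proof.
move=> r0 C0 He tr Hu.
have [E [HE EC]] := rows_cvg r0 C0 He tr.
exists (r / 8), (2 * C), E; split.
- by rewrite divr_gt0.
- by rewrite mulr_ge0.
- move=> k; apply: (@coef_shrink _ _ r) => //; lra.
- move=> s /ltW sr; apply: cvgn_dist => eps eps0.
  have e2 : 0 < eps / 2 by lra.
  have [N1 H1] := cvgn_distE (Hu s sr) e2.
  have [N2 H2] := geo_to0 (2 * C) e2.
  exists (maxn N1 N2) => n; rewrite geq_max => /andP[/H1 h1 /H2 h2].
  have h3 := rows_diag r0 C0 He sr tr HE n.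
  rewrite [X in `|X|](_ : _ = (u (t0 + s) - series (diag e s t) n) -
    (series (fun j => E j * s ^+ j) n - series (diag e s t) n)); last by ring.
  apply: (le_trans (ler_normB _ _)); lra.
Qed.

Lemma PS_cst (c t0 : R) : PS (fun _ => c) t0.
Proof.
exists 1, `|c|, (fun k => if k is 0 then c else 0); split => //.
  by move=> [|k]; rewrite ?expr0 ?mulr1 // normr0 mul0r.
move=> t _; apply: cvgn_dist => e e0; exists 1%N => [[|n]] // _.
rewrite /series /= big_nat_recl // big1 ?addr0 ?expr0 ?mulr1 ?subrr ?normr0 ?ltW //.
by move=> i _; rewrite mul0r.
Qed.

Lemma PS_D u v (t0 : R) : PS u t0 -> PS v t0 -> PS (fun t => u t + v t) t0.
Proof.
move=> [r [C [a [r0 C0 Ha Hu]]]] [r' [C' [b [r0' C0' Hb Hv]]]].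
have m0 : 0 <= Num.min r r' by rewrite le_min !ltW.
exists (Num.min r r'), (C + C'), (fun k => a k + b k); split.
- by rewrite lt_min r0.
- exact: addr_ge0.
- move=> k; apply: (@le_trans _ _ (`|a k| * Num.min r r' ^+ k + `|b k| * Num.min r r' ^+ k)).
    rewrite -mulrDl; apply: ler_wpM2r; last exact: ler_normD.
    by rewrite exprn_ge0.
  apply: lerD.
    by apply: coef_shrink (Ha k); rewrite m0 /= ge_min lexx.
  by apply: coef_shrink (Hb k); rewrite m0 /= ge_min lexx orbT.
- move=> t; rewrite lt_min => /andP[/Hu hu /Hv hv].
  rewrite (_ : series _ = series (fun k => a k * t ^+ k) + series (fun k => b k * t ^+ k)).
    exact: cvgD.
  apply/funext => n; rewrite fctE /series /= -big_split /=; apply: eq_bigr => k _.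
  by rewrite mulrDl.
Qed.

(** Cauchy product: the family a_j b_k is summed at equal arguments, where its rows add up to u v
    and its diagonals are the product coefficients. *)
Lemma PS_M u v (t0 : R) : PS u t0 -> PS v t0 -> PS (fun t => u t * v t) t0.
Proof.
move=> [r1 [C1 [a [r10 C10 Ha Hu]]]] [r2 [C2 [b [r20 C20 Hb Hv]]]].
pose r := Num.min r1 r2.
have r0 : 0 < r by rewrite lt_min r10.
have rr1 : 0 <= r <= r1 by rewrite ltW //= ge_min lexx.
have rr2 : 0 <= r <= r2 by rewrite ltW //= ge_min lexx orbT.
pose e j k := a j * b k.
pose C := C1 * C2.
have C0 : 0 <= C by rewrite mulr_ge0.
have He j k : `|e j k| * r ^+ (j + k) <= C.
  rewrite normrM exprD mulrACA; apply: ler_pM.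
  - by rewrite mulr_ge0 // exprn_ge0 // ltW.
  - by rewrite mulr_ge0 // exprn_ge0 // ltW.
  - exact: coef_shrink (Ha j).
  - exact: coef_shrink (Hb k).
pose d k := \sum_(j < k.+1) e j (k - j)%N.
have dd t k : d k * t ^+ k = diag e t t k.
  rewrite /d /diag mulr_suml; apply: eq_bigr => j _.
  by rewrite -mulrA -exprD subnKC // -ltnS.
exists (r / 8), C, d; split => //; first by rewrite divr_gt0.
- move=> k.
  have -> : `|d k| * (r / 8) ^+ k = `|diag e (r / 8) (r / 8) k|.
    by rewrite -dd normrM [X in _ = _ * X]ger0_norm // exprn_ge0 // divr_ge0 // ltW.
  rewrite /diag; apply: (le_trans (ler_norm_sum _ _ _)).
  apply: (@le_trans _ _ (\sum_(j < k.+1) C * 8^-1 ^+ k)).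
    apply: ler_sum => j _; have jk : (j <= k)%N by rewrite -ltnS.
    rewrite -mulrA -exprD subnKC //.
    apply: (geo_term r0); first by rewrite ger0_norm // divr_ge0 // ltW.
    by have := He j (k - j)%N; rewrite subnKC.
  rewrite sumr_const card_ord -[leLHS]mulr_natr -[leLHS]mulrA ler_piMr // mulrC.
  apply: le_trans (half_pow_le k); apply: ler_wpM2l => //.
  by apply: lerXn2r; rewrite ?nnegrE; lra.
- move=> t tr.
  have tr8 := ltW tr.
  have [h1 h2] : `|t| < r1 /\ `|t| < r2.
    by split; lra.
  have HE j : series (fun k => e j k * t ^+ k) @ \oo --> a j * v (t0 + t).
    rewrite (_ : series _ = (fun n => a j * series (fun k => b k * t ^+ k) n)).
      by apply: cvgMl_tmp; exact: Hv.
    apply/funext => n; rewrite /series /= mulr_sumr; apply: eq_bigr => k _.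
    by rewrite /e mulrA.
  have uv : series (fun j => a j * v (t0 + t) * t ^+ j) @ \oo --> u (t0 + t) * v (t0 + t).
    rewrite (_ : series _ = (fun n => v (t0 + t) * series (fun k => a k * t ^+ k) n)).
      by rewrite mulrC; apply: cvgMl_tmp; exact: Hu.
    apply/funext => n; rewrite /series /= mulr_sumr; apply: eq_bigr => k _; ring.
  apply: cvgn_dist => eps eps0.
  have e2 : 0 < eps / 2 by lra.
  have [N1 H1] := cvgn_distE uv e2.
  have [N2 H2] := geo_to0 (2 * C) e2.
  exists (maxn N1 N2) => n; rewrite geq_max => /andP[/H1 g1 /H2 g2].
  have g3 := rows_diag r0 C0 He tr8 tr8 HE n.
  have -> : series (fun k => d k * t ^+ k) n = series (diag e t t) n.
    by congr (series _ n); apply/funext => k; exact: dd.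
  set A := series _ n in g1 g3; set B := series _ n in g3 *.
  have -> : u (t0 + t) * v (t0 + t) - B = (u (t0 + t) * v (t0 + t) - A) + (A - B) by ring.
  apply: (le_trans (ler_normD _ _)); lra.
Qed.

Lemma PS_sum (I : Type) (s : seq I) (P : pred I) (u : I -> R -> R) t0 :
  (forall i, PS (u i) t0) -> PS (fun t => \sum_(i <- s | P i) u i t) t0.
Proof.
move=> H; elim: s => [|i s IH].
  by under [X in PS X]eq_fun do rewrite big_nil; exact: PS_cst.
case Pi : (P i).
  by under [X in PS X]eq_fun do rewrite big_cons Pi; exact: PS_D.
by under [X in PS X]eq_fun do rewrite big_cons Pi.
Qed.

Lemma PS_prod (I : Type) (s : seq I) (u : I -> R -> R) t0 :
  (forall i, PS (u i) t0) -> PS (fun t => \prod_(i <- s) u i t) t0.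
Proof.
move=> H; elim: s => [|i s IH].
  by under [X in PS X]eq_fun do rewrite big_nil; exact: PS_cst.
by under [X in PS X]eq_fun do rewrite big_cons; exact: PS_M.
Qed.

Lemma PS_det n (M : R -> 'M[R]_n) t0 : (forall i j, PS (fun t => M t i j) t0) ->
  PS (fun t => \det (M t)) t0.
Proof.
move=> H; apply: PS_sum => s; apply: PS_M; first exact: PS_cst.
by apply: PS_prod => i.
Qed.

Definition locally_zero (u : R -> R) t0 := exists2 r, 0 < r &
  forall t, `|t| < r -> u (t0 + t) = 0.

(** The first nonzero coefficient dominates: [D] is chosen so that |t| < |a k| / (2 D) makes the
    tail at most half of the leading term. The lower bound by a power serves both the identity
    theorem and [bO_flat]. *)
Lemma PS_dichotomy u t0 : PS u t0 -> locally_zero u t0 \/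
  exists (k : nat) (c r : R), [/\ 0 < c, 0 < r &
    forall t, `|t| < r -> c * `|t| ^+ k <= `|u (t0 + t)|].
Proof.
move=> [r [C [a [r0 C0 Ha Hu]]]].
have [a0|] := pselect (forall k, a k = 0).
  left; exists r => // t tr; apply: (cvg_unique (@Rhausdorff R) (Hu t tr)).
  rewrite (_ : series _ = fun _ => 0); first exact: cvg_cst.
  by apply/funext => n; rewrite /series /= big1 // => k _; rewrite a0 mul0r.
move=> /existsNP [k0 /eqP ak0]; right.
have ex : exists k, a k != 0 by exists k0.
case: (ex_minnP ex) => k ak kmin.
pose D := 2 * C / r ^+ k.+1 + 1.
have D0 : 0 < D by rewrite ltr_wpDl // !mulr_ge0 // invr_ge0 exprn_ge0 // ltW.
have ak0' : 0 < `|a k| by rewrite normr_gt0.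
exists k, (`|a k| / 2), (Num.min (r / 2) (`|a k| / 2 / D)); split.
- by rewrite divr_gt0.
- by rewrite lt_min !divr_gt0.
- move=> t; rewrite lt_min => /andP[t1 t2].
  have tr : `|t| < r by lra.
  have q1 : 0 <= `|t| / r <= 2^-1.
    apply/andP; split; first by rewrite divr_ge0 // ltW.
    by rewrite ler_pdivrMr //; lra.
  have B j : `|a j * t ^+ j| <= C * (`|t| / r) ^+ j.
    rewrite normrM normrX exprMn exprVn mulrA mulrAC; apply: ler_wpM2r => //.
    by rewrite ler_pdivlMr ?exprn_gt0.
  have := series_tail_geo C0 q1 B (Hu t tr) k.+1.
  rewrite seriesSr (_ : series _ k = 0) ?add0r; last first.
    rewrite /series /= big_nat big1 // => j /andP[_ jk].
    have [|/eqP aj0] := boolP (a j == 0); first by move=> /eqP ->; rewrite mul0r.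
    by have := kmin j (introN eqP aj0); rewrite leqNgt jk.
  move=> h.
  have h2 : 2 * C * (`|t| / r) ^+ k.+1 <= `|a k| / 2 * `|t| ^+ k.
    apply: (@le_trans _ _ (D * `|t| * `|t| ^+ k)).
      rewrite exprMn exprVn /D -[X in _ <= X]mulrA -exprS mulrA mulrAC.
      by apply: ler_wpM2r; rewrite ?exprn_ge0 // lerDl.
    apply: ler_wpM2r; first exact: exprn_ge0.
    by rewrite mulrC -ler_pdivlMr // ltW.
  have h3 : `|a k * t ^+ k| = `|a k| * `|t| ^+ k by rewrite normrM normrX.
  have := lerB_dist (a k * t ^+ k) (u (t0 + t)).
  rewrite h3 distrC => h4.
  have h5 : `|a k| / 2 * `|t| ^+ k = `|a k| * `|t| ^+ k - `|a k| / 2 * `|t| ^+ k by field.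
  lra.
Qed.

Lemma locally_zero_near u t0 : locally_zero u t0 ->
  exists2 r, 0 < r & forall a, `|a - t0| < r -> locally_zero u a.
Proof.
move=> [r r0 H]; exists r => // a ar; exists (r - `|a - t0|); first lra.
move=> t tr; have -> : a + t = t0 + (a - t0 + t) by ring.
by apply: H; apply: (le_lt_trans (ler_normD _ _)); lra.
Qed.

Lemma locally_zero_val u t0 : locally_zero u t0 -> u t0 = 0.
Proof. by move=> [r r0 H]; have := H 0; rewrite normr0 addr0; apply. Qed.

(** Around each point [u] is either locally zero at all nearby points or at none of them, so the two
    endpoints of a short interval behave alike; [cousin] chains such intervals. *)
Lemma PS_identity u (A B : R) : A <= B -> (forall t, A <= t <= B -> PS u t) ->
  (locally_zero u A <-> locally_zero u B).
Proof.
move=> AB H.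
apply: (@cousin R (fun a b => locally_zero u a <-> locally_zero u b)) => //.
  by move=> a b c _ -> ->.
move=> x /H /PS_dichotomy [/locally_zero_near [r r0 Hr]|[k [c [r [c0 r0 Hr]]]]].
  by exists r; split => // a b /Hr ha /Hr hb _ _ _.
exists r; split => // a b ar br _ _ _.
suff nz y : `|y - x| < r -> ~ locally_zero u y by split => [/(nz a ar)|/(nz b br)].
move=> yr [r' r0' Hy].
pose s := Num.min (r - `|y - x|) r' / 2.
have mpos : 0 < Num.min (r - `|y - x|) r' by rewrite lt_min r0' andbT; lra.
have s0 : 0 < s by rewrite divr_gt0.
have s1 : s < r'.
  have : Num.min (r - `|y - x|) r' <= r' by rewrite ge_min lexx orbT.
  rewrite /s; lra.
have s2 : s < r - `|y - x|.
  have : Num.min (r - `|y - x|) r' <= r - `|y - x| by rewrite ge_min lexx.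
  rewrite /s; lra.
have [z [zr z0 uz]] : exists z, [/\ `|z| < r, z != 0 & u (x + z) = 0].
  have [yx|yx] := eqVneq y x.
    exists s; rewrite gtr0_norm // gt_eqF //; split => //.
      by move: s2; rewrite yx subrr normr0; lra.
    by rewrite -yx; apply: Hy; rewrite gtr0_norm.
  exists (y - x); rewrite subr_eq0 yx; split => //.
  by rewrite addrC subrK; apply: locally_zero_val; exists r'.
have := Hr z zr; rewrite uz normr0; apply/negP; rewrite -ltNge.
by rewrite mulr_gt0 // exprn_gt0 // normr_gt0.
Qed.

Lemma hasd_X n (x : R) : hasd (fun s => s ^+ n.+1) x (n.+1%:R * x ^+ n).
Proof.
apply: is_derive_hasd.
have := @is_deriveX R R id n.+1 x 1 1 (is_derive_id _ _).
rewrite /= /GRing.scale /= mulr1.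
suff -> : (id ^+ n.+1 : R -> R) = (fun s => s ^+ n.+1) by [].
apply/funext => s; elim: n => [|n IH]; first by rewrite !expr1.
by rewrite exprS fctE IH [RHS]exprS.
Qed.

(** On a short interval the double expansion is integrated term by term in [s], and [cousin] adds
    the pieces. *)
Lemma PS_integral (h : R -> R -> R) (H : R -> R -> R) (t0 A B : R) :
  (forall s0, exists (r C : R) (e : nat -> nat -> R), [/\ 0 < r, 0 <= C,
     (forall j b, `|e j b| * r ^+ (j + b) <= C) &
     forall t s, `|t| < r -> `|s| < r -> series (diag e t s) @ \oo --> h (t0 + t) (s0 + s)]) ->
  (forall t s, hasd (H t) s (h t s)) -> A <= B ->
  PS (fun t => H t B - H t A) t0.
Proof.
move=> Hh HH.
apply: (@cousin R (fun A B => PS (fun t => H t B - H t A) t0)).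
  move=> a b c _ h1 h2; have := PS_D h1 h2.
  by under [X in PS X]eq_fun do rewrite addrC subrKA.
move=> s0 _; have [r [C [e [r0 C0 He Hs]]]] := Hh s0.
have r8 : 0 < r / 8 by rewrite divr_gt0.
exists (r / 8); split=> // a b ar br ab _ _.
pose x := a - s0; pose y := b - s0.
have xy : x <= y by rewrite /x /y lerD2r.
pose w (n : nat) := (y ^+ n.+1 - x ^+ n.+1) / n.+1%:R.
have wE n : `|w n| <= (y - x) * (r / 8) ^+ n.
  rewrite /w normrM normfV (ger0_norm (x := n.+1%:R)) // ler_pdivrMr ?ltr0n //.
  have := @hasd_bound R (fun s => s ^+ n.+1) (fun s => n.+1%:R * s ^+ n) x y
    (n.+1%:R * (r / 8) ^+ n) xy.
  rewrite (_ : _ * _ * (y - x) = (y - x) * (r / 8) ^+ n * n.+1%:R); last by ring.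
  apply=> [s _|s /andP[s1 s2]]; first exact: hasd_X.
  rewrite normrM normr_nat; apply: ler_wpM2l => //; rewrite normrX.
  apply: lerXn2r; rewrite ?nnegrE ?(ltW r8) // ler_norml.
  move: ar br; rewrite !ltr_norml /x /y in s1 s2 *; lra.
(* Integration removes the second variable, while [PS_double] expects one. It is restored
   artificially and evaluated at r/8, which undoes the division; [wE] keeps the new coefficients
   bounded. *)
pose e' j n := e j n * w n / (r / 8) ^+ n.
pose C' := C * (y - x).
have C0' : 0 <= C' by rewrite mulr_ge0 // subr_ge0.
apply: (@PS_double _ t0 e' C' r (r / 8)) => //.
- move=> j n.
  rewrite /e' normrM normrM normfV (ger0_norm (x := (r / 8) ^+ n)) ?exprn_ge0 ?(ltW r8) //.
  rewrite (_ : _ * _ = `|e j n| * r ^+ (j + n) * (`|w n| / (r / 8) ^+ n)); last by ring.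
  apply: ler_pM => //; first by rewrite mulr_ge0 // exprn_ge0 // ltW.
    by rewrite divr_ge0 // exprn_ge0 // ltW.
  by rewrite ler_pdivrMr ?exprn_gt0.
- by rewrite ger0_norm // ltW.
move=> t tr.
have tr' : `|t| < r by lra.
apply: (@cvgn_geo _ _ _ (2 * C * (y - x))) => K.
(* [Q] is a primitive in [s] of the partial sum, so the mean value bound transfers the remainder of
   the series to the integral. *)
pose Q s := \sum_(0 <= k < K) \sum_(j < k.+1)
    e j (k - j)%N * t ^+ j * (((k - j).+1%:R)^-1 * s ^+ (k - j).+1).
have QE : series (diag e' t (r / 8)) K = Q y - Q x.
  rewrite /Q -sumrB /series /=; apply: eq_bigr => k _.
  rewrite -sumrB /diag; apply: eq_bigr => j _; rewrite /e' /w.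
  have : (r / 8) ^+ (k - j) != 0 by rewrite expf_neq0 // gt_eqF.
  have : (k - j).+1%:R != 0 :> R by rewrite pnatr_eq0.
  move: ((k - j).+1%:R : R) ((r / 8) ^+ (k - j)) => X Y h1 h2.
  by field; rewrite h1 h2.
have hQ s : hasd Q s (series (diag e t s) K).
  rewrite /Q /series /=.
  under [X in hasd X]eq_fun do rewrite big_mkord.
  rewrite big_mkord.
  apply: (@hasd_sum R _ xpredT (fun (k : 'I_K) s => \sum_(j < k.+1)
    e j (k - j)%N * t ^+ j * (((k - j).+1%:R)^-1 * s ^+ (k - j).+1))
    (fun k : 'I_K => diag e t s k)) => k.
  apply: (@hasd_sum R _ xpredT (fun (j : 'I_k.+1) s =>
    e j (k - j)%N * t ^+ j * (((k - j).+1%:R)^-1 * s ^+ (k - j).+1))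
    (fun j : 'I_k.+1 => e j (k - j)%N * t ^+ j * s ^+ (k - j))) => j.
  apply: hasd_Z.
  have -> : s ^+ (k - j) = (k - j).+1%:R^-1 * ((k - j).+1%:R * s ^+ (k - j)).
    by rewrite mulKf // pnatr_eq0.
  by apply: hasd_Z; exact: hasd_X.
have hD s : hasd (fun s => H (t0 + t) (s + s0) - Q s) s
    (h (t0 + t) (s + s0) - series (diag e t s) K).
  by apply: hasd_B => //; apply: hasd_shift; exact: HH.
have := hasd_bound xy (fun s _ => hD s).
move=> /(_ (2 * C * 2^-1 ^+ K)) bnd.
rewrite QE.
have -> : H (t0 + t) b - H (t0 + t) a - (Q y - Q x) =
  H (t0 + t) (y + s0) - Q y - (H (t0 + t) (x + s0) - Q x).
  by rewrite /y /x !subrK; ring.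
apply: (le_trans (bnd _)); last by rewrite mulrAC.
move=> s /andP[s1 s2].
have s8 : `|s| <= r / 8.
  move: ar br; rewrite ltr_norml ltr_norml ler_norml /x /y in s1 s2 *; lra.
have sr : `|s| < r by lra.
have := Hs t s tr' sr; rewrite [s0 + s]addrC => cv.
apply: (@series_tail_geo R _ C 2^-1 _ C0 _ _ cv); first lra.
move=> k; rewrite /diag; apply: (le_trans (ler_norm_sum _ _ _)).
apply: (@le_trans _ _ (\sum_(j < k.+1) C * 8^-1 ^+ k)).
  apply: ler_sum => j _.
  have jk : (j <= k)%N by rewrite -ltnS.
  have g := He j (k - j)%N; rewrite exprD mulrA in g.
  have g1 : `|e j (k - j)%N * r ^+ j| * r ^+ (k - j) <= C.
    by rewrite normrM (ger0_norm (x := r ^+ j)) ?exprn_ge0 ?(ltW r0).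
  have g2 := geo_term r0 s8 g1.
  have g3 : `|e j (k - j)%N * s ^+ (k - j)| * r ^+ j <= C * 8^-1 ^+ (k - j).
    apply: le_trans g2; rewrite !normrM (ger0_norm (x := r ^+ j)) ?exprn_ge0 ?(ltW r0) //.
    by rewrite mulrAC.
  have := geo_term r0 tr g3; rewrite -[leRHS]mulrA -exprD subnK //.
  by apply: le_trans; rewrite mulrAC.
rewrite sumr_const card_ord -[leLHS]mulr_natr -[leLHS]mulrA; apply: ler_wpM2l => //.
rewrite eighth_pow -mulrA ler_piMr ?exprn_ge0 ?invr_ge0 //.
rewrite -mulrA mulr_ile1 ?exprn_ge0 ?invr_ge0 ?mulr_ge0 //.
  by rewrite exprn_ile1 // ?invr_ge0 // invf_le1 // ler1n.
by rewrite mulrC; exact: half_pow_le.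
Qed.

End DoubleSeries.

(** * Null sets *)

Section NullSets.
Variable R : realType.

(* The mean over [c, d] of the sum is at most [delta / (d - c)]. *)
Lemma interval_choice (c d kappa delta : R) (a b nu : nat -> R) :
  c < d -> (forall k, 0 <= nu k) -> (forall k, a k <= b k) ->
  (forall K, \sum_(k < K) nu k * (b k - a k) <= delta) ->
  0 <= kappa -> delta < kappa * (d - c) ->
  exists x, c <= x <= d /\ forall K, \sum_(k < K) nu k * ((a k <= x <= b k)%R : nat)%:R <= kappa.
Proof.
move=> cd nu0 ab Hs k0 dk; apply: contrapT => H.
have {}H x : c <= x <= d -> exists K, kappa < \sum_(k < K) nu k * ((a k <= x <= b k)%R : nat)%:R.
  move=> xcd; apply: contrapT => H2; apply: H; exists x; split => // K.
  by rewrite leNgt; apply/negP => h; apply: H2; exists K.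
pose mu := @lebesgue_measure R.
pose D : set (measurableTypeR R) := `[c, d]%classic.
have mD : measurable D by exact: measurable_itv.
pose A k : set (measurableTypeR R) := `[a k, b k]%classic.
have mA k : measurable (A k) by exact: measurable_itv.
pose f k (x : measurableTypeR R) : \bar R := ((nu k)%:E * (\1_(A k) x)%:E)%E.
have f0 k x : (0 <= f k x)%E by rewrite /f mule_ge0 // lee_fin.
have mf k : measurable_fun D (f k).
  apply: measurable_funeM; apply/measurable_EFinP.
  exact: measurable_indic.
have intf k : (\int[mu]_(x in D) f k x <= (nu k * (b k - a k))%:E)%E.
  rewrite /f ge0_integralZl_EFin //; last first.
    by apply/measurable_EFinP; exact: measurable_indic.
  rewrite integral_indic // EFinM; apply: lee_wpmul2l; first by rewrite lee_fin.
  apply: (@le_trans _ _ (mu (A k))).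
    by apply: le_measure; rewrite ?inE //; exact: measurableI.
  by rewrite /mu /A lebesgue_measure_itv /= lte_fin; case: ifP => // _; rewrite lee_fin subr_ge0.
have ub : (\int[mu]_(x in D) \sum_(0 <= k <oo) f k x <= delta%:E)%E.
  rewrite integral_nneseries //.
  apply: lime_le; first by apply: is_cvg_nneseries => n _ _; apply: integral_ge0.
  apply: nearW => n.
  apply: (@le_trans _ _ (\sum_(0 <= k < n) (nu k * (b k - a k))%:E)%E).
    by apply: lee_sum => k _.
  by rewrite big_mkord sumEFin lee_fin.
have lb : (kappa%:E * mu D <= \int[mu]_(x in D) \sum_(0 <= k <oo) f k x)%E.
  rewrite -integral_cst //; apply: ge0_le_integral => //.
  - exact: ge0_emeasurable_sum.
  - move=> x; rewrite /D /= in_itv /= => /H [K HK].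
    apply: (@le_trans _ _ (\sum_(0 <= k < K) f k x)%E); last exact: nneseries_lim_ge.
    rewrite big_mkord /f.
    under eq_bigr do rewrite -EFinM.
    rewrite sumEFin lee_fin; apply/ltW; apply: (lt_le_trans HK).
    rewrite le_eqVlt; apply/orP; left; apply/eqP; apply: eq_bigr => k _.
    rewrite indicE; congr (_ * _%:R); congr nat_of_bool.
    by apply/idP/idP; rewrite /A inE /= in_itv.
have := le_trans lb ub.
rewrite /mu /D lebesgue_measure_itv /= lte_fin cd -EFinD -EFinM lee_fin leNgt.
by rewrite dk.
Qed.

(** Fubini one coordinate at a time: the first coordinate is chosen so that the slices through it
    have total weighted volume below that of the remaining box. The weights [nu] carry the
    indicators of the coordinates already fixed. With all weights 1 the final sum counts boxes
    containing [x], and a count below 1 means none. *)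
Lemma box_cover (m : nat) (c d : 'I_m -> R) (delta : R) (nu : nat -> R)
    (a b : nat -> 'I_m -> R) :
  (forall i, c i < d i) -> (forall k, 0 <= nu k) -> (forall k i, a k i <= b k i) ->
  (forall K, \sum_(k < K) nu k * \prod_(i < m) (b k i - a k i) <= delta) ->
  0 <= delta -> delta < \prod_(i < m) (d i - c i) ->
  exists x : 'I_m -> R, (forall i, c i <= x i <= d i) /\
    exists2 q, q < 1 & forall K, \sum_(k < K) nu k * ([forall i, (a k i <= x i <= b k i)%R] : nat)%:R <= q.
Proof.
elim: m c d delta nu a b => [|m IH] c d delta nu a b cd nu0 ab Hs delta0 Hd.
  exists (fun _ => 0); split; first by case.
  exists delta => [|K]; first by rewrite big_ord0 in Hd.
  apply: le_trans (Hs K); apply: ler_sum => k _.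
  by rewrite big_ord0; apply: ler_wpM2l => //; case: [forall _, _].
rewrite big_ord_recl in Hd.
set P := \prod_(i < m) _ in Hd.
have P0 : 0 <= P by apply: prodr_ge0 => i _; rewrite subr_ge0 ltW.
have dc0 : 0 < d ord0 - c ord0 by rewrite subr_gt0.
(* The midpoint leaves strict room on both sides: above the mean for [interval_choice], below [P]
   for the induction. *)
pose kappa := (delta / (d ord0 - c ord0) + P) / 2.
have q0 : 0 <= delta / (d ord0 - c ord0) by rewrite divr_ge0 // ltW.
have qP : delta / (d ord0 - c ord0) < P by rewrite ltr_pdivrMr // mulrC.
have k1 : delta < kappa * (d ord0 - c ord0) by rewrite -ltr_pdivrMr // /kappa; lra.
have k2 : kappa < P by rewrite /kappa; lra.
have k0 : 0 <= kappa by rewrite /kappa; lra.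
pose vol k := \prod_(i < m) (b k (lift ord0 i) - a k (lift ord0 i)).
have vol0 k : 0 <= vol k by apply: prodr_ge0 => i _; rewrite subr_ge0.
have [|||x0 [x0cd Hx0]] := @interval_choice (c ord0) (d ord0) kappa delta
   (fun k => a k ord0) (fun k => b k ord0) (fun k => nu k * vol k) (cd ord0) _ _ _ k0 k1.
- by move=> k; rewrite mulr_ge0.
- by [].
- move=> K; apply: le_trans (Hs K); apply: ler_sum => k _.
  by rewrite big_ord_recl -/(vol k) -mulrA [vol k * _]mulrC.
have [||||||x [xcd [q q1 Hq]]] := IH (fun i => c (lift ord0 i)) (fun i => d (lift ord0 i)) kappa
  (fun k => nu k * ((a k ord0 <= x0 <= b k ord0)%R : nat)%:R)
  (fun k i => a k (lift ord0 i)) (fun k i => b k (lift ord0 i)) => //.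
- by move=> k; rewrite mulr_ge0.
- by move=> K; apply: le_trans (Hx0 K); apply: ler_sum => k _; rewrite mulrAC.
exists (fun i => oapp x x0 (unlift ord0 i)); split.
  by move=> i; case: unliftP => [j ->|->].
exists q => // K; apply: le_trans (Hq K); apply: ler_sum => k _.
rewrite -mulrA; apply: ler_wpM2l => //.
case: forallP => [h|_]; last by rewrite mulr_ge0.
have := h ord0; rewrite unlift_none /= => ->.
rewrite mul1r; case: forallP => // -[] i.
by have := h (lift ord0 i); rewrite liftK.
Qed.

Lemma null_box (m : nat) (N : set 'rV[R]_m) (z0 : 'rV[R]_m) (r : R) :
  leb_null N -> 0 < r ->
  exists z : 'rV[R]_m, (forall i, `|z ord0 i - z0 ord0 i| < r) /\ ~ N z.
Proof.
move=> HN r0.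
pose c i := z0 ord0 i - r / 2; pose d i := z0 ord0 i + r / 2.
have dcE i : d i - c i = r by rewrite /c /d; field.
have V0 : 0 < r ^+ m by rewrite exprn_gt0.
have [|a [b [ab [cov vol]]]] := HN (r ^+ m / 2); first by rewrite divr_gt0.
have [||||||x [xcd [q q1 Hq]]] := @box_cover m c d (r ^+ m / 2) (fun _ => 1)
  (fun k i => a k ord0 i) (fun k i => b k ord0 i) => //.
- by move=> i; rewrite -subr_gt0 dcE.
- by move=> K; apply: le_trans (vol K); apply: ler_sum => k _; rewrite mul1r.
- by rewrite divr_ge0 // ltW.
- under eq_bigr do rewrite dcE.
  rewrite prodr_const card_ord; lra.
exists (\row_i x i); split.
  move=> i; rewrite mxE; have /andP[] := xcd i; rewrite /c /d ltr_norml; lra.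
move=> /cov [k Hk].
have := Hq k.+1; rewrite leNgt => /negP; apply; apply: (lt_le_trans q1).
rewrite big_ord_recr /= mul1r.
have -> : [forall i, a k ord0 i <= x i <= b k ord0 i].
  by apply/forallP => i; have := Hk i; rewrite mxE.
by rewrite lerDr; apply: sumr_ge0 => j _; rewrite mul1r.
Qed.

End NullSets.

(** * Restrictions and first-order expansions *)

Section Restriction.
Variable R : realType.

(* Coefficients of the restriction of a power series to the plane where the
   coordinates in [S] are [s * v i] and the others [t * v i]: [ecoef c S v j b]
   belongs to [s ^+ j * t ^+ b]. *)
Definition ekcoef n (c : {ffun 'I_n -> nat} -> R) (S : pred 'I_n) (v : 'I_n -> R)
    (k j : nat) : R :=
  \sum_(a : {ffun 'I_n -> 'I_k.+1} |
      ((\sum_(i < n) (a i : nat))%N == k) && ((\sum_(i < n | S i) (a i : nat))%N == j))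
     c (mi_of a) * \prod_(i < n) v i ^+ a i.

Definition ecoef n (c : {ffun 'I_n -> nat} -> R) S v j b : R := @ekcoef n c S v (j + b) j.

Lemma monom_split n (x0 x : 'rV[R]_n) (S : pred 'I_n) (v : 'I_n -> R) (s t : R) k
    (a : {ffun 'I_n -> 'I_k.+1}) :
  (forall i, x ord0 i - x0 ord0 i = (if S i then s else t) * v i) ->
  (\sum_(i < n) (a i : nat))%N = k ->
  monom x0 x (mi_of a) = (\prod_(i < n) v i ^+ a i) * s ^+ (\sum_(i < n | S i) a i)%N *
     t ^+ (k - \sum_(i < n | S i) a i)%N.
Proof.
move=> Hx ak; rewrite /monom.
have -> : (k - \sum_(i < n | S i) a i)%N = (\sum_(i < n | ~~ S i) a i)%N.
  by rewrite -[X in (X - _)%N]ak (bigID S) /= addKn.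
under eq_bigr => i _ do rewrite Hx ffunE exprMn.
rewrite big_split /= mulrC -mulrA; congr (_ * _).
rewrite !expr_sum (bigID S) /=; congr (_ * _); apply: eq_bigr => i.
  by move=> ->.
by move=> /negbTE ->.
Qed.

Lemma hom_part_split n c (x0 x : 'rV[R]_n) (S : pred 'I_n) (v : 'I_n -> R) (s t : R) k :
  (forall i, x ord0 i - x0 ord0 i = (if S i then s else t) * v i) ->
  hom_part c x0 x k = diag (ecoef c S v) s t k.
Proof.
move=> Hx; rewrite /hom_part /diag.
have Sk (a : {ffun 'I_n -> 'I_k.+1}) : (\sum_(i < n) (a i : nat))%N == k ->
    (\sum_(i < n | S i) (a i : nat) < k.+1)%N.
  by move=> /eqP ak; rewrite ltnS -[leqRHS]ak [leqRHS](bigID S) /= leq_addr.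
rewrite (partition_big (fun a : {ffun 'I_n -> 'I_k.+1} =>
   inord (\sum_(i < n | S i) a i)%N : 'I_k.+1) xpredT) //=.
apply: eq_bigr => j _; rewrite /ecoef subnKC -?[(j <= k)%N]ltnS // /ekcoef !mulr_suml.
apply: eq_big => a.
  by case: (boolP (_ == k)) => //= /Sk h; rewrite -val_eqE /= inordK.
move=> /andP[/eqP ak /eqP <-]; rewrite inordK ?Sk ?ak //.
by rewrite (monom_split Hx ak) !mulrA.
Qed.

Lemma ecoef_bound n (c : {ffun 'I_n -> nat} -> R) S v j b :
  (forall i, `|v i| <= 1) -> `|ecoef c S v j b| <= csum c (j + b).
Proof.
move=> Hv; apply: (le_trans (ler_norm_sum _ _ _)).
rewrite /csum big_mkcondr /=; apply: ler_sum => a _; case: ifP => _ //.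
rewrite normrM ler_piMr // normr_prod; apply: prodr_ile1 => i _.
by rewrite normrX exprn_ge0 //= exprn_ile1.
Qed.

Lemma hom_part_bound n (c : {ffun 'I_n -> nat} -> R) (x0 x : 'rV[R]_n) (s : R) k :
  (forall i, `|x ord0 i - x0 ord0 i| <= s) -> `|hom_part c x0 x k| <= csum c k * s ^+ k.
Proof.
move=> Hx; apply: (le_trans (ler_norm_sum _ _ _)).
rewrite /csum mulr_suml; apply: ler_sum => a /eqP ak; rewrite normrM.
apply: ler_wpM2l => //; rewrite -[in leRHS]ak expr_sum /monom normr_prod.
apply: ler_prod => i _; rewrite normrX exprn_ge0 //= ffunE; apply: lerXn2r => //.
by rewrite nnegrE; apply: le_trans (Hx i).
Qed.

Lemma taylor_tail n (f : 'rV[R]_n -> R) c (x0 : 'rV[R]_n) (r C : R) :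
  0 < r -> 0 <= C -> (forall k, csum c k * r ^+ k <= C) ->
  (forall x : 'rV[R]_n, (forall i, `|x ord0 i - x0 ord0 i| < r) ->
      series (hom_part c x0 x) @ \oo --> f x) ->
  forall (s : R) N (x : 'rV[R]_n), 0 <= s <= r / 2 -> (forall i, `|x ord0 i - x0 ord0 i| <= s) ->
    `|f x - series (hom_part c x0 x) N| <= 2 * C * (s / r) ^+ N.
Proof.
move=> r0 C0 Hc Hf s N x /andP[s0 sr] Hx.
apply: (@series_tail_geo R _ C (s / r)) => //.
- by rewrite divr_ge0 ?(ltW r0) //= ler_pdivrMr //; lra.
- move=> k; apply: (le_trans (hom_part_bound c k Hx)).
  rewrite exprMn mulrCA exprVn [leLHS]mulrC; apply: ler_wpM2l.
    exact: exprn_ge0.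
  by rewrite ler_pdivlMr ?exprn_gt0.
- apply: Hf => i; apply: (le_lt_trans (Hx i)); lra.
Qed.

Lemma prod_deg1 n (z : 'I_n -> R) (a : 'I_n -> nat) : (\sum_(i < n) a i)%N == 1%N ->
  \prod_(i < n) z i ^+ a i = \sum_(i < n) (a i)%:R * z i.
Proof.
move=> /sum_nat_eq1 [i [_ ai H]].
have {}H j : j != i -> a j = 0%N by move=> /H; apply.
rewrite (bigD1 i) //= [RHS](bigD1 i) //= ai expr1 mul1r big1 ?mulr1; last first.
  by move=> j /H ->.
by rewrite big1 ?addr0 // => j /H ->; rewrite mul0r.
Qed.

Lemma analytic_gradient n (f : 'rV[R]_n -> R) (x0 : 'rV[R]_n) : analytic_at f x0 ->
  exists (g : 'I_n -> R) (C d : R), [/\ 0 <= C, 0 < d &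
   forall (s : R) (x : 'rV[R]_n), s <= d -> (forall i, `|x ord0 i - x0 ord0 i| <= s) ->
    `|f x - f x0 - \sum_(i < n) g i * (x ord0 i - x0 ord0 i)| <= C * s ^+ 2].
Proof.
move=> /analytic_bound [r [C [c [r0 C0 Hc Hf]]]].
pose g i := \sum_(a : {ffun 'I_n -> 'I_2} | (\sum_(i < n) (a i : nat))%N == 1%N)
   c (mi_of a) * (a i : nat)%:R.
have r2 : 0 < r / 2 by rewrite divr_gt0.
have C2 : 0 <= 2 * C / r ^+ 2 by apply: divr_ge0; [exact: mulr_ge0|exact: sqr_ge0].
have hom0 x : hom_part c x0 x 0 = f x0.
  have : `|f x0 - series (hom_part c x0 x0) 1| <= 0.
    have := taylor_tail r0 C0 Hc Hf (s := 0) 1 (x := x0).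
    rewrite mul0r expr1 mulr0; apply; first by rewrite lexx ltW.
    by move=> i; rewrite subrr normr0.
  rewrite normr_le0 subr_eq0 => /eqP ->.
  rewrite /series /= big_nat1 /hom_part; apply: eq_bigr => a _; congr (_ * _).
  rewrite /monom; apply: eq_bigr => i _; rewrite ffunE.
  by case: (a i) => -[|m] //= _; rewrite !expr0.
have hom1 x : hom_part c x0 x 1 = \sum_(i < n) g i * (x ord0 i - x0 ord0 i).
  rewrite /hom_part.
  under [RHS]eq_bigr do rewrite mulr_suml.
  rewrite exchange_big /=; apply: eq_bigr => a a1.
  under eq_bigr do rewrite -mulrA; rewrite -mulr_sumr; congr (_ * _).
  rewrite /monom; under eq_bigr do rewrite ffunE.
  exact: (@prod_deg1 n (fun i => x ord0 i - x0 ord0 i) (fun i => a i)).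
exists g, (2 * C / r ^+ 2), (r / 2); split => // s x sr Hx.
(* A negative [s] meets the hypothesis on [x] only for n = 0, where there are no coordinates. *)
have [s0|s0] := leP 0 s; last first.
  case: n => [|n] in f x0 c Hc Hf g hom0 hom1 x Hx *; last first.
    by have := le_trans (normr_ge0 _) (Hx ord0); rewrite leNgt s0.
  have -> : x = x0 by apply/rowP; case.
  rewrite big_ord0 subrr subr0 normr0; apply: mulr_ge0; [exact: C2|exact: sqr_ge0].
have := taylor_tail r0 C0 Hc Hf (s := s) 2 (x := x).
rewrite s0 sr => /(_ isT Hx).
rewrite /series /= big_nat_recr //= big_nat1 hom0 hom1 opprD addrA exprMn exprVn.
by rewrite [_ * (r ^+ 2)^-1]mulrC mulrA.
Qed.

Lemma analytic_restrict n (f : 'rV[R]_n -> R) (x0 : 'rV[R]_n) : analytic_at f x0 ->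
  exists r C : R, [/\ 0 < r, 0 <= C & forall (S : pred 'I_n) (v : 'I_n -> R),
    (forall i, `|v i| <= 1) -> exists e : nat -> nat -> R,
    (forall j b, `|e j b| * r ^+ (j + b) <= C) /\
    forall s t (x : 'rV[R]_n), `|s| < r -> `|t| < r ->
    (forall i, x ord0 i - x0 ord0 i = (if S i then s else t) * v i) ->
    series (diag e s t) @ \oo --> f x].
Proof.
move=> /analytic_bound [r [C [c [r0 C0 Hc Hf]]]].
exists r, C; split => // S v Hv; exists (ecoef c S v); split.
  move=> j b; apply: le_trans (Hc (j + b)%N); apply: ler_wpM2r.
    by rewrite exprn_ge0 // ltW.
  exact: ecoef_bound.
move=> s t x sr tr Hx.
have -> : diag (ecoef c S v) s t = hom_part c x0 x.
  by apply/funext => k; rewrite (hom_part_split c k Hx).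
apply: Hf => i; rewrite Hx normrM.
apply: (@le_lt_trans _ _ (`|if S i then s else t|)); first by rewrite ler_piMr.
by case: (S i).
Qed.

Lemma PS_line n (f : 'rV[R]_n -> R) (x0 v : 'rV[R]_n) (t0 : R) :
  analytic_at f (x0 + t0 *: v) -> (forall i, `|v ord0 i| <= 1) ->
  PS (fun t => f (x0 + t *: v)) t0.
Proof.
move=> /analytic_restrict [r [C [r0 C0 H]]] Hv.
have [e [He Hs]] := H predT (fun i => v ord0 i) Hv.
apply: (@PS_double R _ t0 e C r 0) => //; first by rewrite normr0 divr_ge0 // ltW.
move=> s sr; apply: Hs.
- lra.
- by rewrite normr0.
- move=> i; rewrite !mxE /=; ring.
Qed.

Lemma hasd_sq (f : R -> R) (d C r : R) (x : R) : 0 < r -> 0 <= C ->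
  (forall s, `|s| <= r -> `|f (x + s) - f x - d * s| <= C * `|s| ^+ 2) -> hasd f x d.
Proof.
move=> r0 C0 H e e0.
have C1 : 0 < C + 1 by lra.
exists (Num.min r (e / (C + 1))); split; first by rewrite lt_min r0 divr_gt0.
move=> s; rewrite lt_min => /andP[/ltW sr se].
apply: (le_trans (H s sr)); rewrite expr2 mulrA; apply: ler_wpM2r => //.
have : `|s| * (C + 1) <= e by rewrite -ler_pdivlMr // ltW.
have := normr_ge0 s; nra.
Qed.

End Restriction.

(** * Functions of (I, theta, eps) as functions of one packed vector *)

Section Pack.
Variables (R : realType) (l : nat).
Implicit Types (F : 'rV[R]_l -> R -> R -> R) (p x : 'rV[R]_l) (t e : R).

Let i1 : 'I_2 := @Ordinal 2 1 isT.

Lemma pack3_I p t e i : pack3 p t e ord0 (lshift 2 i) = p ord0 i.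
Proof. by rewrite /pack3 row_mxEl. Qed.
Lemma pack3_t p t e : pack3 p t e ord0 (rshift l ord0) = t.
Proof. by rewrite /pack3 row_mxEr mxE. Qed.
Lemma pack3_e p t e : pack3 p t e ord0 (rshift l i1) = e.
Proof. by rewrite /pack3 row_mxEr mxE. Qed.
Definition pack3E := (pack3_I, pack3_t, pack3_e).

Lemma fstI_pack p t e : fstI (pack3 p t e) = p.
Proof. by rewrite /fstI /pack3 row_mxKl. Qed.
Lemma thetaof_pack p t e : thetaof (pack3 p t e) = t.
Proof. by rewrite /thetaof /pack3 row_mxKr mxE. Qed.
Lemma epsof_pack p t e : epsof (pack3 p t e) = e.
Proof. by rewrite /epsof /pack3 row_mxKr mxE. Qed.
Definition unpackE := (fstI_pack, thetaof_pack, epsof_pack).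

Lemma pack_ind (P : 'I_(l + 2) -> Prop) : (forall i, P (lshift 2 i)) ->
  P (rshift l ord0) -> P (rshift l i1) -> forall j, P j.
Proof.
move=> HI Ht He j; rewrite -(fintype.splitK j); case: (fintype.split j) => //= k.
have [->|->] // : k = ord0 \/ k = i1.
by case: k => -[|[|//]] kP; [left|right]; exact: val_inj.
Qed.

Lemma sum_pack (G : 'I_(l + 2) -> R) : \sum_j G j =
  \sum_i G (lshift 2 i) + (G (rshift l ord0) + G (rshift l i1)).
Proof.
rewrite big_split_ord /=; congr (_ + _); rewrite !big_ord_recl big_ord0 addr0.
by congr (_ + G (rshift l _)); apply/val_inj.
Qed.

Definition an3 F p t e :=
  analytic_at (fun z : 'rV[R]_(l + 2) => F (fstI z) (thetaof z) (epsof z)) (pack3 p t e).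

Lemma analytic3_at (D : 'rV[R]_l -> R -> R -> Prop) F p t e :
  analytic3 D F -> D p t e -> an3 F p t e.
Proof. by move=> H Dp; apply: H; rewrite /= !unpackE. Qed.

(* All that the estimates along curves use of analyticity; unlike [an3] it is
   immediate for functions of [p] alone ([bdat_lift]). *)
Definition bdat F p t e := exists r C : R, [/\ 0 < r, 0 <= C &
  forall m w (x : nat -> 'rV[R]_l) (t' e' : nat -> R), 0 <= w ->
    (forall i, Bd m (r / 2 ^+ m) w (fun k => x k ord0 i - p ord0 i)) ->
    Bd m (r / 2 ^+ m) w (fun k => t' k - t) -> Bd m (r / 2 ^+ m) w (fun k => e' k - e) ->
    Bd m C w (fun k => F (x k) (t' k) (e' k))].

Lemma an3_bdat F p t e : an3 F p t e -> bdat F p t e.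
Proof.
move=> /Bd_analytic [r [C [r0 C0 H]]]; exists r, C; split => // m w x t' e' w0 Hx Ht He.
have := H m w (fun k => pack3 (x k) (t' k) (e' k)) w0 => h.
apply: (Bd_ext _ (h _)); first by move=> k _; rewrite !unpackE.
apply: pack_ind => [i||].
- by apply: Bd_ext (Hx i) => k _; rewrite !pack3E.
- by apply: Bd_ext Ht => k _; rewrite !pack3E.
- by apply: Bd_ext He => k _; rewrite !pack3E.
Qed.

Lemma bdat_lift (f : 'rV[R]_l -> R) p t e : analytic_at f p -> bdat (fun x _ _ => f x) p t e.
Proof.
move=> /Bd_analytic [r [C [r0 C0 H]]]; exists r, C; split => // m w x t' e' w0 Hx _ _.
exact: H.
Qed.

(** First differences of the sequence y, x, x, ... at the scale w = s / (r/2), for which the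
    admissible first difference is exactly [s]. *)
Lemma bdat_lip F p t e : bdat F p t e ->
  exists r C : R, [/\ 0 < r, 0 <= C & forall (s : R) (x y : 'rV[R]_l) (t1 t2 e1 e2 : R), 0 <= s ->
    (forall i, `|x ord0 i - p ord0 i| <= r) -> (forall i, `|y ord0 i - p ord0 i| <= r) ->
    `|t1 - t| <= r -> `|t2 - t| <= r -> `|e1 - e| <= r -> `|e2 - e| <= r ->
    (forall i, `|x ord0 i - y ord0 i| <= s) -> `|t1 - t2| <= s -> `|e1 - e2| <= s ->
    `|F x t1 e1 - F y t2 e2| <= C * s].
Proof.
move=> [r [C [r0 C0 H]]].
have r2 : 0 < r / 2 by rewrite divr_gt0.
exists (r / 2), (C / (r / 2)); split => //; first by rewrite divr_ge0 // ltW.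
move=> s x y t1 t2 e1 e2 s0 Hx Hy Ht1 Ht2 He1 He2 Hxy Ht He.
have key (a b c : R) : `|a - c| <= r / 2 -> `|b - c| <= r / 2 -> `|a - b| <= s ->
   Bd 1 (r / 2 ^+ 1) (s / (r / 2)) (fun k => (if k is 0 then b else a) - c).
  move=> ac bc ab; rewrite /= expr1; split; first by move=> [|k] _.
  split => // k _.
  rewrite [X in _ <= X](_ : _ = s); last by field; rewrite gt_eqF.
  case: k => [|k]; last by rewrite subrr normr0.
  by have -> : a - c - (b - c) = a - b by ring.
have [||||_ /= [/(_ 0%N isT) h _]] := H 1%N (s / (r / 2)) (fun k => if k is 0 then y else x)
   (fun k => if k is 0 then t2 else t1) (fun k => if k is 0 then e2 else e1).
- by rewrite divr_ge0 // ltW.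
- by move=> i; apply: Bd_ext (key (x ord0 i) (y ord0 i) (p ord0 i) _ _ _) => // -[].
- exact: key.
- exact: key.
- by apply: le_trans h _; rewrite mulrA mulrAC.
Qed.

Lemma bdat_cont F p t e : bdat F p t e ->
  forall d : R, 0 < d -> exists2 r : R, 0 < r &
  forall (x : 'rV[R]_l) (t' e' : R), (forall i, `|x ord0 i - p ord0 i| <= r) ->
    `|t' - t| <= r -> `|e' - e| <= r -> `|F x t' e' - F p t e| <= d.
Proof.
move=> /bdat_lip [r [C [r0 C0 H]]] d d0.
have C1 : 0 < C + 1 by lra.
pose m := Num.min r (d / (C + 1)).
have m0 : 0 < m by rewrite lt_min r0 divr_gt0.
have mr : m <= r by rewrite ge_min lexx.
exists m => // x t' e' Hx Ht He.
have [h1 h2 h3] : [/\ forall i, `|p ord0 i - p ord0 i| <= r, `|t - t| <= r & `|e - e| <= r].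
  by split => [i||]; rewrite subrr normr0 ltW.
apply: (le_trans (H m x p t' t e' e (ltW m0) _ h1 _ h2 _ h3 Hx Ht He)).
- by move=> i; apply: le_trans (Hx i) mr.
- exact: le_trans Ht mr.
- exact: le_trans He mr.
- have : m * (C + 1) <= d by rewrite -ler_pdivlMr // ge_min lexx orbT.
  by move: m0; clear -C0; move: m => m m0; nra.
Qed.

Lemma derive_line F (i : 'I_l) p t e d :
  hasd (fun s => F (p + s *: evec R i) t e) 0 d -> dI F i p t e = d.
Proof.
move=> H; rewrite /dI /derive; apply: cvg_lim => //.
apply/cvgrPdist_le => eps eps0.
have [r [r0 Hr]] := H eps eps0.
near=> h.
have h0 : h != 0 by near: h; apply: nbhs_dnbhs_neq.
have hr : `|h| < r by near: h; apply: dnbhs0_lt.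
have := Hr h hr.
rewrite add0r scale0r addr0 /= /GRing.scale /= [_ + p]addrC => h1.
have -> : d - h^-1 * (F (p + h *: evec R i) t e - F p t e) =
   - (h^-1 * (F (p + h *: evec R i) t e - F p t e - d * h)) by field.
by rewrite normrN normrM normfV mulrC ler_pdivrMr ?normr_gt0.
Unshelve. all: by end_near.
Qed.

Lemma an3_gradient F p t e : an3 F p t e ->
  exists C d : R, [/\ 0 <= C, 0 < d &
   forall (s : R) (x : 'rV[R]_l) (t' : R), s <= d -> (forall i, `|x ord0 i - p ord0 i| <= s) -> `|t' - t| <= s ->
    `|F x t' e - F p t e - (\sum_i dI F i p t e * (x ord0 i - p ord0 i)
        + dtheta F p t e * (t' - t))| <= C * s ^+ 2].
Proof.
move=> /analytic_gradient [g [C [d [C0 d0 H]]]]; exists C, d; split => //.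
have G (s : R) x t' : s <= d -> (forall i, `|x ord0 i - p ord0 i| <= s) -> `|t' - t| <= s ->
    `|F x t' e - F p t e - (\sum_i g (lshift 2 i) * (x ord0 i - p ord0 i)
        + g (rshift l ord0) * (t' - t))| <= C * s ^+ 2.
  move=> sd Hx Ht; have := H s (pack3 x t' e) sd.
  rewrite !unpackE sum_pack !pack3E subrr mulr0 addr0.
  under eq_bigr do rewrite !pack3E.
  apply; apply: pack_ind => [i||]; rewrite !pack3E //.
  by rewrite subrr normr0; apply: le_trans Ht.
have EI i : dI F i p t e = g (lshift 2 i).
  apply: derive_line; apply: (@hasd_sq R _ _ C d) => // s sd.
  rewrite add0r scale0r addr0.
  have := G `|s| (p + s *: evec R i) t sd.
  have Ev j : (p + s *: evec R i) ord0 j - p ord0 j = s * (j == i)%:R.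
    by rewrite !mxE; case: eqP => _; rewrite ?mulr1 ?mulr0; ring.
  rewrite subrr mulr0 addr0 (bigD1 i) //= Ev eqxx mulr1 big1 ?addr0; last first.
    by move=> j ji; rewrite Ev (negbTE ji) !mulr0.
  apply => //; last by rewrite normr0.
  by move=> j; rewrite Ev normrM normr_nat; case: eqP; rewrite ?mulr1 ?mulr0.
have Et : dtheta F p t e = g (rshift l ord0).
  rewrite /dtheta derive1E.
  suff /hasd_is_derive [_ ->] : hasd (fun s => F p s e) t (g (rshift l ord0)) by [].
  apply: (@hasd_sq R _ _ C d) => // s sd.
  have := G `|s| p (t + s) sd; rewrite [t + s]addrC addrK big1 ?add0r; last first.
    by move=> j _; rewrite subrr mulr0.
  by apply => // i; rewrite subrr normr0.
by move=> s x t' sd Hx Ht; under eq_bigr do rewrite EI; rewrite Et; exact: G.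
Qed.

Lemma hasd_lip (f : R -> R) (x d : R) : hasd f x d -> exists r C : R, [/\ 0 < r, 0 <= C &
  forall s, `|s| < r -> `|f (x + s) - f x| <= C * `|s|].
Proof.
move=> /(_ 1 ltr01) [r [r0 Hr]]; exists r, (1 + `|d|); split => //.
move=> s /Hr h; have -> : f (x + s) - f x = (f (x + s) - f x - d * s) + d * s by ring.
by rewrite mulrDl; apply: (le_trans (ler_normD _ _)); rewrite normrM lerD2r.
Qed.

Lemma max_finite (I : finType) (P : I -> R -> Prop) :
  (forall i (a b : R), a <= b -> P i a -> P i b) ->
  (forall i, exists a, P i a) -> exists a, forall i, P i a.
Proof.
move=> Pm /choice [a Pa]; exists (\sum_i `|a i|) => i; apply: Pm (Pa i).
rewrite (bigD1 i) //=; apply: (le_trans (ler_norm _)); rewrite lerDl; exact: sumr_ge0.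
Qed.

Lemma min_finite (I : finType) (P : I -> R -> Prop) :
  (forall i (a b : R), 0 < a <= b -> P i b -> P i a) ->
  (forall i, exists2 a, 0 < a & P i a) -> exists2 a, 0 < a & forall i, P i a.
Proof.
move=> Pm H.
have [||a Pa] := @max_finite I (fun i b => 0 < b /\ P i b^-1).
- move=> i a b ab [a0 Pa]; have b0 := lt_le_trans a0 ab; split => //.
  by apply: Pm Pa; rewrite invr_gt0 b0 lef_pV2.
- by move=> i; have [b b0 Pb] := H i; exists b^-1; rewrite invr_gt0 invrK.
exists (`|a| + 1)^-1; first by rewrite invr_gt0 ltr_wpDl.
move=> i; have [a0 P1] := Pa i; apply: Pm P1.
by rewrite invr_gt0 ltr_wpDl //= lef_pV2 ?posrE ?ltr_wpDl // gtr0_norm // lerDl.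
Qed.

Lemma an3_chain F (x : R -> 'rV[R]_l) (dx : 'I_l -> R) t e :
  an3 F (x t) t e -> (forall i, hasd (fun s => x s ord0 i) t (dx i)) ->
  hasd (fun s => F (x s) s e) t (\sum_i dI F i (x t) t e * dx i + dtheta F (x t) t e).
Proof.
move=> /an3_gradient [C [d [C0 d0 H]]] Hx.
set L := \sum_i _ + _.
have hL : hasd (fun s => \sum_i dI F i (x t) t e * x s ord0 i + dtheta F (x t) t e * s) t L.
  apply: hasd_D.
    by apply: (@hasd_sum R _ xpredT (fun i s => dI F i (x t) t e * x s ord0 i)) => i; exact: hasd_Z.
  rewrite -[X in hasd _ _ X]mulr1; apply: hasd_Z.
  by have := hasd_X 0 t; rewrite mulr1.
(* Taking K >= 1 lets the single radius K |s| bound the displacement of the curve and that of t in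
   [an3_gradient]. *)
have [K [K0 HK]] : exists K : R, 1 <= K /\ forall i, exists2 r : R, 0 < r &
    forall s, `|s| < r -> `|x (t + s) ord0 i - x t ord0 i| <= K * `|s|.
  have [||K HK] := @max_finite 'I_l (fun i K => exists2 r : R, 0 < r &
    forall s, `|s| < r -> `|x (t + s) ord0 i - x t ord0 i| <= K * `|s|).
  - move=> i a b ab [r r0 Hr]; exists r => // s /Hr h; apply: le_trans h _.
    exact: ler_wpM2r.
  - by move=> i; have [r [c [r0 _ Hr]]] := hasd_lip (Hx i); exists c, r.
  exists (`|K| + 1); split; first by rewrite lerDr.
  move=> i; have [r r0 Hr] := HK i; exists r => // s /Hr h; apply: le_trans h _.
  by apply: ler_wpM2r => //; apply: (le_trans (ler_norm K)); rewrite lerDl.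
have [r r0 Hr] : exists2 r : R, 0 < r & forall i s, `|s| < r ->
    `|x (t + s) ord0 i - x t ord0 i| <= K * `|s|.
  have [|r r0 Hr] := @min_finite 'I_l (fun i r => forall s, `|s| < r ->
    `|x (t + s) ord0 i - x t ord0 i| <= K * `|s|) _ HK.
    by move=> i a b /andP[_ ab] h s sa; apply: h; apply: lt_le_trans ab.
  by exists r.
have Kp : 0 < K by lra.
move=> eps eps0.
have e2 : 0 < eps / 2 by lra.
have [r1 [r10 H1]] := hL _ e2.
have CK0 : 0 <= C * K ^+ 2 by rewrite mulr_ge0 // sqr_ge0.
have CK : 0 < C * K ^+ 2 + 1 by lra.
exists (Num.min (Num.min r r1) (Num.min (d / K) (eps / 2 / (C * K ^+ 2 + 1)))).
split; first by rewrite !lt_min r0 r10 !divr_gt0.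
move=> s; rewrite !lt_min => /andP[/andP[s1 s2] /andP[s3 s4]].
have sK : K * `|s| <= d by rewrite mulrC -ler_pdivlMr // ltW.
have := H (K * `|s|) (x (t + s)) (t + s) sK (fun i => Hr i s s1).
rewrite [t + s - t](_ : _ = s); last by ring.
move=> /(_ _) h1; have {}h1 := h1 (ler_peMl (normr_ge0 _) K0).
have h2 := H1 s s2.
rewrite [X in `|X|](_ : _ = (F (x (t + s)) (t + s) e - F (x t) t e -
  (\sum_i dI F i (x t) t e * (x (t + s) ord0 i - x t ord0 i) + dtheta F (x t) t e * s)) +
  (\sum_i dI F i (x t) t e * x (t + s) ord0 i + dtheta F (x t) t e * (t + s) -
   (\sum_i dI F i (x t) t e * x t ord0 i + dtheta F (x t) t e * t) - L * s)); last first.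
  under [\sum_i _ * (_ - _)]eq_bigr do rewrite mulrBr; rewrite sumrB; ring.
apply: (le_trans (ler_normD _ _)); apply: (le_trans (lerD h1 h2)).
have : `|s| * (C * K ^+ 2 + 1) <= eps / 2 by rewrite -ler_pdivlMr // ltW.
rewrite exprMn mulrA; move: (C * K ^+ 2) CK0 => X X0; rewrite expr2.
have := normr_ge0 s; nra.
Qed.

Lemma hasd_unique (f : R -> R) (x d d' : R) : hasd f x d -> hasd f x d' -> d = d'.
Proof. by move=> /hasd_is_derive [_ <-] /hasd_is_derive [_ <-]. Qed.

Lemma an3_directional F p (v : 'rV[R]_l) t e : an3 F p t e ->
  (forall i, `|v ord0 i| <= 1) ->
  hasd (fun s => F (p + s *: v) t e) 0 (\sum_i dI F i p t e * v ord0 i).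
Proof.
move=> /an3_gradient [C [d [C0 d0 H]]] Hv.
apply: (@hasd_sq R _ _ C d) => // s sd.
have Ev i : (p + s *: v) ord0 i - p ord0 i = s * v ord0 i by rewrite !mxE; ring.
rewrite add0r scale0r addr0.
have := H `|s| (p + s *: v) t sd.
rewrite subrr mulr0 addr0.
under eq_bigr do rewrite Ev mulrCA.
rewrite -mulr_sumr [s * _]mulrC; apply; last by rewrite normr0.
by move=> i; rewrite Ev normrM ler_piMr.
Qed.

Definition SI : pred 'I_(l + 2) := fun j => if fintype.split j is inl _ then true else false.
(** Together with [SI] this spans the plane where [s] moves I along [v], [t] moves eps, and theta is
    fixed. *)
Definition dirv (v : 'rV[R]_l) (j : 'I_(l + 2)) : R :=
  pack3 v 0 1 ord0 j.

Lemma SI_l i : SI (lshift 2 i) = true.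
Proof. by rewrite /SI (unsplitK (inl i)). Qed.
Lemma SI_r k : SI (rshift l k) = false.
Proof. by rewrite /SI (unsplitK (inr k)). Qed.

(** The coefficient of s on this plane, itself a power series in t, is the derivative along [v] at
    eps = e0 + t. It shows that partial derivatives are analytic in eps, and its partial sums
    reappear in [linear_relation]. *)
Lemma an3_direction_series F p t0 e0 (r C : R) c :
  0 < r -> 0 <= C -> (forall k, csum c k * r ^+ k <= C) ->
  (forall z : 'rV[R]_(l + 2), (forall i, `|z ord0 i - pack3 p t0 e0 ord0 i| < r) ->
      series (hom_part c (pack3 p t0 e0) z) @ \oo --> F (fstI z) (thetaof z) (epsof z)) ->
  forall (v : 'rV[R]_l) t, (forall i, `|v ord0 i| <= 1) -> `|t| <= r / 8 ->
  exists D, series (fun b => ecoef c SI (dirv v) 1 b * t ^+ b) @ \oo --> D /\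
    hasd (fun s => F (p + s *: v) t0 (e0 + t)) 0 D.
Proof.
move=> r0 C0 Hc Hf v t Hv tr.
set e := ecoef c SI (dirv v).
have dv j : `|dirv v j| <= 1.
  by move: j; apply: pack_ind => [i||]; rewrite /dirv !pack3E ?normr0 ?normr1.
have He j b : `|e j b| * r ^+ (j + b) <= C.
  apply: le_trans (Hc (j + b)%N); apply: ler_wpM2r; first by rewrite exprn_ge0 // ltW.
  exact: ecoef_bound.
have [E [HE EC]] := rows_cvg r0 C0 He tr.
have r8 : 0 < r / 8 by rewrite divr_gt0.
exists (E 1%N); split; first exact: HE.
have HF s : `|s| <= r / 8 -> series (fun j => E j * s ^+ j) @ \oo --> F (p + s *: v) t0 (e0 + t).
  move=> sr; pose z := pack3 (p + s *: v) t0 (e0 + t).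
  have Hz j : z ord0 j - pack3 p t0 e0 ord0 j = (if SI j then s else t) * dirv v j.
    move: j; apply: pack_ind => [i||]; rewrite /z /dirv ?SI_l ?SI_r !pack3E.
    - by rewrite !mxE; ring.
    - by rewrite subrr mulr0.
    - by rewrite mulr1; ring.
  have := Hf z; rewrite /z !unpackE => H.
  have {}H : series (diag e s t) @ \oo --> F (p + s *: v) t0 (e0 + t).
    have -> : diag e s t = hom_part c (pack3 p t0 e0) z.
      by apply/funext => k; rewrite (hom_part_split c k Hz).
    apply: H => j; rewrite -/z Hz normrM.
    apply: (@le_lt_trans _ _ (`|if SI j then s else t|)); first by rewrite ler_piMr.
    by case: (SI j); lra.
  apply: cvgn_dist => eps eps0.
  have e2 : 0 < eps / 2 by lra.
  have [N1 H1] := cvgn_distE H e2.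
  have [N2 H2] := geo_to0 (2 * C) e2.
  exists (maxn N1 N2) => n; rewrite geq_max => /andP[/H1 h1 /H2 h2].
  have h3 := rows_diag r0 C0 He sr tr HE n.
  rewrite [X in `|X|](_ : _ = (F (p + s *: v) t0 (e0 + t) - series (diag e s t) n) -
    (series (fun j => E j * s ^+ j) n - series (diag e s t) n)); last by ring.
  apply: (le_trans (ler_normB _ _)); lra.
have C2 : 0 <= 2 * C by rewrite mulr_ge0.
have tail s N : `|s| <= r / 8 ->
    `|F (p + s *: v) t0 (e0 + t) - series (fun j => E j * s ^+ j) N| <= 2 * (2 * C) * (`|s| / r) ^+ N.
  move=> sr; apply: (series_tail_geo C2 _ _ (HF s sr)).
    by apply/andP; split; [rewrite divr_ge0 // ltW|rewrite ler_pdivrMr //; lra].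
  move=> k; rewrite normrM normrX exprMn exprVn mulrA mulrAC; apply: ler_wpM2r.
    exact: exprn_ge0.
  by rewrite ler_pdivlMr ?exprn_gt0.
have F0 : F p t0 (e0 + t) = E 0%N.
  have s0 : `|0 : R| <= r / 8 by rewrite normr0 ltW.
  have := tail 0 1%N s0.
  rewrite scale0r addr0 normr0 mul0r expr1 mulr0 normr_le0 subr_eq0 => /eqP ->.
  by rewrite /series /= big_nat1 expr0 mulr1.
apply: (@hasd_sq R _ _ (2 * (2 * C) / r ^+ 2) (r / 8)) => //.
  by apply: divr_ge0; [exact: mulr_ge0|exact: sqr_ge0].
move=> s sr; rewrite add0r scale0r addr0 F0.
have := tail s 2%N sr.
rewrite /series /= big_nat_recr //= big_nat1 expr0 mulr1 expr1 opprD addrA exprMn exprVn.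
by rewrite [_ ^+ 2 * _]mulrC [leRHS]mulrA.
Qed.

Lemma PS_dI F i p t0 e0 : an3 F p t0 e0 -> PS (fun e => dI F i p t0 e) e0.
Proof.
move=> /analytic_bound [r [C [c [r0 C0 Hc Hf]]]].
have ev j : `|evec R i ord0 j| <= 1.
  by rewrite mxE; case: eqP => _; rewrite ?normr1 ?normr0.
have dv j : `|dirv (evec R i) j| <= 1.
  by move: j; apply: pack_ind => [k||]; rewrite /dirv !pack3E ?normr0 ?normr1.
exists (r / 8), (C / r), (ecoef c SI (dirv (evec R i)) 1); split.
- by rewrite divr_gt0.
- by rewrite divr_ge0 // ltW.
- move=> b; apply: (@coef_shrink _ _ _ r); first lra.
  rewrite ler_pdivlMr // -mulrA -exprSr; apply: le_trans (Hc b.+1).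
  apply: ler_wpM2r; first by rewrite exprn_ge0 // ltW.
  exact: (@ecoef_bound _ _ c SI (dirv (evec R i)) 1 b dv).
- move=> t /ltW tr.
  have [D [HD hD]] := an3_direction_series r0 C0 Hc Hf ev tr.
  by rewrite (derive_line hD).
Qed.

End Pack.

(** * Uniform estimates of iterated differences *)

Section Differences.
Variable R : realType.

(** For orders j >= 1 the constant can be traded for the scale: C w^j <= s' (K w)^j once C <= K s'.
    Only the values need smallness of their own. This brings sequences near the centre into the
    range of [bdat]; [Bd_unscale] returns to the scale w at the price K^m. *)
Lemma Bd_rescale m s s' C w K (u : nat -> R) : 0 <= w -> 1 <= K -> C / K <= s' ->
  (forall n, (n <= m)%N -> `|u n - s| <= s') -> Bd m C w u -> Bd m s' (K * w) (fun n => u n - s).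
Proof.
move=> w0 K1 CK; have K0 : 0 < K by lra.
case: m => [|m] Hu [_ HB]; split => //.
have HB' : Bd m (s' * (K * w)) w (fun n => u n.+1 - s - (u n - s)).
  apply: (@Bd_ext _ _ _ _ (fun n => u n.+1 - u n)) => [n _|]; first by ring.
  apply: Bd_le HB => //; rewrite mulrA; apply: ler_wpM2r => //.
  by rewrite -ler_pdivrMr.
by apply: Bd_scale HB'; rewrite w0 /= ler_peMl.
Qed.

Lemma Bd_unscale m C w K (u : nat -> R) : 0 <= w -> 1 <= K ->
  Bd m C (K * w) u -> Bd m (C * K ^+ m) w u.
Proof.
move=> w0 K1; elim: m C u => [|m IH] C u HB; have C0 := Bd_s0 HB; case: HB => H1 H2.
  by rewrite expr0 mulr1; split.
split.
  by move=> n /H1 h; apply: (le_trans h); rewrite ler_peMr // exprn_ege1.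
by have := IH _ _ H2; rewrite exprS; have -> : C * (K * w) * K ^+ m = C * (K * K ^+ m) * w by ring.
Qed.

(** Induction by the quotient rule Delta a(n) q(n+1) = Delta b(n) - a(n) Delta q(n). *)
Lemma Bd_div m (c Cq : R) : 0 < c -> 0 <= Cq -> exists K : R, 0 <= K /\
  forall Cb w (q a b : nat -> R), 0 <= w <= 1 ->
  (forall n, (n <= m)%N -> a n * q n = b n) -> (forall n, (n <= m)%N -> c <= `|q n|) ->
  Bd m Cq w q -> Bd m Cb w b -> Bd m (K * Cb) w a.
Proof.
move=> c0 Cq0.
have base n (K Cb : R) (q a b : nat -> R) : c^-1 <= K -> a n * q n = b n -> c <= `|q n| ->
    `|b n| <= Cb -> `|a n| <= K * Cb.
  move=> cK abq cq bC.
  have qn0 : 0 < `|q n| by apply: lt_le_trans cq.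
  have -> : `|a n| = `|b n| / `|q n|.
    by rewrite -abq normrM mulfK // gt_eqF.
  rewrite mulrC; apply: ler_pM => //.
  by apply: le_trans cK; rewrite lef_pV2 ?posrE.
suff [K [cK H]] : exists K : R, c^-1 <= K /\
  forall Cb w (q a b : nat -> R), 0 <= w <= 1 ->
  (forall n, (n <= m)%N -> a n * q n = b n) -> (forall n, (n <= m)%N -> c <= `|q n|) ->
  Bd m Cq w q -> Bd m Cb w b -> Bd m (K * Cb) w a.
  by exists K; split => //; apply: le_trans cK; rewrite invr_ge0 ltW.
elim: m => [|m [K [cK IH]]].
  exists c^-1; split => // Cb w q a b w01 abq cq _ [Hb _]; split => // n n0.
  by apply: (base n _ _ q a b) => //; [exact: abq|exact: cq|exact: Hb].
have K0 : 0 <= K by apply: le_trans cK; rewrite invr_ge0 ltW.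
have M0 : 0 <= 2 ^+ m * (K * Cq) by rewrite !mulr_ge0 // exprn_ge0.
exists (K + K * (1 + 2 ^+ m * (K * Cq))); split.
  by apply: (le_trans cK); rewrite lerDl mulr_ge0 // addr_ge0.
move=> Cb w q a b /andP[w0 w1] abq cq Bq Bb.
have Cb0 := Bd_s0 Bb.
have [Bq' Bq''] := Bd_S w0 Bq; have [Bb' Bb''] := Bd_S w0 Bb.
have Ba : Bd m (K * Cb) w a.
  by apply: IH Bq' Bb' => [|n nm|n nm]; [rewrite w0|apply: abq; exact: ltnW|apply: cq; exact: ltnW].
split.
  move=> n nm; apply: (base n _ _ q a b) => //.
  - by apply: (le_trans cK); rewrite lerDl mulr_ge0 // addr_ge0.
  - exact: abq.
  - exact: cq.
  - by apply: Bd0 Bb nm.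
case: Bq => _ Bdq; case: Bb => _ Bdb.
have Br := Bd_D Bdb (Bd_Z (-1) (Bd_M w0 Ba Bdq)).
rewrite normrN1 mul1r in Br.
have := IH _ w (fun n => q n.+1) (fun n => a n.+1 - a n) _ _ _ _ Bq'' Br.
rewrite w0 w1 => /(_ isT) h.
apply: (Bd_le w0 _ (h _ _)).
- have -> : K * (Cb * w + 2 ^+ m * (K * Cb * (Cq * w))) =
     K * (1 + 2 ^+ m * (K * Cq)) * (Cb * w) by ring.
  rewrite -[leRHS]mulrA; apply: ler_wpM2r; first by rewrite mulr_ge0.
  by rewrite lerDr.
- move=> n nm; rewrite -(abq n.+1) // -(abq n) ?(ltnW nm) //; last exact: leqW.
  ring.
- by move=> n nm; apply: cq.
Qed.

(** The difference of consecutive increments of D is an increment of D(x + T) - D(x), a primitive of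
    A(x + T) - A(x), so the induction stays within the statement. Order m for A thus bounds D itself
    to order m + 1. *)
Lemma Bd_int m (T s w : R) (D A : R -> R) (t : R) : 0 <= T -> 0 <= w ->
  (forall x, hasd D x (A x)) ->
  (forall x, t <= x <= t + T -> Bd m s w (fun n => A (x + n%:R * T))) ->
  Bd m (T * s) w (fun n => D (t + n.+1%:R * T) - D (t + n%:R * T)).
Proof.
move=> T0 w0; elim: m D A s => [|m IH] D A s HD HA.
  split => // -[|//] _; rewrite mul0r addr0 mul1r [leRHS]mulrC.
  have -> : s * T = s * (t + T - t) by ring.
  apply: (@hasd_bound _ _ A); [lra|by move=> x _|].
  by move=> x /HA [/(_ 0%N isT) + _]; rewrite mul0r addr0.
split.
  move=> n nm; rewrite [leRHS]mulrC.
  have -> : s * T = s * ((t + n.+1%:R * T) - (t + n%:R * T)) by rewrite -natr1; ring.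
  apply: (@hasd_bound _ _ A); first by rewrite lerD2l; apply: ler_wpM2r; rewrite ?ler_nat.
    by move=> x _.
  move=> x /andP[x1 x2].
  have [|/(_ n nm) + _] := HA (x - n%:R * T).
    by move: x1 x2; rewrite -natr1; lra.
  by rewrite subrK.
have HD' x : hasd (fun x => D (x + T) - D x) x (A (x + T) - A x).
  by apply: hasd_B => //; apply: hasd_shift.
have tS (y : R) n : y + n.+1%:R * T = y + n%:R * T + T by rewrite -natr1; ring.
have h := IH _ _ (s * w) HD'; rewrite -mulrA; apply: Bd_ext (h _) => [n _|x /HA [_]].
  by rewrite !tS.
by apply: Bd_ext => n _; rewrite tS.
Qed.

(* Statements that hold for all small [e], uniformly for [t] in bounded sets. *)
Definition UE (P : R -> R -> R -> Prop) := forall L : R, exists (C d : R),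
  0 < d /\ forall e t, `|e| < d -> `|t| <= L -> P C e t.

Definition mono (P : R -> R -> R -> Prop) := forall C C' e t, C <= C' -> P C e t -> P C' e t.

Lemma UE_comb (P Q S : R -> R -> R -> Prop) : UE P -> UE Q ->
  (forall C C', exists C'' d, 0 < d /\ forall e t, `|e| < d -> P C e t -> Q C' e t -> S C'' e t) ->
  UE S.
Proof.
move=> HP HQ H L; have [C [d [d0 HC]]] := HP L; have [C' [d' [d0' HC']]] := HQ L.
have [C'' [d'' [d0'' HS]]] := H C C'.
exists C'', (Num.min d (Num.min d' d'')); split; first by rewrite !lt_min d0 d0'.
move=> e t; rewrite !lt_min => /and3P[e1 e2 e3] tL.
by apply: HS => //; [exact: HC|exact: HC'].
Qed.

Lemma UE_weak (P S : R -> R -> R -> Prop) : UE P ->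
  (forall C, exists C'' d, 0 < d /\ forall e t, `|e| < d -> P C e t -> S C'' e t) -> UE S.
Proof.
move=> HP H; apply: (UE_comb HP HP) => C C'; have [C'' [d [d0 HS]]] := H C.
by exists C'', d; split => // e t ed Pe _; exact: HS.
Qed.

Lemma UE_all (I : finType) (P : I -> R -> R -> R -> Prop) : (forall i, mono (P i)) ->
  (forall i, UE (P i)) -> UE (fun C e t => forall i, P i C e t).
Proof.
move=> Pm HP L.
have [||C HC] := @max_finite R I (fun i C => exists2 d, 0 < d &
    forall e t, `|e| < d -> `|t| <= L -> P i C e t).
- by move=> i a b ab [d d0 H]; exists d => // e t ed tL; apply: Pm ab _; exact: H.
- by move=> i; have [C [d [d0 H]]] := HP i L; exists C, d.
have [|d d0 Hd] := @min_finite R I (fun i d => forall e t, `|e| < d -> `|t| <= L -> P i C e t) _ HC.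
  by move=> i a b /andP[_ ab] H e t ea; apply: H; apply: lt_le_trans ab.
by exists C, d; split => // e t ed tL i; exact: Hd.
Qed.

(** Compactness of bounded sets of t; monotonicity in the constant allows the constants of adjacent
    intervals to be merged by a maximum. *)
Lemma UE_loc (P : R -> R -> R -> Prop) : mono P ->
  (forall t0, exists (C d r : R), [/\ 0 < d, 0 < r &
     forall e t, `|e| < d -> `|t - t0| < r -> P C e t]) -> UE P.
Proof.
move=> Pm H L; have [L0|L0] := leP 0 L; last first.
  exists 0, 1; split => // e t _ tL; exfalso.
  by have := le_trans (normr_ge0 t) tL; rewrite leNgt L0.
have [] : exists C d : R, 0 < d /\ forall e t, `|e| < d -> - L <= t <= L -> P C e t.
  apply: (@cousin R (fun a b => exists C d : R, 0 < d /\
    forall e t, `|e| < d -> a <= t <= b -> P C e t)); last lra.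
    move=> a b c abc [C [d [d0 h]]] [C' [d' [d0' h']]].
    exists (Num.max C C'), (Num.min d d'); split; first by rewrite lt_min d0.
    move=> e t; rewrite lt_min => /andP[e1 e2] /andP[t1 t2].
    have [tb|tb] := leP t b.
      by apply: (Pm C); [rewrite le_max lexx|apply: h => //; rewrite t1].
    by apply: (Pm C'); [rewrite le_max lexx orbT|apply: h' => //; rewrite ltW].
  move=> x _; have [C [d [r [d0 r0 h]]]] := H x.
  exists r; split => // a b ar br ab _ _; exists C, d; split => // e t ed /andP[t1 t2].
  apply: h => //; move: ar br; rewrite !ltr_norml; lra.
move=> C [d [d0 h]]; exists C, d; split => // e t ed; rewrite ler_norml => tL.
exact: h.
Qed.

Lemma UE_shift (P : R -> R -> R -> Prop) (T : R) (m : nat) : UE P ->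
  UE (fun C e t => forall n, (n <= m)%N -> P C e (t + n%:R * T)).
Proof.
move=> H L; have [C [d [d0 HC]]] := H (L + m%:R * `|T|); exists C, d; split => // e t ed tL n nm.
apply: HC => //; apply: (le_trans (ler_normD _ _)); apply: lerD => //.
by rewrite normrM normr_nat; apply: ler_wpM2r; rewrite ?ler_nat.
Qed.

Lemma mono_norm (u : R -> R -> R) k : mono (fun C e t => `|u e t| <= C * `|e| ^+ k).
Proof. by move=> C C' e t CC h; apply: le_trans h _; apply: ler_wpM2r; rewrite ?exprn_ge0. Qed.

(** Sampled with step T, the j-th differences of [u e] are O(e^j) for j <= m, uniformly for bounded
    t. *)
Definition OB (T : R) m (u : R -> R -> R) :=
  UE (fun C e t => Bd m C `|e| (fun n => u e (t + n%:R * T))).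

Lemma OB_D T m u v : OB T m u -> OB T m v -> OB T m (fun e t => u e t + v e t).
Proof.
move=> Hu Hv; apply: (UE_comb Hu Hv) => C C'; exists (C + C'), 1; split => // e t _.
exact: Bd_D.
Qed.

Lemma OB_e T m u : OB T m u -> OB T m (fun e t => e * u e t).
Proof.
move=> Hu; apply: (UE_weak Hu) => C; exists C, 1; split => // e t e1 HB.
by apply: Bd_le (Bd_Z e HB) => //; rewrite ler_piMl ?(ltW e1) // (Bd_s0 HB).
Qed.

Lemma OB_bound T m u : OB T m u -> UE (fun C e t => `|u e t| <= C).
Proof.
move=> Hu; apply: (UE_weak Hu) => C; exists C, 1; split => // e t _ HB.
by have := Bd0 HB (leq0n m); rewrite mul0r addr0.
Qed.

Lemma OB_div T m (u q v : R -> R -> R) (c : R) : 0 < c -> OB T m q -> OB T m v ->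
  UE (fun _ e t => u e t * q e t = v e t /\ c <= `|q e t|) -> OB T m u.
Proof.
move=> c0 Hq Hv /(@UE_shift _ T m) Huq.
apply: (UE_comb (UE_comb Hq Hv (S := fun C e t => Bd m C `|e| (fun n => q e (t + n%:R * T)) /\
   Bd m C `|e| (fun n => v e (t + n%:R * T))) _) Huq).
  move=> C C'; exists (Num.max C C'), 1; split => // e t _ H1 H2.
  by split; [apply: Bd_le H1|apply: Bd_le H2] => //; rewrite le_max lexx ?orbT.
move=> C _; have [C0|C0] := leP 0 C; last first.
  exists 0, 1; split => // e t _ [/Bd_s0 h _].
  by exfalso; move: h; rewrite leNgt C0.
have [K [K0 HK]] := @Bd_div m c C c0 C0.
exists (K * C), 1; split => // e t e1 [B1 B2] H.
by apply: HK B1 B2; [rewrite normr_ge0 ltW|move=> n /H []|move=> n /H []].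
Qed.

(** One difference amounts to integrating the derivative over a period, and the factor e of that
    derivative is the power gained. *)
Lemma OB_int T m (x a : R -> R -> R) (d0 : R) : 0 <= T -> 0 < d0 ->
  (forall e t, `|e| < d0 -> hasd (x e) t (e * a e t)) ->
  UE (fun C e t => `|x e t| <= C) -> OB T m a -> OB T m.+1 x.
Proof.
move=> T0 dpos Hx Hb Ha L.
have [C [d [dp HC]]] := @UE_shift _ T m.+1 Hb L.
have [C' [d' [dp' HC']]] := Ha (L + T).
exists (Num.max C (T * C')), (Num.min d (Num.min d' d0)); split.
  by rewrite !lt_min dp dp' dpos.
move=> e t; rewrite !lt_min => /and3P[e1 e2 e3] tL; split.
  by move=> n nm; apply: (le_trans (HC e t e1 tL n nm)); rewrite le_max lexx.
have := @Bd_int m T (`|e| * C') `|e| (x e) (fun t => e * a e t) t T0 (normr_ge0 e).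
move=> /(_ (fun y => Hx e y e3)) h.
have {h} : Bd m (T * (`|e| * C')) `|e| (fun n => x e (t + n.+1%:R * T) - x e (t + n%:R * T)).
  apply: h => y /andP[y1 y2]; apply: Bd_Z; apply: HC' => //.
  by move: tL; rewrite !ler_norml; lra.
apply: Bd_le => //; rewrite mulrCA [leRHS]mulrC; apply: ler_wpM2l => //.
by rewrite le_max lexx orbT.
Qed.

(** By periodicity [F] is taken at the fixed time t, so only the points [x e (t + n T)] vary with n.
    For small e they lie within r / 2^m of [p], and [K] brings their difference bounds below this
    size as well. *)
Lemma OB_comp l T m (F : 'rV[R]_l -> R -> R -> R) (p : 'rV[R]_l) (x : R -> R -> 'rV[R]_l) :
  (forall t, bdat F p t 0) -> (forall I t e, F I (t + T) e = F I t e) ->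
  UE (fun C e t => forall i, `|x e t ord0 i - p ord0 i| <= C * `|e|) ->
  (forall i, OB T m (fun e t => x e t ord0 i)) ->
  OB T m (fun e t => F (x e t) t e).
Proof.
move=> HF per Hx Hm.
have perN I t e n : F I (t + n%:R * T) e = F I t e.
  elim: n => [|n IH]; first by rewrite mul0r addr0.
  by rewrite -natr1 mulrDl mul1r addrA per.
have {}Hm : UE (fun C e t => forall i, Bd m C `|e| (fun n => x e (t + n%:R * T) ord0 i)).
  by apply: UE_all => // i C C' e t CC; apply: Bd_le.
apply: UE_loc => [C C' e t|t0]; first exact: Bd_le.
have [r [C [r0 C0 H]]] := HF t0.
have [C1 [d1 [d10 H1]]] := UE_shift T m Hx (`|t0| + 1).
have [C2 [d2 [d20 H2]]] := Hm (`|t0| + 1).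
pose s := r / 2 ^+ m.
have s0 : 0 < s by rewrite divr_gt0 // exprn_gt0.
pose K := 1 + `|C2| / s.
have K1 : 1 <= K by rewrite lerDl divr_ge0 // ltW.
have CK : C2 / K <= s.
  rewrite ler_pdivrMr ?(lt_le_trans ltr01) // /K mulrDr mulr1 mulrCA divff ?gt_eqF // mulr1.
  by apply: (le_trans (ler_norm _)); rewrite lerDr ltW.
pose D := `|C1| + 1.
have D0 : 0 < D by rewrite ltr_wpDl.
exists (C * K ^+ m), (Num.min (Num.min d1 d2) (Num.min s (s / D))), (Num.min 1 s).
split; [by rewrite !lt_min d10 d20 s0 divr_gt0|by rewrite lt_min s0 ltr01|].
move=> e t; rewrite !lt_min => /andP[/andP[e1 e2] /andP[e3 e4]] /andP[t1 ts].
have tL : `|t| <= `|t0| + 1.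
  have -> : t = t0 + (t - t0) by ring.
  by apply: (le_trans (ler_normD _ _)); rewrite lerD2l ltW.
apply: Bd_unscale => //.
apply: (@Bd_ext _ _ _ _ (fun n => F (x e (t + n%:R * T)) t e)); first by move=> n _; rewrite perN.
apply: (H m _ (fun n => x e (t + n%:R * T)) (fun _ => t) (fun _ => e)).
- by rewrite mulr_ge0 // (le_trans ler01).
- move=> i; apply: (Bd_rescale (normr_ge0 e) K1 CK); last exact: H2.
  move=> n nm; apply: (le_trans (H1 e t e1 tL n nm i)).
  apply: (@le_trans _ _ (`|e| * D)); last by rewrite -ler_pdivlMr // ltW.
  rewrite mulrC; apply: ler_wpM2l => //; apply: (le_trans (ler_norm _)).
  by rewrite lerDl.
- by apply: Bd_cst; [rewrite mulr_ge0 // (le_trans ler01)|exact: ltW].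
- by apply: Bd_cst; [rewrite mulr_ge0 // (le_trans ler01)|rewrite subr0; exact: ltW].
Qed.

Lemma UE_lip l (F : 'rV[R]_l -> R -> R -> R) (p : 'rV[R]_l) (x y : R -> R -> 'rV[R]_l) k :
  (forall t, bdat F p t 0) ->
  UE (fun C e t => forall i, `|x e t ord0 i - p ord0 i| <= C * `|e|) ->
  UE (fun C e t => forall i, `|y e t ord0 i - p ord0 i| <= C * `|e|) ->
  UE (fun C e t => forall i, `|x e t ord0 i - y e t ord0 i| <= C * `|e| ^+ k) ->
  UE (fun C e t => `|F (x e t) t e - F (y e t) t e| <= C * `|e| ^+ k).
Proof.
move=> HF Hx Hy Hxy; apply: UE_loc => [|t0]; first exact: mono_norm.
have [r [C [r0 C0 H]]] := bdat_lip (HF t0).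
have [C1 [d1 [d10 H1]]] := Hx (`|t0| + 1).
have [C2 [d2 [d20 H2]]] := Hy (`|t0| + 1).
have [C3 [d3 [d30 H3]]] := Hxy (`|t0| + 1).
pose D := `|C1| + `|C2| + 1.
have D0 : 0 < D by rewrite ltr_wpDl // addr_ge0.
exists (C * `|C3|), (Num.min (Num.min d1 (Num.min d2 d3)) (Num.min r (r / D))), (Num.min 1 r).
split; [by rewrite !lt_min d10 d20 d30 r0 divr_gt0|by rewrite lt_min r0 ltr01|].
move=> e t; rewrite !lt_min => /andP[/and3P[e1 e2 e3] /andP[er e4]] /andP[t1 tr].
have tL : `|t| <= `|t0| + 1.
  have -> : t = t0 + (t - t0) by ring.
  by apply: (le_trans (ler_normD _ _)); rewrite lerD2l ltW.
have De : `|e| * D <= r by rewrite -ler_pdivlMr // ltW.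
have ek : 0 <= `|e| ^+ k by rewrite exprn_ge0.
rewrite -mulrA; apply: (H (`|C3| * `|e| ^+ k)).
- by rewrite mulr_ge0.
- move=> i; apply: (le_trans (H1 e t e1 tL i)); apply: le_trans De.
  rewrite mulrC; apply: ler_wpM2l => //; apply: (le_trans (ler_norm _)).
  by rewrite /D -addrA lerDl addr_ge0.
- move=> i; apply: (le_trans (H2 e t e2 tL i)); apply: le_trans De.
  rewrite mulrC; apply: ler_wpM2l => //; apply: (le_trans (ler_norm _)).
  by rewrite /D addrAC lerDr addr_ge0.
- exact: ltW.
- exact: ltW.
- by rewrite subr0 ltW.
- by rewrite subr0 ltW.
- move=> i; apply: (le_trans (H3 e t e3 tL i)); apply: ler_wpM2r => //.
  exact: ler_norm.
- by rewrite subrr normr0 mulr_ge0.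
- by rewrite subrr normr0 mulr_ge0.
Qed.

End Differences.

(** * Picard iterates *)

Section CurveTools.
Variables (R : realType) (l : nat).

Lemma continuous_at_dist (f : R -> R) x : {for x, continuous f} ->
  forall e : R, 0 < e -> exists2 r : R, 0 < r & forall y, `|y - x| < r -> `|f y - f x| <= e.
Proof.
move=> /cvgrPdist_le H e /H /nbhs_ballP [r /= r0 Hr]; exists r => // y yx.
by rewrite distrC; apply: Hr; rewrite /ball /= distrC.
Qed.

Lemma curve_cont (F : 'rV[R]_l -> R -> R -> R) (x : R -> 'rV[R]_l) t e :
  bdat F (x t) t e -> (forall i, {for t, continuous (fun s => x s ord0 i)}) ->
  {for t, continuous (fun s => F (x s) s e)}.
Proof.
move=> /bdat_cont HF Hx; apply/cvgrPdist_le => eps /HF [r r0 Hr].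
have [|d d0 Hd] := @min_finite R 'I_l (fun i d => forall s, `|s - t| < d ->
    `|x s ord0 i - x t ord0 i| <= r) _ (fun i => continuous_at_dist (Hx i) r0).
  by move=> i a b /andP[_ ab] H s sa; apply: H; apply: lt_le_trans ab.
apply/nbhs_ballP; exists (Num.min r d); first by rewrite /= lt_min r0.
move=> s; rewrite /ball /= lt_min distrC => /andP[s1 s2].
rewrite distrC; apply: Hr => [i||]; [exact: Hd|exact: ltW|].
by rewrite subrr normr0 ltW.
Qed.

Lemma UE_lip0 (F : 'rV[R]_l -> R -> R -> R) (p : 'rV[R]_l) (x : R -> R -> 'rV[R]_l) :
  (forall t, bdat F p t 0) ->
  UE (fun C e t => forall i, `|x e t ord0 i - p ord0 i| <= C * `|e|) ->
  UE (fun C e t => `|F (x e t) t e - F p t 0| <= C * `|e| ^+ 1).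
Proof.
move=> HF Hx; apply: UE_loc => [|t0]; first exact: mono_norm.
have [r [C [r0 C0 H]]] := bdat_lip (HF t0).
have [C1 [d1 [d10 H1]]] := Hx (`|t0| + 1).
pose D := `|C1| + 1.
have D0 : 0 < D by rewrite ltr_wpDl.
have D1 : 1 <= D by rewrite lerDr.
exists (C * D), (Num.min d1 (Num.min r (r / D))), (Num.min 1 r).
split; [by rewrite !lt_min d10 r0 divr_gt0|by rewrite lt_min r0 ltr01|].
move=> e t; rewrite !lt_min => /and3P[e1 er e4] /andP[t1 tr].
have tL : `|t| <= `|t0| + 1.
  have -> : t = t0 + (t - t0) by ring.
  by apply: (le_trans (ler_normD _ _)); rewrite lerD2l ltW.
have De : D * `|e| <= r by rewrite mulrC -ler_pdivlMr // ltW.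
have xD i : `|x e t ord0 i - p ord0 i| <= D * `|e|.
  apply: (le_trans (H1 e t e1 tL i)); apply: ler_wpM2r => //.
  by apply: (le_trans (ler_norm _)); rewrite lerDl.
rewrite expr1 -mulrA; apply: (H (D * `|e|)) => //.
- by rewrite mulr_ge0 // ltW.
- by move=> i; apply: le_trans De.
- by move=> i; rewrite subrr normr0 ltW.
- exact: ltW.
- exact: ltW.
- by rewrite subr0 ltW.
- by rewrite subrr normr0 ltW.
- by rewrite subrr normr0 mulr_ge0 // ltW.
- by rewrite subr0 ler_peMl.
Qed.

Lemma UE_drift (x a : R -> R -> R) (t1 : R) k :
  UE (fun _ e t => hasd (x e) t (a e t)) -> UE (fun C e t => `|a e t| <= C * `|e| ^+ k) ->
  UE (fun C e t => `|x e t - x e t1| <= C * `|e| ^+ k).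
Proof.
move=> Hd Ha L; have [_ [d [d0 Hd']]] := Hd (`|L| + `|t1|).
have [C [d' [d0' Ha']]] := Ha (`|L| + `|t1|).
exists (`|C| * (`|L| + `|t1|)), (Num.min d d'); split; first by rewrite lt_min d0.
move=> e t; rewrite lt_min => /andP[e1 e2] tL.
have tL' : `|t| <= `|L| by apply: (le_trans tL (ler_norm _)).
have B s : `|s| <= `|L| + `|t1| -> `|a e s| <= `|C| * `|e| ^+ k.
  move=> sL; apply: (le_trans (Ha' e s e2 sL)); apply: ler_wpM2r; first by rewrite exprn_ge0.
  exact: ler_norm.
have key u v : u <= v -> `|u| <= `|L| + `|t1| -> `|v| <= `|L| + `|t1| ->
   `|x e v - x e u| <= `|C| * `|e| ^+ k * (v - u).
  move=> uv uL vL; apply: (@hasd_bound _ _ (a e)) => // s /andP[us sv].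
    by apply: Hd' => //; move: uL vL; rewrite !ler_norml; lra.
  by apply: B; move: uL vL; rewrite !ler_norml; lra.
have Lt : `|t| <= `|L| + `|t1| by apply: (le_trans tL'); rewrite lerDl.
have Lt1 : `|t1| <= `|L| + `|t1| by rewrite lerDr.
have Ck : 0 <= `|C| * `|e| ^+ k by rewrite mulr_ge0 // exprn_ge0.
have tt : `|t - t1| <= `|L| + `|t1|.
  by apply: (le_trans (ler_normB _ _)); rewrite lerD2r.
apply: (@le_trans _ _ (`|C| * `|e| ^+ k * `|t - t1|)).
  have [h|h] := leP t1 t.
    by rewrite (ger0_norm (x := t - t1)) ?subr_ge0 //; exact: key.
  have h' := ltW h.
  rewrite distrC (distrC t) (ger0_norm (x := t1 - t)) ?subr_ge0 //; exact: key.
rewrite mulrAC; apply: ler_wpM2r; first by rewrite exprn_ge0.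
exact: ler_wpM2l.
Qed.

(** The Lipschitz constant near the point bounds the difference quotients; the added 1 is the
    tolerance with which a quotient approximates the derivative. *)
Lemma dI_bound (F : 'rV[R]_l -> R -> R -> R) i p t0 e0 : an3 F p t0 e0 ->
  exists r C : R, 0 < r /\ forall (x : 'rV[R]_l) (t e : R),
    (forall j, `|x ord0 j - p ord0 j| <= r) -> `|t - t0| <= r -> `|e - e0| <= r ->
    an3 F x t e -> `|dI F i x t e| <= C.
Proof.
move=> /an3_bdat /bdat_lip [r [C [r0 C0 H]]].
exists (r / 2), (C + 1); split; first by rewrite divr_gt0.
move=> x t e Hx Ht He HF.
have ev j : `|evec R i ord0 j| <= 1.
  by rewrite mxE; case: eqP => _; rewrite ?normr1 ?normr0.
have := an3_directional HF ev.
have -> : \sum_j dI F j x t e * evec R i ord0 j = dI F i x t e.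
  rewrite (bigD1 i) //= mxE eqxx mulr1 big1 ?addr0 // => j ji.
  by rewrite mxE (negbTE ji) mulr0.
move=> /(_ 1 ltr01) [d [d0 Hd]].
pose s := Num.min (r / 2) (d / 2).
have s0 : 0 < s by rewrite lt_min !divr_gt0.
have sr : s <= r / 2 by rewrite ge_min lexx.
have sd : s < d.
  have : s <= d / 2 by rewrite ge_min lexx orbT.
  lra.
have := Hd s; rewrite gtr0_norm // => /(_ sd).
rewrite add0r scale0r addr0 mul1r => h1.
have h2 : `|F (x + s *: evec R i) t e - F x t e| <= C * s.
  have Ev j : (x + s *: evec R i) ord0 j - x ord0 j = s * evec R i ord0 j by rewrite !mxE; ring.
  have Es j : `|s * evec R i ord0 j| <= s.
    by rewrite normrM gtr0_norm // ler_piMr // ltW.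
  apply: H.
  - exact: ltW.
  - move=> j; rewrite (_ : _ - _ = (x ord0 j - p ord0 j) + s * evec R i ord0 j).
      by apply: (le_trans (ler_normD _ _)); have := Es j; have := Hx j; lra.
    by rewrite -Ev; ring.
  - by move=> j; apply: le_trans (Hx j) _; lra.
  - by apply: le_trans Ht _; lra.
  - by apply: le_trans Ht _; lra.
  - by apply: le_trans He _; lra.
  - by apply: le_trans He _; lra.
  - by move=> j; rewrite Ev.
  - by rewrite subrr normr0 ltW.
  - by rewrite subrr normr0 ltW.
have h3 : `|dI F i x t e * s| <= (C + 1) * s.
  rewrite (_ : dI F i x t e * s = (F (x + s *: evec R i) t e - F x t e) -
    (F (x + s *: evec R i) t e - F x t e - dI F i x t e * s)); last by ring.
  by apply: (le_trans (ler_normB _ _)); rewrite mulrDl mul1r lerD.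
by move: h3; rewrite normrM (gtr0_norm s0) ler_pM2r.
Qed.

End CurveTools.

Section Picard.
Variables (R : realType) (l : nat) (h : 'rV[R]_l -> R -> R -> 'I_l -> R).
Variables (omega : 'rV[R]_l -> R) (g : 'rV[R]_l -> R -> R -> R) (T eps1 : R).
Hypotheses (T0 : 0 <= T) (heps1 : 0 < eps1).
Hypothesis hper : forall I t e i, h I (t + T) e i = h I t e i.
Hypothesis gper : forall I t e, g I (t + T) e = g I t e.
Hypothesis han : forall i I t e, `|e| < eps1 -> an3 (fun I t e => h I t e i) I t e.
Hypothesis gan : forall I t e, `|e| < eps1 -> an3 g I t e.
Hypothesis oman : forall I, analytic_at omega I.
Variables (p : 'rV[R]_l) (t1 : R).
Hypothesis omp : omega p != 0.

Definition freq I t e := omega I + e * g I t e.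

(* [h / freq], written so as to be continuous even where [freq] vanishes. *)
Definition slope I t e i : R :=
  h I t e i * freq I t e / Num.max (freq I t e ^+ 2) (omega p ^+ 2 / 4).

(** The default of [xget] occurs only for functions without a primitive; subtracting the value at
    [t1] makes every iterate start at [p]. *)
Definition primitive (f : R -> R) (t : R) : R :=
  let F := xget (fun _ => 0) [set F : R -> R | forall x, hasd F x (f x)] in F t - F t1.

Lemma primitive_hasd f x : continuous f -> hasd (primitive f) x (f x).
Proof.
move=> /antiderivative [F [_ HF]]; rewrite /primitive.
set G := xget _ _; have HG : forall x, hasd G x (f x).
  by rewrite /G; apply: (@xgetPex _ (fun _ => 0) [set F : R -> R | forall x, hasd F x (f x)]); exists F.
by have := hasd_B (HG x) (hasd_cst (G t1) x); rewrite subr0.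
Qed.

Fixpoint picard (M : nat) (e t : R) : 'rV[R]_l :=
  if M is M'.+1 then \row_i (p ord0 i + e * primitive (fun s => slope (picard M' e s) s e i) t)
  else p.

Lemma picard_t1 M e : picard M e t1 = p.
Proof.
by case: M => //= M; apply/rowP => i; rewrite mxE /primitive subrr mulr0 addr0.
Qed.

Let hbd i I t e : `|e| < eps1 -> bdat (fun I t e => h I t e i) I t e.
Proof. by move=> /(han i I t) /an3_bdat. Qed.
Let gbd I t e : `|e| < eps1 -> bdat g I t e.
Proof. by move=> /(gan I t) /an3_bdat. Qed.
Let obd I t e : bdat (fun I _ _ => omega I) I t e.
Proof. exact: bdat_lift. Qed.
Let e00 : `|0 : R| < eps1.
Proof. by rewrite normr0. Qed.

Lemma slope_cont (x : R -> 'rV[R]_l) e t i : `|e| < eps1 ->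
  (forall j, {for t, continuous (fun s => x s ord0 j)}) ->
  {for t, continuous (fun s => slope (x s) s e i)}.
Proof.
move=> ee Hx.
have ch := curve_cont (hbd i (x t) t ee) Hx.
have cg := curve_cont (gbd (x t) t ee) Hx.
have co := curve_cont (obd (x t) t e) Hx.
have cq : {for t, continuous (fun s => freq (x s) s e)}.
  by apply: cvgD; [exact: co|apply: cvgMl_tmp; exact: cg].
apply: cvgM; first by apply: cvgM.
have pos s : 0 < Num.max (freq (x s) s e ^+ 2) (omega p ^+ 2 / 4).
  by rewrite lt_max orbC divr_gt0 // exprn_even_gt0.
apply: cvgV; first by rewrite gt_eqF.
have -> : (fun s => Num.max (freq (x s) s e ^+ 2) (omega p ^+ 2 / 4)) =
   (fun s => freq (x s) s e ^+ 2) \max (fun _ => omega p ^+ 2 / 4) by [].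
apply: (@continuous_max R R _ _ t); last exact: cvg_cst.
exact: (cvgM cq cq).
Qed.

Lemma picard_cont M e t i : `|e| < eps1 -> {for t, continuous (fun s => picard M e s ord0 i)}.
Proof.
elim: M t i => [|M IH] t i ee; first exact: cvg_cst.
have c : continuous (fun s => slope (picard M e s) s e i).
  by move=> s; apply: slope_cont => // j; exact: IH.
rewrite (_ : (fun s => _) = (fun s => p ord0 i + e * primitive (fun s => slope (picard M e s) s e i) s));
  last by apply/funext => s; rewrite /= mxE.
apply: cvgD; first exact: cvg_cst.
by apply: cvgMl_tmp; apply: hasd_cont (primitive_hasd t c).
Qed.

Lemma picard_hasd M e t i : `|e| < eps1 ->
  hasd (fun s => picard M.+1 e s ord0 i) t (e * slope (picard M e t) t e i).
Proof.
move=> ee.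
have c : continuous (fun s => slope (picard M e s) s e i).
  by move=> s; apply: slope_cont => // j; exact: picard_cont.
have := hasd_D (hasd_cst (p ord0 i) t) (hasd_Z e (primitive_hasd t c)).
rewrite add0r => H eps /H [r [r0 Hr]]; exists r; split => // s /Hr.
by rewrite /= !mxE.
Qed.

Definition near_p (x : R -> R -> 'rV[R]_l) :=
  UE (fun C e t => forall i, `|x e t ord0 i - p ord0 i| <= C * `|e|).

Lemma freq_near (x : R -> R -> 'rV[R]_l) : near_p x ->
  UE (fun C e t => `|freq (x e t) t e - omega p| <= C * `|e| ^+ 1).
Proof.
move=> Hx.
have H1 := UE_lip0 (fun t => obd p t 0) Hx.
have H2 := UE_lip0 (fun t => gbd p t e00) Hx.
have H3 : UE (fun C e t => `|g p t 0| <= C).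
  apply: UE_loc => [C C' e t CC|t0]; first by move=> h1; apply: le_trans CC.
  have [r r0 Hr] := bdat_cont (gbd p t0 e00) ltr01.
  exists (1 + `|g p t0 0|), 1, r; split => // e t _ tr.
  have -> : g p t 0 = (g p t 0 - g p t0 0) + g p t0 0 by ring.
  apply: (le_trans (ler_normD _ _)); rewrite lerD2r; apply: Hr => [i||]; last 1 first.
  - by rewrite subrr normr0 ltW.
  - by rewrite subrr normr0 ltW.
  - exact: ltW.
apply: (UE_comb H1 (UE_comb H2 H3 (S := fun C e t => `|g (x e t) t e| <= C) _)) => [C C'|C C'].
  exists (`|C| + C'), 1; split => // e t e1 h1 h2.
  have -> : g (x e t) t e = (g (x e t) t e - g p t 0) + g p t 0 by ring.
  apply: (le_trans (ler_normD _ _)); apply: lerD => //; apply: (le_trans h1).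
  rewrite expr1; apply: (@le_trans _ _ (`|C| * `|e|)).
    by apply: ler_wpM2r => //; exact: ler_norm.
  by rewrite ler_piMr // ltW.
exists (C + C'), 1; split => // e t e1 h1 h2; rewrite /freq addrAC mulrDl.
apply: (le_trans (ler_normD _ _)); apply: lerD => //.
by rewrite normrM expr1 mulrC; apply: ler_wpM2r.
Qed.

Lemma freq_low (x : R -> R -> 'rV[R]_l) : near_p x ->
  UE (fun _ e t => `|omega p| / 2 <= `|freq (x e t) t e|).
Proof.
move=> /freq_near H; apply: (UE_weak H) => C.
have om0 : 0 < `|omega p| by rewrite normr_gt0.
have C1 : 0 < `|C| + 1 by rewrite ltr_wpDl.
exists 0, (`|omega p| / 2 / (`|C| + 1)); split; first by rewrite !divr_gt0.
move=> e t; rewrite ltr_pdivlMr // expr1 => ee Hq.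
have h1 : C * `|e| <= `|C| * `|e| by apply: ler_wpM2r => //; exact: ler_norm.
have := lerB_dist (omega p) (freq (x e t) t e); rewrite distrC => h2.
have := normr_ge0 e; lra.
Qed.

(** For small e, |freq| >= |omega p| / 2 makes [freq ^+ 2] the larger argument of the maximum, so
    the modified quotient is the true one. The 4 in [slope] is the square of this 2. *)
Lemma slope_eq (x : R -> R -> 'rV[R]_l) i : near_p x ->
  UE (fun _ e t => slope (x e t) t e i * freq (x e t) t e = h (x e t) t e i /\
        `|omega p| / 2 <= `|freq (x e t) t e|).
Proof.
move=> /freq_low H; apply: (UE_weak H) => C; exists C, 1; split => // e t _ ql; split => //.
have om0 : 0 < `|omega p| by rewrite normr_gt0.
rewrite /slope.
have q2 : omega p ^+ 2 / 4 <= freq (x e t) t e ^+ 2.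
  rewrite -[omega p ^+ 2]real_normK ?num_real // -[freq _ _ _ ^+ 2]real_normK ?num_real //.
  move: ql om0; move: `|omega p| `|freq _ _ _| => a b; nra.
rewrite max_l //.
have q0 : freq (x e t) t e != 0 by rewrite -normr_gt0; lra.
by field.
Qed.

Lemma slope_OB (x : R -> R -> 'rV[R]_l) m i : near_p x ->
  (forall j, OB T m (fun e t => x e t ord0 j)) -> OB T m (fun e t => slope (x e t) t e i).
Proof.
move=> Hx Hm.
have om0 : 0 < `|omega p| / 2 by rewrite divr_gt0 // normr_gt0.
have Hh : OB T m (fun e t => h (x e t) t e i).
  exact: (OB_comp (fun t => hbd i p t e00) (fun I t e => hper I t e i) Hx Hm).
have Hg : OB T m (fun e t => g (x e t) t e).
  exact: (OB_comp (fun t => gbd p t e00) gper Hx Hm).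
have Ho : OB T m (fun e t => omega (x e t)).
  exact: (OB_comp (fun t => obd p t 0) (fun _ _ _ => erefl) Hx Hm).
exact: (OB_div om0 (OB_D Ho (OB_e Hg)) Hh (slope_eq i Hx)).
Qed.

(** All orders m are carried together: order m of an iterate passes to its slope by [slope_OB], and
    integration makes it order m + 1 of the next iterate. Nearness to [p] is what allows the
    expansions at [p] to be composed. *)
Lemma picard_near M : near_p (picard M) /\ forall m i, OB T m (fun e t => picard M e t ord0 i).
Proof.
elim: M => [|M [IH1 IH2]].
  split=> [L|m i L].
    by exists 0, 1; split => // e t _ _ i; rewrite subrr normr0 mul0r.
  by exists `|p ord0 i|, 1; split => // e t _ _; apply: Bd_cst.
have HS i m := slope_OB i IH1 (IH2 m).
have Hd i : UE (fun _ e t => hasd (fun s => picard M.+1 e s ord0 i) t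
     (e * slope (picard M e t) t e i)).
  by move=> L; exists 0, eps1; split => // e t ee _; exact: picard_hasd.
have N1 : near_p (picard M.+1).
  apply: UE_all => [i C C' e t CC h1|i]; first by apply: le_trans h1 _; apply: ler_wpM2r.
  have Hb : UE (fun C e t => `|e * slope (picard M e t) t e i| <= C * `|e| ^+ 1).
    apply: (UE_weak (OB_bound (HS i 0%N))) => C; exists C, 1; split => // e t _ h1.
    by rewrite normrM expr1 mulrC; apply: ler_wpM2r.
  apply: (UE_weak (UE_drift t1 (Hd i) Hb)) => C; exists C, 1; split => // e t _.
  by rewrite picard_t1 expr1.
split => // m i.
have Hb : UE (fun C e t => `|picard M.+1 e t ord0 i| <= C).
  apply: (UE_weak N1) => C; exists (`|C| + `|p ord0 i|), 1; split => // e t e1 /(_ i) h1.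
  rewrite -[picard _ _ _ _ _](subrK (p ord0 i)); apply: (le_trans (ler_normD _ _)).
  rewrite lerD2r; apply: (le_trans h1); apply: (@le_trans _ _ (`|C| * `|e|)).
    by apply: ler_wpM2r => //; exact: ler_norm.
  by rewrite ler_piMr // ltW.
case: m => [|m].
  by apply: (UE_weak (UE_shift T 0 Hb)) => C; exists C, 1.
by apply: (OB_int T0 heps1 _ Hb (HS i m)) => e t ee; exact: picard_hasd.
Qed.

(** With a q = b and a' q' = b', one has (a - a') q = (b - b') - a' (q - q'), where q is bounded
    below. *)
Lemma slope_lip (x y : R -> R -> 'rV[R]_l) k i : near_p x -> near_p y ->
  (forall j, OB T 0 (fun e t => y e t ord0 j)) ->
  UE (fun C e t => forall i, `|x e t ord0 i - y e t ord0 i| <= C * `|e| ^+ k) ->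
  UE (fun C e t => `|slope (x e t) t e i - slope (y e t) t e i| <= C * `|e| ^+ k).
Proof.
move=> Hx Hy Hm Hxy.
have om0 : 0 < `|omega p| / 2 by rewrite divr_gt0 // normr_gt0.
have H1 := UE_lip (fun t => hbd i p t e00) Hx Hy Hxy.
have H2 := UE_lip (fun t => gbd p t e00) Hx Hy Hxy.
have H3 := UE_lip (fun t => obd p t 0) Hx Hy Hxy.
have H4 : UE (fun C e t => `|freq (x e t) t e - freq (y e t) t e| <= C * `|e| ^+ k).
  apply: (UE_comb H2 H3) => C C'; exists (`|C| + C'), 1; split => // e t e1 h2 h3.
  have -> : freq (x e t) t e - freq (y e t) t e =
    e * (g (x e t) t e - g (y e t) t e) + (omega (x e t) - omega (y e t)) by rewrite /freq; ring.
  apply: (le_trans (ler_normD _ _)); rewrite mulrDl; apply: lerD => //.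
  rewrite normrM; apply: (@le_trans _ _ (1 * (`|C| * `|e| ^+ k))); last by rewrite mul1r.
  apply: ler_pM => //; first exact: ltW.
  by apply: (le_trans h2); apply: ler_wpM2r; [rewrite exprn_ge0|exact: ler_norm].
have H5 := OB_bound (slope_OB i Hy Hm).
have H6 := UE_comb (slope_eq i Hx) (slope_eq i Hy)
  (S := fun _ e t => [/\ slope (x e t) t e i * freq (x e t) t e = h (x e t) t e i,
    `|omega p| / 2 <= `|freq (x e t) t e| &
    slope (y e t) t e i * freq (y e t) t e = h (y e t) t e i]) _.
have {}H6 := H6 (fun C C' => ex_intro _ 0 (ex_intro _ 1 (conj ltr01
  (fun e t _ '(conj a b) '(conj a' _) => And3 a b a')))).
apply: (UE_comb (UE_comb H1 H4 (S := fun C e t =>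
   `|h (x e t) t e i - h (y e t) t e i| <= C * `|e| ^+ k /\
   `|freq (x e t) t e - freq (y e t) t e| <= C * `|e| ^+ k) _) (UE_comb H5 H6
   (S := fun C e t => `|slope (y e t) t e i| <= C /\
    [/\ slope (x e t) t e i * freq (x e t) t e = h (x e t) t e i,
    `|omega p| / 2 <= `|freq (x e t) t e| &
    slope (y e t) t e i * freq (y e t) t e = h (y e t) t e i]) _)) => [C C'|C C'|C C'].
- exists (Num.max C C'), 1; split => // e t _ a b; split; [apply: le_trans a _|apply: le_trans b _];
  by apply: ler_wpM2r; rewrite ?exprn_ge0 // le_max lexx ?orbT.
- by exists C, 1; split.
exists ((C + `|C'| * C) / (`|omega p| / 2)), 1; split => // e t _ [a b] [c [d1 d2 d3]].
have q0 : 0 < `|freq (x e t) t e| by apply: lt_le_trans d2.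
have ek : 0 <= `|e| ^+ k by rewrite exprn_ge0.
have E : (slope (x e t) t e i - slope (y e t) t e i) * freq (x e t) t e =
  (h (x e t) t e i - h (y e t) t e i) - slope (y e t) t e i * (freq (x e t) t e - freq (y e t) t e).
  by rewrite -d1 -d3; ring.
have B : `|slope (x e t) t e i - slope (y e t) t e i| * `|freq (x e t) t e| <=
   (C + `|C'| * C) * `|e| ^+ k.
  rewrite -normrM E mulrDl; apply: (le_trans (ler_normB _ _)); apply: lerD => //.
  rewrite normrM -mulrA; apply: ler_pM => //.
  by apply: (le_trans c); exact: ler_norm.
rewrite mulrAC ler_pdivlMr //; apply: le_trans B; exact: ler_wpM2l.
Qed.

Lemma picard_step M :
  UE (fun C e t => forall i, `|picard M.+1 e t ord0 i - picard M e t ord0 i| <= C * `|e| ^+ M.+1).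
Proof.
elim: M => [|M IH].
  by apply: (UE_weak (picard_near 1).1) => C; exists C, 1; split => // e t _ H i; rewrite expr1.
apply: UE_all => [i|i]; first exact: mono_norm.
have [N1 O1] := picard_near M.+1; have [N0 O0] := picard_near M.
have HL := slope_lip i N1 N0 (O0 0%N) IH.
pose a e t := e * slope (picard M.+1 e t) t e i - e * slope (picard M e t) t e i.
have Hb : UE (fun C e t => `|a e t| <= C * `|e| ^+ M.+2).
  apply: (UE_weak HL) => C; exists C, 1; split => // e t _ h1.
  by rewrite /a -mulrBr normrM exprS mulrCA; apply: ler_wpM2l.
have Hd : UE (fun _ e t => hasd (fun s => picard M.+2 e s ord0 i - picard M.+1 e s ord0 i) t (a e t)).
  move=> L; exists 0, eps1; split => // e t ee _; apply: hasd_B; exact: picard_hasd.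
apply: (UE_weak (UE_drift t1 Hd Hb)) => C; exists C, 1; split => // e t _.
by rewrite !picard_t1 subrr subr0.
Qed.

(** At lowest order the slope is h(p, t, 0) / omega(p) with [p] frozen. Taken over one period, [H]
    yields the average of h. *)
Lemma picard_first_order M i (H : R -> R) : (forall t, hasd H t (h p t 0 i)) ->
  UE (fun C e t => `|picard M.+1 e t ord0 i - p ord0 i - e * ((H t - H t1) / omega p)|
     <= C * `|e| ^+ 2).
Proof.
move=> HH.
have [N O] := picard_near M.
have H1 := UE_lip0 (fun t => hbd i p t e00) N.
have H2 := freq_near N.
have H3 : UE (fun C e t => `|h p t 0 i| <= C).
  apply: UE_loc => [C C' e t CC|t0]; first by move=> h1; apply: le_trans CC.
  have [r r0 Hr] := bdat_cont (hbd i p t0 e00) ltr01.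
  exists (1 + `|h p t0 0 i|), 1, r; split => // e t _ tr.
  have -> : h p t 0 i = (h p t 0 i - h p t0 0 i) + h p t0 0 i by ring.
  apply: (le_trans (ler_normD _ _)); rewrite lerD2r; apply: Hr => [j||]; last 1 first.
  - by rewrite subrr normr0 ltW.
  - by rewrite subrr normr0 ltW.
  - exact: ltW.
pose a e t := e * slope (picard M e t) t e i - e * (h p t 0 i / omega p).
have om0 : 0 < `|omega p| by rewrite normr_gt0.
have Hb : UE (fun C e t => `|a e t| <= C * `|e| ^+ 2).
  apply: (UE_comb (UE_comb H1 H2 (S := fun C e t =>
     `|h (picard M e t) t e i - h p t 0 i| <= C * `|e| ^+ 1 /\
     `|freq (picard M e t) t e - omega p| <= C * `|e| ^+ 1) _)
    (UE_comb H3 (slope_eq i N) (S := fun C e t => `|h p t 0 i| <= C /\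
     (slope (picard M e t) t e i * freq (picard M e t) t e = h (picard M e t) t e i /\
      `|omega p| / 2 <= `|freq (picard M e t) t e|)) _)) => [C C'|C C'|C C'].
  - exists (Num.max C C'), 1; split => // e t _ u v; split; [apply: le_trans u _|apply: le_trans v _];
    by apply: ler_wpM2r; rewrite ?exprn_ge0 // le_max lexx ?orbT.
  - by exists C, 1; split.
  exists ((C + C' / `|omega p| * C) / (`|omega p| / 2)), 1.
  split => // e t _ [u v] [c [d1 d2]].
  have q0 : 0 < `|freq (picard M e t) t e|.
    by apply: lt_le_trans d2; rewrite divr_gt0.
  have E : (slope (picard M e t) t e i - h p t 0 i / omega p) * freq (picard M e t) t e =
    (h (picard M e t) t e i - h p t 0 i) -
     h p t 0 i / omega p * (freq (picard M e t) t e - omega p).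
    by rewrite -d1; field.
  have B : `|slope (picard M e t) t e i - h p t 0 i / omega p| * `|freq (picard M e t) t e| <=
     (C + C' / `|omega p| * C) * `|e| ^+ 1.
    rewrite -normrM E mulrDl; apply: (le_trans (ler_normB _ _)); apply: lerD => //.
    rewrite normrM -[X in _ <= X]mulrA; apply: ler_pM => //.
    by rewrite normrM normfV; apply: ler_wpM2r.
  rewrite /a -mulrBr normrM exprS mulrCA; apply: ler_wpM2l => //.
  rewrite mulrAC ler_pdivlMr ?divr_gt0 //; apply: le_trans B; exact: ler_wpM2l.
have Hd : UE (fun _ e t => hasd (fun s => picard M.+1 e s ord0 i - e * (H s / omega p)) t (a e t)).
  move=> L; exists 0, eps1; split => // e t ee _; apply: hasd_B; first exact: picard_hasd.
  apply: hasd_Z; rewrite mulrC.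
  have := hasd_Z (omega p)^-1 (HH t) => h1 eps /h1 [r [r0 Hr]]; exists r; split => // s /Hr.
  by rewrite ![(omega p)^-1 * H _]mulrC.
apply: (UE_weak (UE_drift t1 Hd Hb)) => C; exists C, 1; split => // e t _.
rewrite picard_t1; apply: le_trans; rewrite le_eqVlt; apply/orP; left; apply/eqP.
by congr (`| _ |); ring.
Qed.

(** * First integrals along Picard iterates *)

Section Integral.
Variables (F : 'rV[R]_l -> R -> R -> R) (rho eps0 : R).
Hypotheses (rho0 : 0 < rho) (eps00 : 0 < eps0).
Hypothesis Fan : forall (x : 'rV[R]_l) (t e : R), (forall i, `|x ord0 i - p ord0 i| < rho) -> `|e| < eps0 -> an3 F x t e.
Hypothesis Ffi : forall (x : 'rV[R]_l) (t e : R), (forall i, `|x ord0 i - p ord0 i| < rho) -> `|e| < eps0 ->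
  \sum_(i < l) dI F i x t e * (e * h x t e i) + dtheta F x t e * freq x t e = 0.

Lemma picard_in (x : R -> R -> 'rV[R]_l) : near_p x ->
  UE (fun _ e t => `|e| < eps0 /\ forall i, `|x e t ord0 i - p ord0 i| < rho).
Proof.
move=> H; apply: (UE_weak H) => C.
have C1 : 0 < `|C| + 1 by rewrite ltr_wpDl.
exists 0, (Num.min eps0 (rho / (`|C| + 1))); split; first by rewrite lt_min eps00 divr_gt0.
move=> e t; rewrite lt_min => /andP[e1 e2] h1; split => // i.
apply: (le_lt_trans (h1 i)); move: e2; rewrite ltr_pdivlMr // mulrC; apply: le_lt_trans.
apply: ler_wpM2r => //; apply: (le_trans (ler_norm _)); by rewrite lerDl.
Qed.

(** The iterate M + 1 moves with the slope taken at iterate M. Its own slope would annihilate the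
    derivative of [F], so only the difference of the two slopes remains, which is O(e^(M+1)) by
    [picard_step] and is multiplied by e. *)
Lemma first_integral_picard M :
  UE (fun C e t => `|F (picard M.+1 e t) t e - F p t1 e| <= C * `|e| ^+ M.+2).
Proof.
have [N0 O0] := picard_near M; have [N1 O1] := picard_near M.+1.
have Hin := picard_in N1.
have HdI : UE (fun C e t => forall i, `|dI F i (picard M.+1 e t) t e| <= C).
  apply: UE_all => [i C C' e t CC h1|i]; first exact: le_trans h1 CC.
  apply: UE_loc => [C C' e t CC h1|t0]; first exact: le_trans h1 CC.
  have an0 : an3 F p t0 0.
    by apply: Fan => [j|]; rewrite ?subrr normr0.
  have [r [C [r0 HC]]] := dI_bound i an0.
  have [C1 [d1 [d10 H1]]] := N1 (`|t0| + 1).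
  have [_ [d2 [d20 H2]]] := Hin (`|t0| + 1).
  have C10 : 0 < `|C1| + 1 by rewrite ltr_wpDl.
  exists C, (Num.min (Num.min d1 d2) (Num.min r (r / (`|C1| + 1)))), (Num.min 1 r).
  split; [by rewrite !lt_min d10 d20 r0 divr_gt0|by rewrite lt_min r0 ltr01|].
  move=> e t; rewrite !lt_min => /andP[/andP[e1 e2] /andP[e3 e4]] /andP[t2 tr].
  have tL : `|t| <= `|t0| + 1.
    have -> : t = t0 + (t - t0) by ring.
    by apply: (le_trans (ler_normD _ _)); rewrite lerD2l ltW.
  have [ee xr] := H2 e t e2 tL.
  apply: HC; [|exact: ltW|by rewrite subr0 ltW|exact: Fan].
  move=> j; apply: (le_trans (H1 e t e1 tL j)).
  move: e4; rewrite ltr_pdivlMr // mulrC => /ltW; apply: le_trans.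
  by apply: ler_wpM2r => //; apply: (le_trans (ler_norm _)); rewrite lerDl.
pose a e t := \sum_i dI F i (picard M.+1 e t) t e *
   (e * (slope (picard M e t) t e i - slope (picard M.+1 e t) t e i)).
have HL : UE (fun C e t => forall i,
    `|slope (picard M.+1 e t) t e i - slope (picard M e t) t e i| <= C * `|e| ^+ M.+1).
  apply: UE_all => [i|i]; first exact: mono_norm.
  exact: (slope_lip i N1 N0 (O0 0%N) (@picard_step M)).
have Hb : UE (fun C e t => `|a e t| <= C * `|e| ^+ M.+2).
  apply: (UE_comb HdI HL) => C C'; exists (l%:R * (`|C| * C')), 1; split => // e t _ h1 h2.
  apply: (le_trans (ler_norm_sum _ _ _)).
  apply: (@le_trans _ _ (\sum_(i < l) `|C| * C' * `|e| ^+ M.+2)); last first.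
    by rewrite sumr_const card_ord -[leLHS]mulr_natl mulrA.
  apply: ler_sum => i _; rewrite !normrM -mulrA; apply: ler_pM => //.
  - by apply: (le_trans (h1 i)); exact: ler_norm.
  - by rewrite [`|e| ^+ _]exprS mulrCA; apply: ler_wpM2l => //; rewrite distrC.
have Heq : UE (fun _ e t => (forall i,
   slope (picard M.+1 e t) t e i * freq (picard M.+1 e t) t e = h (picard M.+1 e t) t e i /\
   `|omega p| / 2 <= `|freq (picard M.+1 e t) t e|) /\
   `|omega p| / 2 <= `|freq (picard M.+1 e t) t e|).
  have Hall : UE (fun _ e t => forall i,
     slope (picard M.+1 e t) t e i * freq (picard M.+1 e t) t e = h (picard M.+1 e t) t e i /\
     `|omega p| / 2 <= `|freq (picard M.+1 e t) t e|).
    by apply: UE_all => [i C C' e t _ //|i]; exact: (slope_eq i N1).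
  by apply: (UE_comb Hall (freq_low N1)) => C C'; exists 0, 1; split.
have Hd : UE (fun _ e t => hasd (fun s => F (picard M.+1 e s) s e) t (a e t)).
  apply: (UE_comb Hin Heq) => _ _; exists 0, eps1; split => // e t ee [e0 xr] [Hs q2].
  have := an3_chain (Fan t xr e0) (fun i => picard_hasd M t i ee).
  suff -> : a e t = \sum_(i < l) dI F i (picard M.+1 e t) t e * (e * slope (picard M e t) t e i)
     + dtheta F (picard M.+1 e t) t e by [].
  rewrite /a; under eq_bigr do rewrite mulrBr mulrBr.
  rewrite sumrB; congr (_ + _); apply/eqP; rewrite eq_sym -addr_eq0 addrC.
  have q0 : freq (picard M.+1 e t) t e != 0.
    by rewrite -normr_gt0; apply: lt_le_trans q2; rewrite divr_gt0 // normr_gt0.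
  have := Ffi t xr e0; move=> /eqP.
  have -> : \sum_(i < l) dI F i (picard M.+1 e t) t e * (e * h (picard M.+1 e t) t e i) =
    (\sum_(i < l) dI F i (picard M.+1 e t) t e * (e * slope (picard M.+1 e t) t e i)) *
      freq (picard M.+1 e t) t e.
    rewrite mulr_suml; apply: eq_bigr => i _; have [<- _] := Hs i; ring.
  by rewrite -mulrDl mulf_eq0 (negbTE q0) orbF.
apply: (UE_weak (UE_drift t1 Hd Hb)) => C; exists C, 1; split => // e t _.
by rewrite picard_t1.
Qed.

End Integral.

End Picard.

(** * Polynomial interpolation *)

Section Interpolation.
Variable R : realType.

Fixpoint fdiff (j : nat) (u : nat -> R) : nat -> R :=
  if j is j'.+1 then fdiff j' (fun n => u n.+1 - u n) else u.

Lemma fdiff_Bd m s w (u : nat -> R) j : 0 <= w -> Bd m s w u -> (j <= m)%N ->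
  `|fdiff j u 0| <= s * w ^+ j.
Proof.
move=> w0; elim: m s u j => [|m IH] s u [|j] // HB jm.
- by rewrite expr0 mulr1; apply: Bd0 HB _.
- by rewrite expr0 mulr1; apply: Bd0 HB _.
- by case: HB => _ /IH /(_ jm); rewrite exprS mulrA.
Qed.

Lemma newton_forward (u : nat -> R) n : u n = \sum_(j < n.+1) 'C(n, j)%:R * fdiff j u 0.
Proof.
elim: n u => [|n IH] u; first by rewrite big_ord1 bin0 mul1r.
have E1 := IH u; have E2 := IH (fun n => u n.+1 - u n).
rewrite [LHS](_ : _ = u n + (u n.+1 - u n)); last by ring.
rewrite E2 E1.
have -> : \sum_(j < n.+1) 'C(n, j)%:R * fdiff j u 0 =
   \sum_(j < n.+2) 'C(n, j)%:R * fdiff j u 0.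
  by rewrite [RHS]big_ord_recr /= bin_small // mul0r addr0.
rewrite big_ord_recl [RHS]big_ord_recl !bin0 -addrA -big_split /=; congr (_ + _).
apply: eq_bigr => j _; rewrite /bump /= add1n binS natrD; ring.
Qed.

Lemma newton_forward_le (u : nat -> R) n N : (n <= N)%N ->
  u n = \sum_(j < N.+1) 'C(n, j)%:R * fdiff j u 0.
Proof.
move=> nN; rewrite newton_forward (big_ord_widen N.+1 (fun j => 'C(n, j)%:R * fdiff j u 0)) //.
rewrite big_mkcond; apply: eq_bigr => j _; case: ifP => // /negbT.
by rewrite -leqNgt => h; rewrite bin_small // mul0r.
Qed.

Definition binpoly (j : nat) : {poly R} :=
  (j`!%:R)^-1 *: \prod_(k < j) ('X - (k : nat)%:R%:P).

Lemma binpoly_horner j n : (binpoly j).[n%:R] = 'C(n, j)%:R.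
Proof.
rewrite /binpoly hornerZ horner_prod.
under eq_bigr do rewrite hornerXsubC.
have -> : \prod_(k < j) (n%:R - (k : nat)%:R) = (n ^_ j)%:R :> R.
  elim: j => [|j IH]; first by rewrite big_ord0 ffactn0.
  rewrite big_ord_recr /= IH ffactnSr natrM.
  have [jn|nj] := leqP j n; first by rewrite natrB.
  by rewrite ffact_small // !mul0r.
by rewrite -bin_ffact natrM mulrC mulfK // pnatr_eq0 -lt0n fact_gt0.
Qed.

Lemma size_binpoly j : (size (binpoly j) <= j.+1)%N.
Proof.
apply: (leq_trans (size_scale_leq _ _)); rewrite size_prod_XsubC.
by rewrite [index_enum _]unlock -enumT size_enum_ord.
Qed.

Lemma binpoly0 : binpoly 0 = 1.
Proof. by rewrite /binpoly big_ord0 fact0 invr1 scale1r. Qed.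

Lemma binpoly1 : binpoly 1 = 'X.
Proof. by rewrite /binpoly big_ord1 /= (_ : 1`!%:R = 1 :> R) // invr1 scale1r subr0. Qed.

(** In the Newton basis the coefficients are the iterated differences at 0, whose orders in e are
    known. *)
Definition interp N (u : nat -> R) : {poly R} := \sum_(j < N.+1) fdiff j u 0 *: binpoly j.

Lemma interp_horner N u n : (n <= N)%N -> (interp N u).[n%:R] = u n.
Proof.
move=> nN; rewrite (newton_forward_le u nN) /interp horner_sum; apply: eq_bigr => j _.
by rewrite hornerZ binpoly_horner mulrC.
Qed.

Lemma size_interp N u : (size (interp N u) <= N.+1)%N.
Proof.
apply: (leq_trans (size_sum _ _ _)); apply/bigmax_leqP => j _.
apply: (leq_trans (size_scale_leq _ _)); apply: (leq_trans (size_binpoly j)).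
exact: ltn_ord.
Qed.

(* [u e = O(e ^ k)] as [e] tends to 0; for [0 < k] this includes [u 0 = 0]. *)
Definition bO k (u : R -> R) := exists C d : R, [/\ 0 <= C, 0 < d & forall e, `|e| < d -> `|u e| <= C * `|e| ^+ k].

Lemma bO_ext k u v : (forall e, u e = v e) -> bO k u -> bO k v.
Proof. by move=> uv [C [d [C0 d0 H]]]; exists C, d; split => // e /H; rewrite uv. Qed.

Lemma bO0 k : bO k (fun _ => 0).
Proof. by exists 0, 1; split => // e _; rewrite normr0 mul0r. Qed.

Lemma bO_cst c : bO 0 (fun _ => c).
Proof. by exists `|c|, 1; split => // e _; rewrite expr0 mulr1. Qed.

Lemma bO_id : bO 1 id.
Proof. by exists 1, 1; split => // e _; rewrite expr1 mul1r. Qed.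

Lemma bO_D k u v : bO k u -> bO k v -> bO k (fun e => u e + v e).
Proof.
move=> [C [d [C0 d0 H]]] [C' [d' [C0' d0' H']]].
exists (C + C'), (Num.min d d'); split; [exact: addr_ge0|by rewrite lt_min d0|].
move=> e; rewrite lt_min => /andP[/H h /H' h'].
by apply: (le_trans (ler_normD _ _)); rewrite mulrDl lerD.
Qed.

Lemma bO_M k k' u v : bO k u -> bO k' v -> bO (k + k') (fun e => u e * v e).
Proof.
move=> [C [d [C0 d0 H]]] [C' [d' [C0' d0' H']]].
exists (C * C'), (Num.min d d'); split; [exact: mulr_ge0|by rewrite lt_min d0|].
move=> e; rewrite lt_min => /andP[/H h /H' h'].
by rewrite normrM exprD mulrACA ler_pM.
Qed.

Lemma bO_le k k' u : (k' <= k)%N -> bO k u -> bO k' u.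
Proof.
move=> kk [C [d [C0 d0 H]]]; exists C, (Num.min d 1); split => //; first by rewrite lt_min d0 /=.
move=> e; rewrite lt_min => /andP[/H h /ltW e1]; apply: (le_trans h); apply: ler_wpM2l => //.
by apply: ler_wiXn2l.
Qed.

Lemma bO_sum k (I : Type) (s : seq I) (P : pred I) (u : I -> R -> R) :
  (forall i, P i -> bO k (u i)) -> bO k (fun e => \sum_(i <- s | P i) u i e).
Proof.
move=> H; elim: s => [|i s IH].
  by apply: bO_ext (bO0 k) => e; rewrite big_nil.
case Pi : (P i).
  by apply: bO_ext (bO_D (H i Pi) IH) => e; rewrite big_cons Pi.
by apply: bO_ext IH => e; rewrite big_cons Pi.
Qed.

Lemma bO_Z k c u : bO k u -> bO k (fun e => c * u e).
Proof. by move=> H; have := bO_M (bO_cst c) H. Qed.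

Lemma bO_B k u v : bO k u -> bO k v -> bO k (fun e => u e - v e).
Proof. by move=> Hu /(bO_Z (-1)) Hv; apply: bO_ext (bO_D Hu Hv) => e; rewrite mulN1r. Qed.

(* The coefficient of degree [i] is [O(e ^ i)]: this class is a ring. *)
Definition pO (q : R -> {poly R}) :=
  (exists S, forall e, (size (q e) <= S)%N) /\ forall i, bO i (fun e => (q e)`_i).

Lemma pO_D q q' : pO q -> pO q' -> pO (fun e => q e + q' e).
Proof.
move=> [[S HS] H] [[S' HS'] H']; split.
  exists (maxn S S') => e; apply: (leq_trans (size_polyD _ _)).
  by rewrite geq_max !leq_max HS HS' orbT.
by move=> i; apply: bO_ext (bO_D (H i) (H' i)) => e; rewrite coefD.
Qed.

Lemma pO_M q q' : pO q -> pO q' -> pO (fun e => q e * q' e).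
Proof.
move=> [[S HS] H] [[S' HS'] H']; split.
  exists (S + S')%N => e; apply: (leq_trans (size_polyMleq _ _)).
  by apply: (leq_trans (leq_pred _)); rewrite leq_add.
move=> i; apply: (@bO_ext _ (fun e => \sum_(j < i.+1) (q e)`_j * (q' e)`_(i - j))).
  by move=> e; rewrite coefM.
apply: bO_sum => j _; have := bO_M (H j) (H' (i - j)%N).
by rewrite subnKC // -ltnS.
Qed.

Lemma pO_C (u : R -> R) : bO 0 u -> pO (fun e => (u e)%:P).
Proof.
move=> Hu; split; first by exists 1%N => e; exact: size_polyC_leq1.
move=> [|i]; first by apply: bO_ext Hu => e; rewrite coefC.
by apply: bO_ext (bO0 _) => e; rewrite coefC.
Qed.

Lemma pO_sum (I : Type) (s : seq I) (P : pred I) (q : I -> R -> {poly R}) :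
  (forall i, pO (q i)) -> pO (fun e => \sum_(i <- s | P i) q i e).
Proof.
move=> H; elim: s => [|i s IH].
  rewrite (_ : (fun e => _) = (fun _ => 0%:P)); first exact: pO_C (bO0 0).
  by apply/funext => e; rewrite big_nil.
case Pi : (P i).
  rewrite (_ : (fun e => _) = (fun e => q i e + \sum_(j <- s | P j) q j e)); first exact: pO_D.
  by apply/funext => e; rewrite big_cons Pi.
rewrite (_ : (fun e => _) = (fun e => \sum_(j <- s | P j) q j e)) //.
by apply/funext => e; rewrite big_cons Pi.
Qed.

Lemma pO_X (q : R -> {poly R}) n : pO q -> pO (fun e => q e ^+ n).
Proof.
move=> H; elim: n => [|n IH].
  rewrite (_ : (fun e => _) = (fun _ => 1%:P)); first exact: pO_C (bO_cst 1).
  by apply/funext => e; rewrite expr0.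
rewrite (_ : (fun e => _) = (fun e => q e * q e ^+ n)); first exact: pO_M.
by apply/funext => e; rewrite exprS.
Qed.

Lemma pO_prod (I : Type) (s : seq I) (q : I -> R -> {poly R}) :
  (forall i, pO (q i)) -> pO (fun e => \prod_(i <- s) q i e).
Proof.
move=> H; elim: s => [|i s IH].
  rewrite (_ : (fun e => _) = (fun _ => 1%:P)); first exact: pO_C (bO_cst 1).
  by apply/funext => e; rewrite big_nil.
rewrite (_ : (fun e => _) = (fun e => q i e * \prod_(j <- s) q j e)); first exact: pO_M.
by apply/funext => e; rewrite big_cons.
Qed.

Lemma interp_pO N (u : R -> nat -> R) : (forall j, (j <= N)%N -> bO j (fun e => fdiff j (u e) 0)) ->
  pO (fun e => interp N (u e)).
Proof.
move=> H; split; first by exists N.+1 => e; exact: size_interp.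
move=> i.
apply: (@bO_ext _ (fun e => \sum_(j < N.+1) fdiff j (u e) 0 * (binpoly j)`_i)).
  by move=> e; rewrite /interp coef_sum; apply: eq_bigr => j _; rewrite [RHS]coefZ.
apply: bO_sum => j _; have jN : (j <= N)%N by rewrite -ltnS.
have [ij|ji] := leqP i j.
  have := bO_M (bO_le ij (H j jN)) (bO_cst (binpoly j)`_i).
  by rewrite addn0.
apply: bO_ext (bO0 i) => e.
by rewrite nth_default ?mulr0 //; apply: (leq_trans (size_binpoly j)).
Qed.

(* By Lagrange interpolation the linear coefficient is a fixed combination of the
   values at 0, ..., N, up to the coefficients of degree above [N]. *)
Lemma pO_coef1 N (q : R -> {poly R}) (c : R -> R) : (0 < N)%N -> pO q ->
  (forall n, (n <= N)%N -> bO N.+1 (fun e => (q e).[n%:R] - c e)) ->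
  bO N.+1 (fun e => (q e)`_1).
Proof.
move=> N0 [[S HS] Hq] Hc.
pose x (n : nat) : R := n%:R.
have xinj : injective x by move=> a b /eqP; rewrite eqr_nat => /eqP.
pose L (i : 'I_N.+1) : R := (tnth (N.+1.-lagrange x) i : {poly R})`_1.
have lagrange1 (p : {poly R}) : (size p <= N.+1)%N -> p`_1 = \sum_(i < N.+1) p.[i%:R] * L i.
  move=> sp; have E := lagrange_gen (ltn0Sn N) xinj sp.
  rewrite {1}E coef_sum; apply: eq_bigr => i _.
  by rewrite coefCM.
(* The constant polynomial 1 has no linear coefficient; this removes [c e] from the combination. *)
have L1 : \sum_(i < N.+1) L i = 0.
  have := lagrange1 1; rewrite size_poly1 => /(_ isT); rewrite coef1 /= => h; rewrite [RHS]h.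
  by apply: eq_bigr => i _; rewrite hornerC mul1r.
have hi (n : nat) : bO N.+1 (fun e => (q e).[n%:R] - (take_poly N.+1 (q e)).[n%:R]).
  apply: (@bO_ext _ (fun e => \sum_(i < S + N.+1 | (N < i)%N) (q e)`_i * n%:R ^+ i)).
    move=> e; rewrite (@horner_coef_wide _ (S + N.+1) (q e)) ?(leq_trans (HS e)) ?leq_addr //.
    rewrite (@horner_coef_wide _ (S + N.+1) (take_poly N.+1 (q e))); last first.
      exact: (leq_trans (size_take_poly _ _) (leq_addl _ _)).
    rewrite -sumrB [LHS]big_mkcond; apply: eq_bigr => i _.
    by rewrite coef_take_poly ltnS; case: (leqP i N) => _; rewrite ?subrr // mul0r subr0.
  apply: bO_sum => i Ni; apply: (bO_le Ni).
  by have := bO_M (Hq i) (bO_cst (n%:R ^+ i)); rewrite addn0.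
apply: (@bO_ext _ (fun e => \sum_(i < N.+1) ((q e).[i%:R] - c e -
   ((q e).[i%:R] - (take_poly N.+1 (q e)).[i%:R])) * L i)).
  move=> e; have -> : (q e)`_1 = (take_poly N.+1 (q e))`_1 by rewrite coef_take_poly ltnS N0.
  rewrite lagrange1 ?size_take_poly //.
  rewrite [RHS](_ : _ = \sum_(i < N.+1) (take_poly N.+1 (q e)).[i%:R] * L i - c e * \sum_(i < N.+1) L i);
    last by rewrite L1 mulr0 subr0.
  rewrite mulr_sumr -sumrB.
  by apply: eq_bigr => i _; ring.
apply: bO_sum => i _.
have := bO_M (bO_B (Hc i _) (hi i)) (bO_cst (L i)); rewrite addn0; apply.
by rewrite -ltnS.
Qed.

(** The lowest term of [q] is k X^d. For d = 0 the polynomial must be exactly constant; otherwise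
    its higher terms would enter the linear coefficient of a product. *)
Definition low d (q : {poly R}) (k : R) :=
  [/\ forall j, (j < d)%N -> q`_j = 0, q`_d = k & d = 0%N -> q = k%:P].

Lemma low_M d d' q q' k k' : low d q k -> low d' q' k' -> low (d + d') (q * q') (k * k').
Proof.
move=> [H1 H2 H3] [H1' H2' H3']; split.
- move=> j jd; rewrite coefM big1 // => i _.
  have [id|di] := ltnP i d; first by rewrite H1 // mul0r.
  by rewrite H1' ?mulr0 //; have := ltn_ord i; lia.
- rewrite coefM.
  have dlt : (d < (d + d').+1)%N by rewrite ltnS leq_addr.
  rewrite (bigD1 (Ordinal dlt)) //= H2 addKn H2' big1 ?addr0 // => i.
  rewrite -val_eqE /= => id.
  have [id2|di] := ltnP i d; first by rewrite H1 // mul0r.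
  rewrite H1' ?mulr0 //; have := ltn_ord i; move/eqP: id; lia.
- by move=> /eqP; rewrite addn_eq0 => /andP[/eqP /H3 -> /eqP /H3' ->]; rewrite polyCM.
Qed.

Lemma low_1 : low 0 1 1.
Proof. by split => //; rewrite coef1. Qed.

Lemma low_X d q k n : low d q k -> low (n * d) (q ^+ n) (k ^+ n).
Proof.
move=> H; elim: n => [|n IH]; first by rewrite mul0n !expr0; exact: low_1.
by rewrite mulSn !exprS; exact: low_M.
Qed.

Lemma low_prod (I : Type) (s : seq I) (d : I -> nat) (q : I -> {poly R}) (k : I -> R) :
  (forall i, low (d i) (q i) (k i)) ->
  low (\sum_(i <- s) d i) (\prod_(i <- s) q i) (\prod_(i <- s) k i).
Proof.
move=> H; elim: s => [|i s IH]; first by rewrite !big_nil; exact: low_1.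
by rewrite !big_cons; exact: low_M.
Qed.

Lemma low_coef1 d q k : low d q k -> q`_1 = if d == 1%N then k else 0.
Proof.
case: d => [|[|d]] [H1 H2 H3] //=.
  by rewrite H3 // coefC.
exact: H1.
Qed.

End Interpolation.

(** * The linear relation between the gradients *)

Section LinearRelation.
Variables (R : realType) (l : nat).

Let i1 : 'I_2 := @Ordinal 2 1 isT.

(** Displacement from (p, t1, 0) as polynomials in the number of periods: theta stays at [t1] by
    periodicity, and eps enters as the constant e. *)
Definition packp (y : 'I_l -> {poly R}) (e : R) (j : 'I_(l + 2)) : {poly R} :=
  match fintype.split j with inl i => y i | inr k => if k == ord0 then 0 else e%:P end.

Lemma packp_I y e i : packp y e (lshift 2 i) = y i.
Proof. by rewrite /packp (unsplitK (inl i)). Qed.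
Lemma packp_t y e : packp y e (rshift l ord0) = 0.
Proof. by rewrite /packp (unsplitK (inr ord0)). Qed.
Lemma packp_e y e : packp y e (rshift l i1) = e%:P.
Proof. by rewrite /packp (unsplitK (inr i1)). Qed.
Definition packpE := (packp_I, packp_t, packp_e).

Definition taylor_poly (c : {ffun 'I_(l + 2) -> nat} -> R) N (z : 'I_(l + 2) -> {poly R}) : {poly R} :=
  \sum_(k < N) \sum_(a : {ffun 'I_(l + 2) -> 'I_k.+1} | (\sum_i (a i : nat))%N == k)
    (c (mi_of a))%:P * \prod_i z i ^+ a i.

Lemma taylor_poly_horner c N z (s : R) (x0 x : 'rV[R]_(l + 2)) :
  (forall j, (z j).[s] = x ord0 j - x0 ord0 j) ->
  (taylor_poly c N z).[s] = series (hom_part c x0 x) N.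
Proof.
move=> Hz; rewrite /taylor_poly /series /= big_mkord horner_sum; apply: eq_bigr => k _.
rewrite horner_sum; apply: eq_bigr => a _; rewrite hornerCM horner_prod; congr (_ * _).
by apply: eq_bigr => j _; rewrite horner_exp Hz ffunE.
Qed.

Lemma taylor_poly_pO c N (z : R -> 'I_(l + 2) -> {poly R}) : (forall j, pO (fun e => z e j)) ->
  pO (fun e => taylor_poly c N (z e)).
Proof.
move=> Hz; apply: pO_sum => k; apply: pO_sum => a; apply: pO_M; first exact: pO_C (bO_cst _).
by apply: pO_prod => j; exact: pO_X.
Qed.

(** The I entries have no constant term, so only monomials of degree 1 in I contribute. One of total
    degree k then leaves e^(k-1), hence N + 1 homogeneous parts yield N terms. *)
Lemma taylor_poly_coef1 c N (y : 'I_l -> {poly R}) (v : 'rV[R]_l) e :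
  (forall i, (y i)`_0 = 0) -> (forall i, (y i)`_1 = v ord0 i) ->
  (taylor_poly c N.+1 (packp y e))`_1 =
  series (fun b => ecoef c (@SI l) (dirv v) 1 b * e ^+ b) N.
Proof.
move=> y0 y1.
pose kap (j : 'I_(l + 2)) := (if SI j then 1 else e) * dirv v j.
have Hlow j : low (SI j) (packp y e j) (kap j).
  move: j; apply: pack_ind => [i||]; rewrite /kap ?SI_l ?SI_r packpE /dirv !pack3E.
  - by split=> //; [case|rewrite mul1r].
  - by rewrite mulr0; split => //; rewrite coef0.
  - by rewrite mulr1; split => //; rewrite coefC.
have key k (a : {ffun 'I_(l + 2) -> 'I_k.+1}) : (\sum_i (a i : nat))%N == k ->
    (\prod_i packp y e i ^+ a i)`_1 =
    if (\sum_(i | SI i) (a i : nat))%N == 1%N then (\prod_i dirv v i ^+ a i) * e ^+ k.-1 else 0.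
  move=> /eqP ak.
  have := low_coef1 (low_prod (index_enum _) (fun j => low_X (a j) (Hlow j))) => ->.
  have -> : (\sum_i a i * SI i)%N = (\sum_(i | SI i) (a i : nat))%N.
    by rewrite [RHS]big_mkcond; apply: eq_bigr => i _; case: (SI i); rewrite ?muln1 ?muln0.
  case: ifP => // /eqP a1.
  have Hx (i : 'I_(l + 2)) : (\row_j kap j) ord0 i - (0 : 'rV[R]_(l + 2)) ord0 i =
     (if SI i then 1 else e) * dirv v i by rewrite !mxE subr0.
  have := monom_split Hx ak; rewrite a1 expr1n mulr1 subn1 => <-.
  by rewrite /monom; apply: eq_bigr => j _; rewrite !mxE subr0 ffunE.
rewrite /taylor_poly coef_sum /series /= big_mkord big_ord_recl.
rewrite coef_sum big1 ?add0r => [|a a0]; last first.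
  rewrite coefCM key //; case: ifP => [/eqP a1|_]; last by rewrite mulr0.
  by move: a0; rewrite (bigID (@SI l)) /= a1.
apply: eq_bigr => b _; rewrite coef_sum /ecoef /ekcoef mulr_suml /bump /=.
rewrite [RHS](_ : _ = \sum_(a : {ffun 'I_(l + 2) -> 'I_(1 + b).+1} | (\sum_i (a i : nat))%N == (1 + b)%N)
   if (\sum_(i | SI i) (a i : nat))%N == 1%N then
     c (mi_of a) * (\prod_i dirv v i ^+ a i) * e ^+ b else 0); last first.
  by rewrite big_mkcondr.
apply: eq_bigr => a ak; rewrite coefCM key //.
by case: ifP => _; rewrite ?mulr0 // mulrA.
Qed.

(** [G] is the Taylor polynomial of [F] along the interpolated orbit. At n = 0, ..., N its values
    equal [F p t1 e] up to O(e^(N+1)), so [pO_coef1] bounds its linear coefficient. That coefficient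
    is a partial sum of the derivative of [F] along [v], and truncation leaves an error O(e^N). *)
Lemma linear_relation (F : 'rV[R]_l -> R -> R -> R) p t1 (eps0 : R) N (y : R -> nat -> 'rV[R]_l) :
  0 < eps0 -> (forall e, `|e| < eps0 -> an3 F p t1 e) -> (0 < N)%N ->
  (forall e, y e 0%N = 0) ->
  (exists C d : R, 0 < d /\ forall e, `|e| < d -> forall n i, (n <= N)%N -> `|y e n ord0 i| <= C * `|e|) ->
  (forall i, pO (fun e => interp N (fun n => y e n ord0 i))) ->
  (forall n, (n <= N)%N -> bO N.+1 (fun e => F (p + y e n) t1 e - F p t1 e)) ->
  bO N (fun e => \sum_i dI F i p t1 e * (interp N (fun n => y e n ord0 i))`_1).
Proof.
move=> eps00 Fan N0 y0 [K [d [d0 Hy]]] HpO HF.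
have F0 : an3 F p t1 0 by apply: Fan; rewrite normr0.
have [r [C [c [r0 C0 Hc Hf]]]] := analytic_bound F0.
pose Y e i := interp N (fun n => y e n ord0 i).
pose v e : 'rV[R]_l := \row_i (Y e i)`_1.
pose G e := taylor_poly c N.+1 (packp (Y e) e).
have GpO : pO G.
  apply: taylor_poly_pO; apply: pack_ind => [i||].
  - by under eq_fun do rewrite packpE; exact: HpO.
  - by under eq_fun do rewrite packpE; exact: pO_C (bO0 _ 0).
  - by under eq_fun do rewrite packpE; apply: pO_C (bO_le _ (bO_id R)).
(* The added 1 makes K' |e| also dominate the displacement e of the eps coordinate. *)
pose K' := `|K| + 1.
have K0 : 0 < K' by rewrite ltr_wpDl.
have Gn n : (n <= N)%N -> bO N.+1 (fun e => F (p + y e n) t1 e - (G e).[n%:R]).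
  move=> nN; exists (2 * C * (K' / r) ^+ N.+1), (Num.min d (r / 2 / K')); split.
  - by rewrite !mulr_ge0 // exprn_ge0 // divr_ge0 // ltW.
  - by rewrite lt_min d0 !divr_gt0.
  move=> e; rewrite lt_min => /andP[ed er].
  pose x := pack3 (p + y e n) t1 e.
  have GE : (G e).[n%:R] = series (hom_part c (pack3 p t1 0) x) N.+1.
    apply: taylor_poly_horner; apply: pack_ind => [i||]; rewrite packpE /x !pack3E.
    - by rewrite /Y interp_horner // !mxE; ring.
    - by rewrite horner0 subrr.
    - by rewrite hornerC subr0.
  rewrite GE.
  have KE : 0 <= K' * `|e| <= r / 2.
    apply/andP; split; first by rewrite mulr_ge0 // ltW.
    by rewrite mulrC -ler_pdivlMr // ltW.
  have := taylor_tail r0 C0 Hc Hf (s := K' * `|e|) N.+1 (x := x) KE.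
  rewrite /x !unpackE => H; apply: (le_trans (H _)).
    apply: pack_ind => [i||]; rewrite !pack3E.
    - rewrite !mxE [X in `|X|](_ : _ = y e n ord0 i); last by ring.
      apply: (le_trans (Hy e ed n i nN)); apply: ler_wpM2r => //.
      by apply: (le_trans (ler_norm _)); rewrite lerDl.
    - by rewrite subrr normr0 mulr_ge0 // ltW.
    - by rewrite subr0 ler_peMl // lerDr.
  by rewrite -[leRHS]mulrA -exprMn [K' * `|e| / r]mulrAC.
have Gc n : (n <= N)%N -> bO N.+1 (fun e => (G e).[n%:R] - F p t1 e).
  move=> nN; apply: bO_ext (bO_B (HF n nN) (Gn n nN)) => e; ring.
have G1 := pO_coef1 N0 GpO Gc.
have Yc e i : (Y e i)`_0 = 0.
  rewrite -horner_coef0 -[0]/(0%:R) /Y interp_horner // y0 mxE //.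
have GE e : (G e)`_1 = series (fun b => ecoef c (@SI l) (dirv (v e)) 1 b * e ^+ b) N.
  by apply: taylor_poly_coef1 => // i; rewrite mxE.
(* The expansion along a direction is available for entries bounded by 1; here [v e] is even
   O(e). *)
have [dv dv0 vsmall] : exists2 d, 0 < d & forall e, `|e| < d -> forall i, `|v e ord0 i| <= 1.
  have [||dv dv0 H] := @min_finite R 'I_l (fun i d => forall e, `|e| < d -> `|v e ord0 i| <= 1) _ _.
  - by move=> i a b /andP[_ ab] H e ea; apply: H; apply: lt_le_trans ab.
  - move=> i; have [B [b [B0 b0 HB]]] := (HpO i).2 1%N.
    have B1 : 0 < B + 1 by lra.
    exists (Num.min b (B + 1)^-1); first by rewrite lt_min b0 invr_gt0.
    move=> e; rewrite lt_min => /andP[/HB h e2]; rewrite mxE; apply: (le_trans h).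
    move: e2; rewrite expr1 -[_^-1]mul1r ltr_pdivlMr //; have := normr_ge0 e; nra.
  - by exists dv => // e ed i; apply: H.
have tail : bO N (fun e => \sum_i dI F i p t1 e * (Y e i)`_1 - (G e)`_1).
  exists (2 * (C / r) * r^-1 ^+ N), (Num.min (Num.min dv eps0) (r / 8)); split.
  - by rewrite !mulr_ge0 // ?exprn_ge0 // invr_ge0 ltW.
  - by rewrite !lt_min dv0 eps00 divr_gt0.
  move=> e; rewrite !lt_min => /andP[/andP[e1 e2] /ltW e3].
  have [D [HD hD]] := an3_direction_series r0 C0 Hc Hf (vsmall e e1) e3.
  have -> : \sum_i dI F i p t1 e * (Y e i)`_1 = D.
    have := an3_directional (Fan e e2) (vsmall e e1).
    under eq_bigr do rewrite mxE.
    by rewrite add0r in hD; move=> /(hasd_unique hD) ->.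
  rewrite GE -mulrA -exprMn [r^-1 * _]mulrC.
  apply: (@series_tail_geo R _ (C / r)) HD _; first by rewrite divr_ge0 // ltW.
    by apply/andP; split; [rewrite divr_ge0 // ltW|rewrite ler_pdivrMr //; lra].
  move=> b; rewrite normrM normrX exprMn exprVn mulrA mulrAC; apply: ler_wpM2r.
    exact: exprn_ge0.
  rewrite ler_pdivlMr ?exprn_gt0 // ler_pdivlMr // -mulrA -exprSr.
  apply: le_trans (Hc b.+1); apply: ler_wpM2r; first by rewrite exprn_ge0 // ltW.
  apply: (@ecoef_bound _ _ c (@SI l) (dirv (v e)) 1 b); apply: pack_ind => [i||];
    rewrite /dirv !pack3E ?normr0 ?normr1 //; exact: vsmall.
by apply: bO_ext (bO_D tail (bO_le (leqnSn N) G1)) => e; ring.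
Qed.

Lemma bO_prod (I : Type) (s : seq I) (u : I -> R -> R) :
  (forall i, bO 0 (u i)) -> bO 0 (fun e => \prod_(i <- s) u i e).
Proof.
move=> H; elim: s => [|i s IH].
  by apply: bO_ext (bO_cst 1) => e; rewrite big_nil.
by apply: bO_ext (bO_M (H i) IH) => e; rewrite big_cons.
Qed.

Lemma bO_det n (M : R -> 'M[R]_n) : (forall i j, bO 0 (fun e => M e i j)) ->
  bO 0 (fun e => \det (M e)).
Proof.
move=> H; apply: bO_sum => s _; apply: bO_Z; exact: bO_prod.
Qed.

Lemma bO_PS (u : R -> R) : PS u 0 -> bO 0 u.
Proof.
move=> [r [C [a [r0 C0 Ha Hu]]]]; exists (2 * C), (r / 2); split; rewrite ?mulr_ge0 ?divr_gt0 //.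
move=> e er; have er' : `|e| < r by lra.
have := Hu e er'; rewrite add0r => H.
have := @series_tail_geo R _ C (`|e| / r) _ C0 _ _ H 0.
rewrite /series /= big_geq // subr0; apply.
  by apply/andP; split; [rewrite divr_ge0 // ltW|rewrite ler_pdivrMr //; lra].
move=> k; rewrite normrM normrX exprMn exprVn mulrA mulrAC; apply: ler_wpM2r.
  exact: exprn_ge0.
by rewrite ler_pdivlMr ?exprn_gt0.
Qed.

(** Multiplication by the adjugate, whose entries stay bounded, covers singular matrices as well. *)
Lemma bO_cramer n N (M : R -> 'M[R]_n) (v : R -> 'I_n -> R) : (forall i j, bO 0 (fun e => M e i j)) ->
  (forall j, bO N (fun e => \sum_i M e j i * v e i)) ->
  forall i, bO N (fun e => \det (M e) * v e i).
Proof.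
move=> HM Hv i.
apply: (@bO_ext _ _ (fun e => \sum_j (\adj (M e)) i j * \sum_k M e j k * v e k)).
  move=> e.
  have : (\adj (M e) *m M e *m (\col_k v e k)) i ord0 = ((\det (M e))%:M *m (\col_k v e k)) i ord0.
    by rewrite mul_adj_mx.
  rewrite mul_scalar_mx -mulmxA !mxE => <-; apply: eq_bigr => j _; rewrite !mxE.
  by congr (_ * _); apply: eq_bigr => k _; rewrite !mxE.
apply: bO_sum => j _; have := bO_M _ (Hv j); rewrite -[X in bO X]add0n; apply.
apply: (@bO_ext _ _ (fun e => (-1) ^+ (j + i) * \det (row' j (col' i (M e))))).
  by move=> e; rewrite mxE /cofactor.
apply: bO_Z; apply: bO_det => a b.
by apply: bO_ext (HM (lift j a) (lift i b)) => e; rewrite !mxE.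
Qed.

(** A lower bound c |e|^k is incompatible with an upper bound of order k + 1 as e tends to 0. *)
Lemma bO_flat (u : R -> R) : PS u 0 -> (forall N, bO N u) -> locally_zero u 0.
Proof.
move=> /PS_dichotomy [//|[k [c [r [c0 r0 H]]]]] /(_ k.+1) [C [d [C0 d0 Hb]]]; exfalso.
pose e := Num.min (Num.min r d) (c / (C + 1)) / 2.
have C1 : 0 < C + 1 by lra.
have m0 : 0 < Num.min (Num.min r d) (c / (C + 1)) by rewrite !lt_min r0 d0 divr_gt0.
have e0 : 0 < e by rewrite divr_gt0.
have em : e < Num.min (Num.min r d) (c / (C + 1)) by rewrite /e; lra.
move: em; rewrite !lt_min => /andP[/andP[er ed] ec].
have ne : `|e| = e by rewrite gtr0_norm.
have := H e; have := Hb e; rewrite add0r ne => /(_ ed) h1 /(_ er) h2.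
have ek : 0 < e ^+ k by rewrite exprn_gt0.
have h3 := le_trans h2 h1.
move: h3; rewrite exprS mulrA ler_pM2r // => h3.
move: ec; rewrite ltr_pdivlMr //; nra.
Qed.

End LinearRelation.

(** * Averages over one period *)

Section Averages.
Variables (R : realType) (l : nat) (f : 'rV[R]_l -> R -> R -> R) (T eps1 : R).
Hypothesis eps10 : 0 < eps1.
Hypothesis fan : forall I t e, `|e| < eps1 -> an3 f I t e.
Hypothesis fper : forall I t e, f I (t + T) e = f I t e.
Variable H : 'rV[R]_l -> R -> R.
Hypothesis HH : forall I t, hasd (H I) t (f I t 0).

Let e00 : `|0 : R| < eps1.
Proof. by rewrite normr0. Qed.

Lemma section_cont I : continuous (fun t => f I t 0).
Proof.
move=> t; apply: (@curve_cont R l f (fun _ => I) t 0); first exact/an3_bdat/fan.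
by move=> i; exact: cvg_cst.
Qed.

Lemma period_const I a b : H I (a + T) - H I a = H I (b + T) - H I b.
Proof.
have hd t : hasd (fun t => H I (t + T) - H I t) t 0.
  by rewrite -(subrr (f I t 0)) -[X in hasd _ _ (X - _)]fper; apply: hasd_B => //; exact: hasd_shift.
have [ab|/ltW ba] := leP a b.
  exact: (@hasd_const R (fun t => H I (t + T) - H I t)).
by symmetry; exact: (@hasd_const R (fun t => H I (t + T) - H I t)).
Qed.

Lemma PS_average (I v : 'rV[R]_l) (t0 : R) : 0 <= T -> (forall i, `|v ord0 i| <= 1) ->
  PS (fun t => H (I + t *: v) T - H (I + t *: v) 0) t0.
Proof.
move=> T0 Hv.
apply: (@PS_integral R (fun t s => f (I + t *: v) s 0) (fun t => H (I + t *: v))) => //.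
move=> s0; have [r [C [r0 C0 K]]] := analytic_restrict (fan (I + t0 *: v) s0 e00).
have [|e [He Hs]] := K (@SI l) (fun j => pack3 v 1 0 ord0 j).
  by apply: pack_ind => [i||]; rewrite !pack3E ?normr0 ?normr1.
exists r, C, e; split => // t s tr sr.
have := Hs t s (pack3 (I + (t0 + t) *: v) (s0 + s) 0) tr sr; rewrite !unpackE; apply.
apply: pack_ind => [i||]; rewrite !pack3E ?SI_l ?SI_r.
- by rewrite !mxE; ring.
- by rewrite mulr1; ring.
- by rewrite mulr0 subrr.
Qed.

Lemma average_cont (I0 : 'rV[R]_l) : 0 <= T -> forall d : R, 0 < d -> exists2 r : R, 0 < r &
  forall I : 'rV[R]_l, (forall i, `|I ord0 i - I0 ord0 i| <= r) ->
    `|(H I T - H I 0) - (H I0 T - H I0 0)| <= d.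
Proof.
move=> T0 d d0.
(* Here the variable [e] of [UE] measures the distance from I to [I0] and is not the perturbation
   parameter. *)
have [|t0|C [r [r0 HC]]] := @UE_loc R (fun C e t => forall I : 'rV[R]_l,
  (forall i, `|I ord0 i - I0 ord0 i| <= `|e|) -> `|f I t 0 - f I0 t 0| <= C * `|e|) _ _ T.
- by move=> C C' e t CC K I /K h; apply: (le_trans h); apply: ler_wpM2r.
- have [r [C [r0 C0 K]]] := bdat_lip (an3_bdat (fan I0 t0 e00)).
  exists C, r, r; split => // e t er tr I HI; apply: K => //.
  + by move=> i; apply: le_trans (HI i) (ltW er).
  + by move=> i; rewrite subrr normr0 ltW.
  + exact: ltW.
  + exact: ltW.
  + by rewrite subrr normr0 ltW.
  + by rewrite subrr normr0 ltW.
  + by rewrite subrr normr0.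
  + by rewrite subrr normr0.
have D0 : 0 < `|C| * T + 1 by rewrite ltr_wpDl // mulr_ge0.
pose e := Num.min (r / 2) (d / (`|C| * T + 1)).
have e0 : 0 < e by rewrite lt_min !divr_gt0.
have er : `|e| < r.
  rewrite gtr0_norm //; have : e <= r / 2 by rewrite ge_min lexx.
  lra.
exists e => // I HI.
have -> : H I T - H I 0 - (H I0 T - H I0 0) = H I T - H I0 T - (H I 0 - H I0 0) by ring.
have := @hasd_bound R (fun t => H I t - H I0 t) (fun t => f I t 0 - f I0 t 0) 0 T (`|C| * e) T0.
move=> K; apply: le_trans (K _ _) _ => [t _|t /andP[t0 t1]|].
- exact: hasd_B.
- have := HC e t er; rewrite (ger0_norm t0) (gtr0_norm e0) => /(_ t1 I HI) h.
  by apply: (le_trans h); apply: ler_wpM2r; [exact: ltW|exact: ler_norm].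
- rewrite subr0; have : e * (`|C| * T + 1) <= d by rewrite -ler_pdivlMr // ge_min lexx orbT.
  nra.
Qed.

End Averages.

(** * From the linear relation to the determinant *)

Section Auxiliary.
Variable R : realType.

Lemma PS_id (t0 : R) : PS id t0.
Proof.
exists 1, (`|t0| + 1), (fun k => if k is k'.+1 then (k' == 0%N)%:R else t0); split => //.
  move=> [|[|k]]; rewrite ?expr1n mulr1 /=.
  - by rewrite lerDl.
  - by rewrite normr1 lerDr.
  - by rewrite normr0 addr_ge0.
move=> t _; apply: cvgn_dist => e e0; exists 2%N => [[|[|n]]] // _.
rewrite /series /= big_nat_recl // big_nat_recl //= big1 => [|i _]; last by rewrite mul0r.
by rewrite expr0 mulr1 expr1 mul1r addr0 subrr normr0 ltW.
Qed.

(** The first difference multiplies X in the Newton form, and the remaining terms carry differences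
    of order at least 2. Thus [eta] is the one-period increment up to O(e^2). *)
Lemma interp_coef1 N (u : R -> nat -> R) : (0 < N)%N ->
  (forall j, (j <= N)%N -> bO j (fun e => fdiff j (u e) 0)) ->
  bO 2 (fun e => (interp N (u e))`_1 - (u e 1%N - u e 0%N)).
Proof.
case: N => // N _ H.
apply: (@bO_ext _ _ (fun e => \sum_(j < N) fdiff j.+2 (u e) 0 * (binpoly R j.+2)`_1)).
  move=> e; rewrite /interp coef_sum big_ord_recl big_ord_recl /=.
  rewrite binpoly0 binpoly1 coefZ coef1 mulr0 add0r coefZ coefX mulr1 addrAC subrr add0r.
  by apply: eq_bigr => j _; rewrite [RHS]coefZ.
apply: bO_sum => j _.
have jN : (j.+2 <= N.+1)%N by have := ltn_ord j; lia.
have := bO_M (bO_le (isT : (2 <= j.+2)%N) (H _ jN)) (bO_cst (binpoly R j.+2)`_1).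
by rewrite addn0.
Qed.

(** For small e, |v e| >= |c| |e| / 2, so the factor [v e] may be exchanged for e. *)
Lemma bO_divide N (u v : R -> R) (c : R) : c != 0 -> bO 2 (fun e => v e - e * c) ->
  bO N (fun e => u e * v e) -> bO N (fun e => u e * e).
Proof.
move=> c0 [B [b [B0 b0 HB]]] [C [d [C0 d0 HC]]].
have cp : 0 < `|c| by rewrite normr_gt0.
have B1 : 0 < B + 1 by lra.
exists (2 / `|c| * C), (Num.min (Num.min b d) (`|c| / 2 / (B + 1))); split.
- by rewrite mulr_ge0 // divr_ge0 // ltW.
- by rewrite !lt_min b0 d0 !divr_gt0.
move=> e; rewrite !lt_min => /andP[/andP[/HB h1 /HC h2] e3].
have h3 : `|e| * `|c| / 2 <= `|v e|.
  have := lerB_dist (e * c) (v e); rewrite distrC normrM => h4.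
  have h5 : `|e| * (B + 1) <= `|c| / 2 by rewrite -ler_pdivlMr // ltW.
  have h6 : B * `|e| ^+ 2 <= `|e| * `|c| / 2.
    rewrite expr2 mulrA mulrC -mulrA; apply: ler_wpM2l => //.
    have := normr_ge0 e; nra.
  lra.
have h7 : `|u e * e| * (`|c| / 2) <= `|u e * v e|.
  rewrite !normrM -mulrA; apply: ler_wpM2l => //; by rewrite mulrA.
have -> : 2 / `|c| * C * `|e| ^+ N = (C * `|e| ^+ N) / (`|c| / 2).
  by field; rewrite gt_eqF.
by rewrite ler_pdivlMr ?divr_gt0 //; apply: le_trans h2.
Qed.

(** A left kernel vector of the I block also annihilates the last column, since q times that column
    is a combination of the columns of the block. It would then annihilate all of [A], against rank
    l. *)
Lemma rank_det (l : nat) (M : 'M[R]_l) (A : 'M[R]_(l, l + 1)) (x : 'I_l -> R) (q : R) :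
  (forall j i, A j (lshift 1 i) = M j i) -> q != 0 ->
  (forall j, \sum_i M j i * x i + A j (rshift l ord0) * q = 0) -> \rank A = l -> \det M != 0.
Proof.
move=> HM q0 HA rA; apply/negP => /det0P [w w0 wM].
have frA : row_free A by rewrite /row_free rA.
have wA : w *m A = 0.
  apply/rowP => k; rewrite !mxE -(fintype.splitK k); case: (fintype.split k) => /= [i|i].
    have := congr1 (fun v : 'rV[R]_l => v ord0 i) wM; rewrite !mxE => h.
    rewrite -[RHS]h; apply: eq_bigr => j _; by rewrite HM.
  rewrite ord1; apply: (mulIf q0); rewrite mul0r mulr_suml.
  have -> : \sum_j w ord0 j * A j (rshift l ord0) * q = - \sum_i (w *m M) ord0 i * x i.
    under [X in - X]eq_bigr do rewrite mxE mulr_suml.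
    rewrite exchange_big /= -sumrN; apply: eq_bigr => j _.
    rewrite -mulrA; have /eqP := HA j; rewrite addrC addr_eq0 => /eqP ->.
    by rewrite mulrN mulr_sumr; congr (- _); apply: eq_bigr => i2 _; rewrite mulrA.
  by rewrite wM big1 ?oppr0 // => i2 _; rewrite mxE mul0r.
by move: w0; rewrite -(mulmx_free_eq0 _ frA) wA eqxx.
Qed.

End Auxiliary.

(** * Conclusion *)

Section Degeneracy.
Variables (R : realType) (l : nat) (h : 'rV[R]_l -> R -> R -> 'I_l -> R).
Variables (omega : 'rV[R]_l -> R) (g : 'rV[R]_l -> R -> R -> R) (T eps1 : R).
Hypotheses (T0 : 0 <= T) (heps1 : 0 < eps1).
Hypothesis hper : forall I t e i, h I (t + T) e i = h I t e i.
Hypothesis gper : forall I t e, g I (t + T) e = g I t e.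
Hypothesis han : forall i I t e, `|e| < eps1 -> an3 (fun I t e => h I t e i) I t e.
Hypothesis gan : forall I t e, `|e| < eps1 -> an3 g I t e.
Hypothesis oman : forall I, analytic_at omega I.
Variables (p : 'rV[R]_l) (t1 : R).
Hypothesis omp : omega p != 0.
Variables (F : 'I_l -> 'rV[R]_l -> R -> R -> R) (rho eps0 : R).
Hypotheses (rho0 : 0 < rho) (eps00 : 0 < eps0).
Hypothesis Fper : forall j I t e, F j I (t + T) e = F j I t e.
Hypothesis Fan : forall j (x : 'rV[R]_l) (t e : R),
  (forall i, `|x ord0 i - p ord0 i| < rho) -> `|e| < eps0 -> an3 (F j) x t e.
Hypothesis Ffi : forall j (x : 'rV[R]_l) (t e : R),
  (forall i, `|x ord0 i - p ord0 i| < rho) -> `|e| < eps0 ->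
  \sum_(i < l) dI (F j) i x t e * (e * h x t e i) + dtheta (F j) x t e * freq omega g x t e = 0.
Variables (i0 : 'I_l) (H : R -> R).
Hypothesis HH : forall t, hasd H t (h p t 0 i0).
Hypothesis Hnz : H (t1 + T) - H t1 != 0.

Let jac (e : R) : 'M[R]_l := \matrix_(j, i) dI (F j) i p t1 e.

(** By Cramer's rule the determinant times [eta] is small to high order. Its component [i0] is
    comparable to e, which is where the factor e comes from; the factor does not affect flatness. *)
Lemma jacobian_flat N : bO N (fun e => \det (jac e) * e).
Proof.
(* Working at order N + 1 supplies the positive order that [linear_relation] and [interp_coef1]
   require. *)
apply: (bO_le (leqnSn N)).
pose X := picard h omega g p t1 N.+1.
have [NX OX] := picard_near T0 heps1 hper gper han gan oman t1 omp N.+1.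
pose y e n : 'rV[R]_l := X e (t1 + n%:R * T) - p.
have yE e n i : y e n ord0 i = X e (t1 + n%:R * T) ord0 i - p ord0 i.
  by rewrite /y; move: (X e _) => x; rewrite !mxE.
pose Y e i := interp N.+1 (fun n => y e n ord0 i).
have at_t1 (P : R -> R -> R -> Prop) : UE P -> exists C d : R, 0 < d /\ forall e, `|e| < d -> P C e t1.
  by move=> /(_ `|t1|) [C [d [d0 HC]]]; exists C, d; split => // e /HC; apply.
have y0 e : y e 0%N = 0 by rewrite /y mul0r addr0 /X picard_t1 subrr.
have y1 : exists C d : R, 0 < d /\ forall e, `|e| < d ->
    forall n i, (n <= N.+1)%N -> `|y e n ord0 i| <= C * `|e|.
  have [C [d [d0 HC]]] := at_t1 _ (UE_shift T N.+1 NX).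
  by exists C, d; split => // e ed n i nN; rewrite yE; apply: HC.
have yB i : exists C d : R, 0 < d /\ forall e, `|e| < d -> Bd N.+1 C `|e| (fun n => y e n ord0 i).
  have [C [d [d0 HC]]] := at_t1 _ (OX N.+1 i).
  exists (C + `|- p ord0 i|), d; split => // e ed.
  have := Bd_D (HC e ed) (Bd_cst N.+1 (normr_ge0 e) (lexx `|- p ord0 i|)).
  by apply: Bd_ext => n _; rewrite yE.
have yO i j : (j <= N.+1)%N -> bO j (fun e => fdiff j (fun n => y e n ord0 i) 0).
  move=> jN; have [C [d [d0 HC]]] := yB i.
  exists `|C|, d; split => // e ed.
  apply: (le_trans (fdiff_Bd (normr_ge0 e) (HC e ed) jN)).
  by apply: ler_wpM2r; [rewrite exprn_ge0|exact: ler_norm].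
have YO i : pO (fun e => Y e i) by apply: interp_pO; exact: yO.
have FO j n : (n <= N.+1)%N -> bO N.+2 (fun e => F j (p + y e n) t1 e - F j p t1 e).
  move=> nN.
  have := first_integral_picard T0 heps1 hper gper han gan oman t1 omp rho0 eps00 (Fan j) (Ffi j) N.
  move=> /(UE_shift T n) /at_t1 [C [d [d0 HC]]].
  exists `|C|, d; split => // e ed.
  have := HC e ed n (leqnn n); rewrite -/X.
  have -> : p + y e n = X e (t1 + n%:R * T) by rewrite /y addrC subrK.
  have -> : F j (X e (t1 + n%:R * T)) (t1 + n%:R * T) e = F j (X e (t1 + n%:R * T)) t1 e.
    move: (X e _) => x; elim: n {nN HC} => [|n IH]; first by rewrite mul0r addr0.
    by rewrite -natr1 mulrDl mul1r addrA Fper.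
  by move=> h1; apply: (le_trans h1); apply: ler_wpM2r; [rewrite exprn_ge0|exact: ler_norm].
have Fan1 j e : `|e| < eps0 -> an3 (F j) p t1 e.
  by apply: Fan => i; rewrite subrr normr0.
have rel j : bO N.+1 (fun e => \sum_i jac e j i * (Y e i)`_1).
  have := linear_relation eps00 (Fan1 j) (ltn0Sn N) y0 y1 YO (FO j).
  by apply: bO_ext => e; apply: eq_bigr => i _; rewrite mxE.
have ent j i : bO 0 (fun e => jac e j i).
  have f0 : `|0 : R| < eps0 by rewrite normr0.
  by apply: bO_ext (bO_PS (PS_dI i (Fan1 j 0 f0))) => e; rewrite mxE.
apply: (@bO_divide _ _ _ (fun e => (Y e i0)`_1) ((H (t1 + T) - H t1) / omega p)).
- by rewrite mulf_neq0 // invr_eq0.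
- have [C [d [d0 HC]]] := picard_first_order T0 heps1 hper gper han gan oman t1 omp N HH (`|t1| + T).
  have first : bO 2 (fun e => y e 1%N ord0 i0 - y e 0%N ord0 i0 - e * ((H (t1 + T) - H t1) / omega p)).
    exists `|C|, d; split => // e ed.
    have tT : `|t1 + T| <= `|t1| + T.
      by apply: (le_trans (ler_normD _ _)); rewrite (ger0_norm T0).
    have z0 : (0 : 'rV[R]_l) ord0 i0 = 0 by rewrite mxE.
    have := HC e (t1 + T) ed tT; rewrite y0 z0 subr0 yE mul1r => h1.
    by apply: (le_trans h1); apply: ler_wpM2r; [rewrite exprn_ge0|exact: ler_norm].
  apply: bO_ext (bO_D (interp_coef1 (ltn0Sn N) (yO i0)) first) => e.
  by rewrite -/(Y e i0); ring.
- exact: (bO_cramer ent rel i0).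
Qed.

(** Flatness gives vanishing only near eps = 0; the identity theorem on [[0, e]] carries it to the
    given e. *)
Lemma jacobian_zero e : 0 < e -> e < eps0 -> \det (jac e) = 0.
Proof.
move=> e0 ee.
have F1 j t : 0 <= t <= e -> an3 (F j) p t1 t.
  move=> /andP[t0 te]; apply: Fan; first by move=> i; rewrite subrr normr0.
  by rewrite ger0_norm //; apply: le_lt_trans ee.
have PSu t : 0 <= t <= e -> PS (fun e => \det (jac e) * e) t.
  move=> /F1 Ft; apply: PS_M; last exact: PS_id.
  by apply: PS_det => j i; under [X in PS X]eq_fun do rewrite mxE; apply: PS_dI.
have z0 : locally_zero (fun e => \det (jac e) * e) 0.
  by apply: bO_flat; [apply: PSu; rewrite lexx ltW|exact: jacobian_flat].
have /locally_zero_val /eqP := (PS_identity (ltW e0) PSu).1 z0.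
by rewrite mulf_eq0 (gt_eqF e0) orbF => /eqP.
Qed.

End Degeneracy.

Unset Implicit Arguments.

Theorem theorem4p3 (R : realType) (l : nat) (hl : (1 <= l)%N)
  (h : 'rV[R]_l -> R -> R -> 'I_l -> R) (omega : 'rV[R]_l -> R)
  (g : 'rV[R]_l -> R -> R -> R) (eps1 : R) (heps1 : 0 < eps1)
  (* h, g are functions on R^l x S^1 x R: 2pi-periodic in theta *)
  (hper : forall I t e i, h I (t + 2 * pi) e i = h I t e i)
  (gper : forall I t e, g I (t + 2 * pi) e = g I t e)
  (* real-analyticity in (I, theta, eps) *)
  (han : forall i, analytic3 (fun _ _ e => `|e| < eps1) (fun I t e => h I t e i))
  (gan : analytic3 (fun _ _ e => `|e| < eps1) g)
  (oman : analytic_on setT omega)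
  (I0 : 'rV[R]_l) (U : set 'rV[R]_l) (hU : nbhs I0 U)
  (hnz : exists I, U I /\ omega I != 0 /\ hhat0 h I != 0) :
  ~ exists (r eps0 : R) (F : 'I_l -> 'rV[R]_l -> R -> R -> R),
      let D := fun (I : 'rV[R]_l) (t e : R) =>
                 (forall i, `|I ord0 i - I0 ord0 i| < r) /\ `|e| < eps0 in
      [/\ 0 < r /\ 0 < eps0,
        (* F_j : (neighbourhood of I0) x S^1 x (-eps0, eps0) -> R *)
        (forall j I t e, F j I (t + 2 * pi) e = F j I t e),
        (* real-analytic in (I, theta, eps) *)
        (forall j, analytic3 D (F j)),
        (* first integrals for every eps *)
        (forall j, first_integral h omega g D (F j)) &
        (* functionally independent for each eps <> 0 *)
        (forall e, 0 < `|e| < eps0 ->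
           leb_null [set z : 'rV[R]_(l + 1) |
              D (lsubmx z) (rsubmx z ord0 ord0) e /\
              \rank (dIth F (lsubmx z) (rsubmx z ord0 ord0) e) != l])].
Proof.
move=> [r [eps0 [F [[r0 eps00] Fper Fan Ffi Fnull]]]].
have T0 : 0 < 2 * pi :> R by rewrite mulr_gt0 // pi_gt0.
have han' i I t e : `|e| < eps1 -> an3 (fun I t e => h I t e i) I t e.
  by move=> ee; apply: (analytic3_at (han i)).
have gan' I t e : `|e| < eps1 -> an3 g I t e by move=> ee; apply: (analytic3_at gan).
have oman' I : analytic_at omega I by exact: oman.
have [Is [_ [oms hs]]] := hnz.
have [i0 hi0] : exists i0, hhat0 h Is ord0 i0 != 0.
  apply: contrapT => H; move/eqP: hs; apply; apply/rowP => i; rewrite [RHS]mxE.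
  by apply/eqP/negPn/negP => Hi; apply: H; exists i.
pose f I t e := h I t e i0.
have fcont I : continuous (fun t => f I t 0).
  exact: (@section_cont R l f eps1 heps1 (han' i0)).
have [H HH] := choice (fun I => antiderivative (fcont I)).
have HH' I t : hasd (H I) t (f I t 0) by have [_] := HH I.
pose A I := H I (2 * pi) - H I 0.
have hA I : hhat0 h I ord0 i0 = (2 * pi)^-1 * A I.
  by rewrite mxE (@Rintegral_hasd R (fun t => f I t 0) (H I)).
have As : A Is != 0.
  by move: hi0; rewrite hA mulf_eq0 negb_or => /andP[].
(* [Is] need not lie in the domain of [F], hence the identity theorem on the segment
   from [I0] to [Is]. *)
have [p0 [p0r om0 A0]] : exists p0 : 'rV[R]_l,
    [/\ forall i, `|p0 ord0 i - I0 ord0 i| < r, omega p0 != 0 & A p0 != 0].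
  (* Dividing by [B] makes the entries of [v] at most 1, as [PS_line] and [PS_average] require; [Is]
     is then reached at parameter B. *)
  pose B := 1 + \sum_i `|Is ord0 i - I0 ord0 i|.
  have B1 : 1 <= B by rewrite lerDl sumr_ge0.
  have B0 : 0 < B by lra.
  pose v : 'rV[R]_l := B^-1 *: (Is - I0).
  have Hv i : `|v ord0 i| <= 1.
    rewrite !mxE normrM normfV (gtr0_norm B0) mulrC ler_pdivrMr // mul1r.
    by rewrite /B (bigD1 i) //= addrCA lerDl addr_ge0 // sumr_ge0.
  pose u t := omega (I0 + t *: v) * A (I0 + t *: v).
  have PSu t : 0 <= t <= B -> PS u t.
    move=> _; apply: PS_M; first exact: PS_line.
    exact: (@PS_average R l f _ eps1 heps1 (han' i0) H HH' I0 v t (ltW T0) Hv).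
  have uB : u B != 0.
    rewrite /u; have -> : I0 + B *: v = Is.
      by rewrite /v scalerA divff ?gt_eqF // scale1r addrC subrK.
    exact: mulf_neq0.
  have nz0 : ~ locally_zero u 0.
    move=> /(PS_identity (ltW B0) PSu).1 /locally_zero_val /eqP; exact/negP.
  (* If no admissible point existed, [u] would vanish for all |t| < r, since these parameters stay
     in the box of radius r. *)
  apply: contrapT => Hn; apply: nz0; exists r => // t tr; rewrite add0r.
  apply/eqP/negPn/negP => ut; apply: Hn; exists (I0 + t *: v).
  move: ut; rewrite mulf_eq0 negb_or => /andP[ut1 ut2]; split => // i.
  rewrite [X in `|X|](_ : _ = t * v ord0 i); last by rewrite !mxE; ring.
  by rewrite normrM; apply: le_lt_trans tr; rewrite ler_piMr.
have om0' : 0 < `|omega p0| by rewrite normr_gt0.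
have om4 : 0 < `|omega p0| / 4 by rewrite divr_gt0.
have e00 : `|0 : R| < eps1 by rewrite normr0.
have [r1 r10 H1] := bdat_cont (bdat_lift 0 0 (oman' p0)) om4.
have [r2 r20 H2] := bdat_cont (an3_bdat (gan' p0 0 0 e00)) (@ltr01 R).
have A2 : 0 < `|A p0| / 2 by rewrite divr_gt0 // normr_gt0.
have [r3 r30 H3] := @average_cont R l f _ eps1 heps1 (han' i0) H HH' p0 (ltW T0) _ A2.
have [r4 r40 H4] : exists2 d, 0 < d & forall i, d + `|p0 ord0 i - I0 ord0 i| < r.
  apply: (@min_finite R 'I_l (fun i d => d + `|p0 ord0 i - I0 ord0 i| < r)).
    by move=> i a b /andP[_ ab]; apply: le_lt_trans; rewrite lerD2r.
  move=> i; exists ((r - `|p0 ord0 i - I0 ord0 i|) / 2).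
    by rewrite divr_gt0 // subr_gt0.
  by have := p0r i; lra.
pose G := `|g p0 0 0| + 1.
have G0 : 0 < G by rewrite ltr_wpDl.
(* [e] is fixed before [p] and [t1], because the exceptional null set depends on it. Near (p0, 0) it
   keeps |e g| below |omega p0| / 4, and since |omega p| will be at least 3/4 of |omega p0|, omega +
   e g is nonzero at the point chosen next. *)
pose e := Num.min (Num.min eps0 eps1) (Num.min r2 (`|omega p0| / 4 / G)) / 2.
have em : 0 < Num.min (Num.min eps0 eps1) (Num.min r2 (`|omega p0| / 4 / G)).
  by rewrite !lt_min eps00 heps1 r20 divr_gt0.
have e0 : 0 < e by rewrite divr_gt0.
have : e < Num.min (Num.min eps0 eps1) (Num.min r2 (`|omega p0| / 4 / G)) by rewrite /e; lra.
rewrite !lt_min => /andP[/andP[ee0 ee1] /andP[er2 eG]].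
have ne : `|e| = e by rewrite gtr0_norm.
pose d := Num.min (Num.min r1 r2) (Num.min r3 r4).
have d0 : 0 < d by rewrite !lt_min r10 r20 r30 r40.
have [d1 d2 d3 d4] : [/\ d <= r1, d <= r2, d <= r3 & d <= r4].
  by rewrite /d !ge_min !lexx ?orbT.
have eD : 0 < `|e| < eps0 by rewrite ne e0.
(* The angle is sought near 0, where the bound on [g] holds. *)
have [z [zd Nz]] := null_box (row_mx p0 (const_mx 0)) (Fnull e eD) d0.
pose p := lsubmx z; pose t1 := rsubmx z ord0 ord0.
have pd i : `|p ord0 i - p0 ord0 i| < d.
  by have := zd (lshift 1 i); rewrite row_mxEl /p mxE.
have td : `|t1 - 0| < d.
  by have := zd (rshift l ord0); rewrite row_mxEr mxE /t1 mxE.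
have pr i : `|p ord0 i - I0 ord0 i| < r.
  have -> : p ord0 i - I0 ord0 i = (p ord0 i - p0 ord0 i) + (p0 ord0 i - I0 ord0 i) by ring.
  by apply: (le_lt_trans (ler_normD _ _)); have := pd i; have := H4 i; lra.
have omp : `|omega p0| * 3 / 4 <= `|omega p|.
  have := H1 p 0 0 (fun i => ltW (lt_le_trans (pd i) d1)).
  rewrite subrr normr0 => /(_ (ltW r10) (ltW r10)).
  have := lerB_dist (omega p0) (omega p); rewrite distrC; lra.
have omp0 : omega p != 0 by rewrite -normr_gt0; lra.
have Ap : A p != 0.
  rewrite -normr_gt0.
  have := H3 p (fun i => ltW (lt_le_trans (pd i) d3)); rewrite -/(A p) -/(A p0).
  have := lerB_dist (A p0) (A p); rewrite distrC; lra.
have gp : `|g p t1 e| <= G.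
  have := H2 p t1 e (fun i => ltW (lt_le_trans (pd i) d2)) (ltW (lt_le_trans td d2)).
  rewrite subr0 ne => /(_ (ltW er2)) h1.
  have -> : g p t1 e = (g p t1 e - g p0 0 0) + g p0 0 0 by ring.
  by apply: (le_trans (ler_normD _ _)); rewrite /G addrC lerD2l.
have fq : freq omega g p t1 e != 0.
  rewrite -normr_gt0 /freq.
  have h1 : `|e * g p t1 e| <= `|omega p0| / 4.
    rewrite normrM ne; apply: (@le_trans _ _ (e * G)); first by apply: ler_wpM2l => //; exact: ltW.
    by rewrite -ler_pdivlMr // ltW.
  have := lerB_normD (omega p) (e * g p t1 e); lra.
have rk : \rank (dIth F p t1 e) = l.
  apply: contrapT => /eqP hr; apply: Nz; split => //; split => //; by rewrite ne.
have detnz : \det (\matrix_(j, i) dI (F j) i p t1 e) != 0.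
  apply: (@rank_det R l _ (dIth F p t1 e) (fun i => e * h p t1 e i) (freq omega g p t1 e)) => //.
  - by move=> j i; rewrite !mxE (unsplitK (inl i)).
  - move=> j; have pD : (forall i, `|p ord0 i - I0 ord0 i| < r) /\ `|e| < eps0 by rewrite ne.
    have Ej := Ffi j p t1 e pD; rewrite /dIth mxE (unsplitK (inr ord0)) -[RHS]Ej.
    by congr (_ + _); apply: eq_bigr => i _; rewrite mxE.
have [rho rho0 Hrho] : exists2 d, 0 < d & forall i, d + `|p ord0 i - I0 ord0 i| < r.
  apply: (@min_finite R 'I_l (fun i d => d + `|p ord0 i - I0 ord0 i| < r)).
    by move=> i a b /andP[_ ab]; apply: le_lt_trans; rewrite lerD2r.
  move=> i; exists ((r - `|p ord0 i - I0 ord0 i|) / 2).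
    by rewrite divr_gt0 // subr_gt0.
  by have := pr i; lra.
have inD (x : 'rV[R]_l) : (forall i, `|x ord0 i - p ord0 i| < rho) ->
    forall i, `|x ord0 i - I0 ord0 i| < r.
  move=> hx i.
  have -> : x ord0 i - I0 ord0 i = (x ord0 i - p ord0 i) + (p ord0 i - I0 ord0 i) by ring.
  by apply: (le_lt_trans (ler_normD _ _)); have := hx i; have := Hrho i; lra.
have Fan' j (x : 'rV[R]_l) (t e' : R) :
    (forall i, `|x ord0 i - p ord0 i| < rho) -> `|e'| < eps0 -> an3 (F j) x t e'.
  by move=> /inD hx he; apply: (analytic3_at (Fan j)).
have Ffi' j (x : 'rV[R]_l) (t e' : R) :
    (forall i, `|x ord0 i - p ord0 i| < rho) -> `|e'| < eps0 ->
  \sum_(i < l) dI (F j) i x t e' * (e' * h x t e' i) + dtheta (F j) x t e' * freq omega g x t e' = 0.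
  by move=> /inD hx he; apply: Ffi.
have Hnz : H p (t1 + 2 * pi) - H p t1 != 0.
  by rewrite (@period_const R l f (2 * pi) (fun I t e => hper I t e i0) H HH' p t1 0) add0r.
have := @jacobian_zero R l h omega g (2 * pi) eps1 (ltW T0) heps1 hper gper han' gan' oman'
  p t1 omp0 F rho eps0 rho0 eps00 Fper Fan' Ffi' i0 (H p) (HH' p) Hnz e e0 ee0.
by apply/eqP.
Qed.
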